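(* Let $\{Y(t),\rho(t)\}_{t\ge 0}$ be a flexible Markov-modulated Brownian motion on $[0,b]$ with phase space $\mathcal{E}=\{1,\dots,m\}$, generator $Q$, drift vector $\boldsymbol\mu$, variance vector $\boldsymbol\sigma^2$ (with all $\sigma_i>0$) and boundary switching matrices $P^\circ$ (at level $0$) and $P^\bullet$ (at level $b$), and assume that the matrix $D(\infty)$ defined in the context is irreducible. Then its stationary distribution is \[ \Pi(x) = (\boldsymbol\nu\,\boldsymbol m)^{-1}\,\boldsymbol\nu\, M(x), \qquad x\in[0,b], \] where $\boldsymbol\nu=\begin{bmatrix}\boldsymbol\nu_0 & \boldsymbol\nu_b\end{bmatrix}$ with \[ \boldsymbol\nu_0=\boldsymbol\nu_0 H_0 P^\bullet H_b P^\circ,\qquad \boldsymbol\nu_b=\boldsymbol\nu_0 H_0 P^\bullet, \] the row vector $\boldsymbol\nu_0$ being unique up to a multiplicative constant, $M(x)=\begin{bmatrix} M_0(x)\\ M_b(x)\end{bmatrix}$ (a $2m\times m$ matrix), and $\boldsymbol m=M(b)\boldsymbol 1$.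
   Context: Let $\mathcal{E}=\{1,\dots,m\}$, $Q$ a generator on $\mathcal{E}$ (not necessarily irreducible), $\boldsymbol\mu\in\mathbb{R}^m$, $\boldsymbol\sigma\in(0,\infty)^m$, $\Delta_\mu=\mathrm{diag}(\mu_i)$, $\Delta_\sigma=\mathrm{diag}(\sigma_i)$, and $b>0$. A free MMBM is $\{X(t),\kappa(t)\}$ where $\kappa$ is a Markov chain with generator $Q$ and $X(t)=X(0)+\int_0^t\mu_{\kappa(s)}ds+\int_0^t\sigma_{\kappa(s)}dB(s)$, $B$ a standard Brownian motion independent of $\kappa$. The MMBM regulated at $0$ and $b$ is $Z(t)=X(t)+R_0(t)-R_b(t)$, where $R_0,R_b$ are the minimal continuous nondecreasing processes keeping $Z$ in $[0,b]$, $R_0$ increasing only when $Z=0$ and $R_b$ only when $Z=b$. For this regulated process let $\delta_y=\inf\{t>0: Z(t)=y\}$ and define the $m\times m$ matrices $(H_0)_{ij}=P[\delta_b<\infty,\kappa(\delta_b)=j\mid Z(0)=0,\kappa(0)=i]$, $(H_b)_{ij}=P[\delta_0<\infty,\kappa(\delta_0)=j\mid Z(0)=b,\kappa(0)=i]$, $(M_0(x))_{ij}=E[\int_0^{\delta_b}\mathbf 1\{Z(s)\in[0,x],\kappa(s)=j\}ds\mid Z(0)=0,\kappa(0)=i]$, $(M_b(x))_{ij}=E[\int_0^{\delta_0}\mathbf 1\{Z(s)\in[0,x],\kappa(s)=j\}ds\mid Z(0)=b,\kappa(0)=i]$. Let $P^\circ,P^\bullet$ be $m\times m$ stochastic matrices.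 The flexible MMBM $\{Y(t),\rho(t)\}$ is constructed as follows: $\theta_0=0$, $Y(0)=0$, $\rho(0)=i$. On $[\theta_n,\theta_{n+1})$ the process evolves as an independent copy of the regulated MMBM $(Z,\kappa)$ started at level $Y(\theta_n)$ in phase $\rho(\theta_n)$, where $\theta_{n+1}$ is the first time after $\theta_n$ at which this copy reaches the other boundary (level $b$ if $n$ is even, level $0$ if $n$ is odd). At $\theta_{n+1}$ the phase instantaneously jumps: the new phase $\rho(\theta_{n+1})$ is drawn from row $\rho(\theta_{n+1}^-)$ of $P^\bullet$ if $Y(\theta_{n+1})=b$ and of $P^\circ$ if $Y(\theta_{n+1})=0$, where $\rho(\theta^-)$ denotes the left limit; $\rho$ is right-continuous. Let $D(\infty)$ be the transition matrix on $\{0,b\}\times\mathcal{E}$ with entries $P[Y(\theta_{n+1})=y,\rho(\theta_{n+1}^-)=j\mid Y(\theta_n)=x,\rho(\theta_n^-)=i]$. The stationary distribution $\Pi(x)$ is the row vector indexed by $\mathcal{E}$ whose $j$-th component is the long-run fraction of time with $Y(t)\in[0,x]$ and $\rho(t)=j$. $\boldsymbol 1$ is a column vector of ones. *)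

(* Defs.v *)
From HB Require Import structures.
From mathcomp Require Import all_boot all_order all_algebra.
From mathcomp Require Import all_classical all_reals all_analysis.
From mathcomp Require Import normal_distribution.

Set Implicit Arguments.
Unset Strict Implicit.
Unset Printing Implicit Defensive.
Import Order.TTheory GRing.Theory Num.Theory.
Import numFieldTopology.Exports.
Local Open Scope classical_set_scope.
Local Open Scope ring_scope.

Section FlexibleMMBM.
Context {R : realType} {m : nat}.
Context {d : measure_display} {T : measurableType d}.

Definition generator (Q : 'M[R]_m) : Prop :=
  (forall i j, i != j -> 0 <= Q i j) /\ (forall i, \sum_j Q i j = 0).

Definition stochastic {n : nat} (A : 'M[R]_n) : Prop :=
  (forall i j, 0 <= A i j) /\ (forall i, \sum_j A i j = 1).

Definition expmx (Q : 'M[R]_m) (t : R) : 'M[R]_m :=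
  \matrix_(i, j) limn (fun N => \sum_(n < N) (t ^+ n / (n`!)%:R * (Q ^+ n) i j)).

Definition irreducible_mx {n : nat} (A : 'M[R]_n) : Prop :=
  forall u v : 'I_n, exists k : nat, 0 < (A ^+ k) u v.

Definition step_path (k : R -> 'I_m) : Prop :=
  forall Tm, 0 < Tm -> exists (N : nat) (s : nat -> R),
    s 0%N = 0 /\ Tm <= s N /\
    forall l, (l < N)%N -> s l < s l.+1 /\
      forall u, s l <= u < s l.+1 -> k u = k (s l).

Definition left_lim (k : R -> 'I_m) (t : R) (l : 'I_m) : Prop :=
  exists2 e : R, 0 < e & forall u, t - e < u < t -> k u = l.

(** Pathwise description of the regulated MMBM on [0,b] started at level y,
    driven by the phase path k and the Brownian path W:
    X(t) = y + \int_0^t mu_{k(s)} ds + \int_0^t sigma_{k(s)} dW(s)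
    (for a piecewise constant integrand, the stochastic integral is the
    pathwise sum of sigma_i times the Brownian increments), and
    Z = X + R0 - Rb is the two-sided Skorokhod regulation of X on [0,b]:
    R0, Rb continuous nondecreasing, null at 0, R0 increasing only when
    Z = 0 and Rb only when Z = b. *)
Definition regulated_path (mu sigma : 'I_m -> R) (b y : R)
    (k : R -> 'I_m) (W : R -> R) (Z : R -> R) : Prop :=
  exists X R0 Rb : R -> R,
    X 0 = y /\
    {within [set t | 0 <= t], continuous X} /\
    (forall s t, 0 <= s <= t -> (forall u, s <= u < t -> k u = k s) ->
       X t - X s = mu (k s) * (t - s) + sigma (k s) * (W t - W s)) /\
    R0 0 = 0 /\ Rb 0 = 0 /\
    {within [set t | 0 <= t], continuous R0} /\
    {within [set t | 0 <= t], continuous Rb} /\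
    (forall s t, 0 <= s <= t -> R0 s <= R0 t /\ Rb s <= Rb t) /\
    (forall t, 0 <= t -> Z t = X t + R0 t - Rb t /\ 0 <= Z t <= b) /\
    (forall s t, 0 <= s <= t -> (forall u, s <= u <= t -> Z u != 0) ->
       R0 t = R0 s) /\
    (forall s t, 0 <= s <= t -> (forall u, s <= u <= t -> Z u != b) ->
       Rb t = Rb s).

Definition hit (Z : R -> R) (y : R) : \bar R :=
  ereal_inf [set t%:E | t in [set t | 0 < t /\ Z t = y]].

Definition tprev (t : nat -> R) (l : nat) : R :=
  if l is l'.+1 then t l' else 0.
Definition kprev (i : 'I_m) (k : nat -> 'I_m) (l : nat) : 'I_m :=
  if l is l'.+1 then k l' else i.

Definition time_grid (L : nat) (t : nat -> R) : Prop :=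
  0 < t 0%N /\ forall l, (l.+1 < L)%N -> t l < t l.+1.

Definition cyl_event (kap : R -> T -> 'I_m) (W : R -> T -> R)
   (L : nat) (t : nat -> R) (k : nat -> 'I_m) (A : nat -> set R) : set T :=
  [set w | forall l, (l < L)%N ->
     kap (t l) w = k l /\ A l (W (t l) w - W (tprev t l) w)].

(** (kap, W) is a Markov chain with generator Q started in phase i together
    with an independent standard Brownian motion: finite-dimensional
    distributions (product of exp(Q dt) transition probabilities and of
    independent N(0, dt) increments). *)
Definition MC_BM_fdd (P : probability T R) (Q : 'M[R]_m) (i : 'I_m)
   (kap : R -> T -> 'I_m) (W : R -> T -> R) : Prop :=
  forall L t k A, time_grid L t -> (forall l, measurable (A l)) ->
    P (cyl_event kap W L t k A) =
      ((\prod_(l < L) expmx Q (t l - tprev t l) (kprev i k l) (k l))%:E *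
       \prod_(l < L) normal_prob 0 (Num.sqrt (t l - tprev t l)) (A l))%E.

Definition cyl_class (kap : R -> T -> 'I_m) (W : R -> T -> R) : set (set T) :=
  [set E | exists L t k A, time_grid L t /\ (forall l, measurable (A l)) /\
           E = cyl_event kap W L t k A].

Definition mutually_independent {I : eqType} (P : probability T R)
    (F : I -> set (set T)) : Prop :=
  forall (S : seq I) (E : I -> set T), uniq S ->
    (forall s, s \in S -> F s (E s)) ->
    P (\big[setI/setT]_(s <- S) E s) = (\prod_(s <- S) P (E s))%E.

Definition seg_start (b : R) (n : nat) : R := if odd n then b else 0.
Definition seg_target (b : R) (n : nat) : R := if odd n then 0 else b.

(** The flexible MMBM (Y, rho) started at Y(0) = 0, rho(0) = i0, built from
    independent ingredients: for every segment number n and every phase i,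
    (kap n i, W n i) is a Markov chain with generator Q started at i with an
    independent Brownian motion, Z n i is the corresponding regulated MMBM
    started at level seg_start b n; J n i is the phase drawn from row i of
    P^o (n even, jump at level 0) or P^* (n odd, jump at level b).
    theta n are the switching epochs, phi n = rho(theta_n) the phase at the
    start of segment n.  On [theta_n, theta_{n+1}) (Y, rho) follows segment
    n run from phase phi n; theta_{n+1} - theta_n is the first passage time
    of that segment to the other boundary; phi (n+1) = J (n+1) l where l is
    the left limit rho(theta_{n+1}^-). *)
Definition flexible_MMBM (P : probability T R) (Q : 'M[R]_m)
    (mu sigma : 'I_m -> R) (b : R) (Pc Pb : 'M[R]_m) (i0 : 'I_m)
    (kap : nat -> 'I_m -> R -> T -> 'I_m) (W : nat -> 'I_m -> R -> T -> R)
    (Z : nat -> 'I_m -> R -> T -> R) (J : nat -> 'I_m -> T -> 'I_m)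
    (theta : nat -> T -> \bar R) (phi : nat -> T -> 'I_m)
    (Y : R -> T -> R) (rho : R -> T -> 'I_m) : Prop :=
   (forall n i w,
     kap n i 0 w = i /\ W n i 0 w = 0 /\
     step_path (kap n i ^~ w) /\
     {within [set t | 0 <= t], continuous (W n i ^~ w)} /\
     regulated_path mu sigma b (seg_start b n)
       (kap n i ^~ w) (W n i ^~ w) (Z n i ^~ w)) /\
   (forall n i t k, measurable [set w | kap n i t w = k]) /\
   (forall n i t, measurable_fun setT (W n i t)) /\
   (forall n i k, measurable [set w | J n i w = k]) /\
   (forall n i, MC_BM_fdd P Q i (kap n i) (W n i)) /\
   (forall n i k, P [set w | J n i w = k] =
                    (if odd n then Pb i k else Pc i k)%:E) /\
   mutually_independent P
     (fun x : (nat * 'I_m) + (nat * 'I_m) => match x with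
        | inl (n, i) => <<s cyl_class (kap n i) (W n i) >>
        | inr (n, i) => [set J n i @^-1` A | A in [set: set 'I_m]]
        end) /\
   (forall w,
     theta 0%N w = 0%E /\ phi 0%N w = i0 /\
     forall n,
       theta n.+1 w =
         (theta n w + hit (Z n (phi n w) ^~ w) (seg_target b n))%E /\
       (forall r t, theta n w = r%:E -> r <= t -> (t%:E < theta n.+1 w)%E ->
          Y t w = Z n (phi n w) (t - r) w /\
          rho t w = kap n (phi n w) (t - r) w) /\
       (forall r dl l, theta n w = r%:E ->
          hit (Z n (phi n w) ^~ w) (seg_target b n) = dl%:E ->
          left_lim (kap n (phi n w) ^~ w) dl l ->
          phi n.+1 w = J n.+1 l w)).

(** (H_y)_{ij} for a regulated MMBM started at the opposite boundary:
    P[delta_target < oo, kappa(delta_target) = j], computed on the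
    regulated MMBM realization (kap i, Z i) started in phase i. *)
Definition Hmat (P : probability T R) (kap : 'I_m -> R -> T -> 'I_m)
    (Z : 'I_m -> R -> T -> R) (target : R) : 'M[R]_m :=
  \matrix_(i, j) fine (P [set w | exists dl : R,
       hit (Z i ^~ w) target = dl%:E /\ kap i dl w = j]).

Definition Mmat (P : probability T R) (kap : 'I_m -> R -> T -> 'I_m)
    (Z : 'I_m -> R -> T -> R) (target x : R) : 'M[R]_m :=
  \matrix_(i, j) fine (\int[P]_w
     (\int[@lebesgue_measure R]_(s in
          [set s : R | (0 <= s)%R /\ (s%:E < hit (Z i ^~ w) target)%E])
        (if (0 <= Z i s w <= x)%R && (kap i s w == j) then 1%R else 0%R)%:E))%E.

(** D(infinity): transition matrix of (Y(theta_n), rho(theta_n^-)) on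
    {0,b} x E; first m indices = level 0, last m indices = level b.
    From (0,i): new phase k ~ P^o_{ik}, then reach b in phase j w.p. (H_0)_{kj}. *)
Definition Dinf (Pc Pb H0 Hb : 'M[R]_m) : 'M[R]_(m + m) :=
  block_mx 0 (Pc *m H0) (Pb *m Hb) 0.

Definition occ_frac (Y : R -> T -> R) (rho : R -> T -> 'I_m) (x : R)
    (j : 'I_m) (Tm : R) (w : T) : R :=
  Tm^-1 * fine (\int[@lebesgue_measure R]_(t in [set t : R | (0 <= t <= Tm)%R])
                 (if (0 <= Y t w <= x)%R && (rho t w == j) then 1%R else 0%R)%:E)%E.

End FlexibleMMBM.

(* Main.v *)
Require Import Defs.
From HB Require Import structures.
From mathcomp Require Import all_boot all_order all_algebra.
From mathcomp Require Import all_classical all_reals all_analysis.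
From mathcomp Require Import normal_distribution measurable_realfun.
From mathcomp Require Import lra ring zify.
Set Implicit Arguments.
Unset Strict Implicit.
Unset Printing Implicit Defensive.
Import Order.TTheory GRing.Theory Num.Theory.
Import numFieldTopology.Exports numFieldNormedType.Exports.
Local Open Scope classical_set_scope.
Local Open Scope ring_scope.

(** Until it reaches [b], a segment started at 0 is the drawup [X t - min_(u <= t) X u] of the
    free process [X]; its duration, its occupation times and its final phase are therefore
    measurable functionals of the phase path and of the Brownian path at dyadic times. Odd
    segments become segments started at 0 when the two boundaries are exchanged. Whatever the
    past, over a short interval the phase stays constant and the Brownian increment pushes [X]
    up by [b] with probability bounded below, so durations have geometric tails. The phase
    almost surely does not jump at the hitting time of [b], because that time is announced by
    the crossing times of lower levels.

    The phases at the switching epochs form a Markov chain. Irreducibility of D(oo) yields the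
    uniqueness of [nu0] and the solvability of the Poisson equation, whose solution turns the
    centred durations, or occupation times, of successive segments into orthogonal increments
    with bounded variance. Hence a strong law along the squares, then along all integers by
    monotonicity; the long-run fraction is the ratio of the mean occupation time to the mean
    duration. *)

(** * Irreducible stochastic matrices *)

Section StochasticMatrices.
Context {R : realType}.

(** The hypotheses say nothing about the measurability of [Z], of the hitting times or of [Y]; they
    give the finite-dimensional laws of [kap] and [W] and the independence of the sigma-algebras
    these generate. This is why every quantity is rewritten as a functional of countably many
    coordinates before a probability is computed, and why segments of equal parity are compared
    through a canonical path space. The Markov property is used at deterministic dyadic times only;
    the random hitting time is approached by splitting according to the grid time at which a lower
    level is first seen crossed. The absence of a jump there matters because the construction draws
    the new phase from the left limit, whereas [Hmat] records the phase at the hitting time itself.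
    D(oo) alternates between the two levels, hence is periodic: the laws of the switching phases
    need not converge, only averages do, and the Poisson equation is suited to averages. The
    mean-square argument uses second moments of the durations, which the geometric tails supply. *)

Lemma stochastic_mul n (A B : 'M[R]_n) :
  stochastic A -> stochastic B -> stochastic (A *m B).
Proof.
move=> [A0 A1] [B0 B1]; split=> [i j|i].
  by rewrite mxE sumr_ge0 // => k _; rewrite mulr_ge0.
under eq_bigr do rewrite mxE.
rewrite exchange_big /= -[RHS](A1 i); apply: eq_bigr => k _.
by rewrite -mulr_sumr B1 mulr1.
Qed.

Lemma stochastic_exp n (A : 'M[R]_n) k : stochastic A -> stochastic (A ^+ k).
Proof.
move=> sA; elim: k => [|k IH]; last by rewrite exprS; exact: stochastic_mul.
split=> [i j|i]; first by rewrite expr0 mxE ler0n.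
rewrite (bigD1 i) //= big1 ?addr0 => [|j ji]; rewrite expr0 mxE ?eqxx //.
by rewrite eq_sym (negbTE ji).
Qed.

(** Maximum principle: at a maximiser [u] of [v], the nonnegative deficits [v u - v w] average to 0
    under row [u] of [D ^+ k], so they vanish at every state reached from [u]. *)
Lemma irreducible_harmonic n (D : 'M[R]_n) (v : 'cV[R]_n) :
  stochastic D -> irreducible_mx D -> D *m v = v ->
  forall i j, v i 0 = v j 0.
Proof.
move=> sD iD Dv.
have Dkv k : D ^+ k *m v = v.
  elim: k => [|k IH]; first by rewrite expr0 mul1mx.
  by rewrite exprS -mulmxE -mulmxA IH.
suff H : forall i : 'I_n, exists u, forall j, v j 0 = v u 0.
  by move=> i j; have [u hu] := H i; rewrite (hu i) (hu j).
move=> i; pose u := [arg max_(u > i) v u 0]%O.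
have umax j : v j 0 <= v u 0.
  by rewrite /u; case: Order.TotalTheory.arg_maxP => // w _; exact.
exists u => j; have [k Dk] := iD u j.
have [Dk0 Dk1] := stochastic_exp k sD.
have E0 : \sum_w (D ^+ k) u w * (v u 0 - v w 0) = 0.
  under eq_bigr do rewrite mulrBr.
  rewrite sumrB -mulr_suml Dk1 mul1r.
  by move/matrixP : (Dkv k) => /(_ u 0); rewrite mxE => ->; rewrite subrr.
have : (D ^+ k) u j * (v u 0 - v j 0) = 0.
  apply/eqP; move: j {Dk}.
  have /psumr_eq0P H : forall w, true -> 0 <= (D ^+ k) u w * (v u 0 - v w 0).
    by move=> w _; rewrite mulr_ge0 // subr_ge0.
  by move=> j; apply/eqP; exact: H E0 j isT.
by move/eqP; rewrite mulf_eq0 gt_eqF //= subr_eq0 => /eqP.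
Qed.

(** The left and right kernels of [D - 1] have the same dimension, and harmonic vectors are
    constant, so this dimension is 1. Nonnegativity: the entrywise modulus of an invariant row is
    subinvariant, and since [D] preserves total mass, no entry can increase strictly. *)
Lemma irreducible_invariant n (D : 'M[R]_n) : (0 < n)%N ->
  stochastic D -> irreducible_mx D ->
  exists u : 'rV[R]_n, [/\ u != 0, (forall i, 0 <= u 0 i), u *m D = u &
    forall v : 'rV[R]_n, v *m D = v -> exists c, v = c *: u].
Proof.
move=> n0 sD iD; pose M := D - 1%:M.
have kerM (v : 'rV[R]_n) : (v <= kermx M)%MS = (v *m D == v).
  by rewrite sub_kermx mulmxBr mulmx1 subr_eq0.
have rker : \rank (kermx M) = 1%N.
  rewrite mxrank_ker -mxrank_tr -mxrank_ker; apply/eqP; rewrite eqn_leq.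
  apply/andP; split.
    apply: (@leq_trans (\rank (const_mx 1 : 'rV[R]_n))); last exact: rank_leq_row.
    apply: mxrankS; apply/row_subP => i; set x := row i _.
    have xM : x *m M^T = 0 by apply/sub_kermxP; exact: row_sub.
    have Dx : D *m x^T = x^T.
      apply/eqP; rewrite -subr_eq0 -{2}[x^T]mul1mx -mulmxBl.
      by rewrite -[_ *m _]trmxK trmx_mul trmxK xM trmx0.
    apply/sub_rVP; exists (x 0 (Ordinal n0)); apply/rowP => j.
    rewrite !mxE mulr1.
    by have := irreducible_harmonic sD iD Dx j (Ordinal n0); rewrite !mxE.
  rewrite lt0n mxrank_eq0; apply/negP => /eqP k0.
  have : (const_mx 1 : 'rV[R]_n) *m M^T = 0.
    apply/rowP => j; rewrite !mxE (eq_bigr (fun k => D j k - (j == k)%:R)).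
      rewrite sumrB (proj2 sD) [X in _ - X](bigD1 j) //= eqxx big1 ?addr0 ?subrr //.
      by move=> k /negbTE; rewrite eq_sym => ->.
    by move=> k _; rewrite /M !mxE mul1r.
  move/eqP; rewrite -sub_kermx k0 submx0 => /eqP /rowP /(_ (Ordinal n0)).
  by rewrite !mxE => /eqP; rewrite oner_eq0.
have [u0 u0D u0n] : exists2 u : 'rV[R]_n, u *m D = u & u != 0.
  have /rowV0Pn[u uk un] : kermx M != 0 by rewrite -mxrank_eq0 rker.
  by exists u => //; apply/eqP; rewrite -kerM.
pose u : 'rV[R]_n := \row_j `|u0 0 j|.
have le_u j : `|u0 0 j| <= \sum_i `|u0 0 i| * D i j.
  move/rowP : u0D => /(_ j); rewrite mxE => {1}<-.
  apply: (le_trans (ler_norm_sum _ _ _)); apply: ler_sum => i _.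
  by rewrite normrM (ger0_norm (proj1 sD i j)).
have uD : u *m D = u.
  apply/rowP => j; rewrite !mxE; apply/eqP; rewrite -subr_eq0; apply/eqP.
  have H0 : \sum_j (\sum_i `|u0 0 i| * D i j - `|u0 0 j|) = 0.
    rewrite sumrB exchange_big /=; apply/eqP; rewrite subr_eq0; apply/eqP.
    by apply: eq_bigr => i _; rewrite -mulr_sumr (proj2 sD) mulr1.
  have /psumr_eq0P : forall j, true -> 0 <= \sum_i `|u0 0 i| * D i j - `|u0 0 j|.
    by move=> k _; rewrite subr_ge0.
  move=> /(_ H0 j isT) H; rewrite -[RHS]H; congr (_ - _); apply: eq_bigr => i _.
  by rewrite mxE.
have un : u != 0.
  apply: contra_neq u0n => /rowP uE; apply/rowP => j; have := uE j.
  by rewrite !mxE => /eqP; rewrite normr_eq0 => /eqP.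
exists u; split=> // [i|v /eqP vD]; first by rewrite mxE.
have uk : (u <= kermx M)%MS by rewrite kerM uD.
have ku : (kermx M <= u)%MS.
  have := mxrank_leqif_sup uk; rewrite rker => -[_ <-].
  by rewrite rank_rV un.
by apply/sub_rVP; apply: submx_trans ku; rewrite kerM.
Qed.

(** D(oo) lives on the phases just before a switch. An invariant row of it is a pair of such phase
    vectors, and one more factor [Pc] turns its level-0 part into the phases just after the switch,
    which is [nu0]. The last clause is the Fredholm alternative for the Poisson system of the
    alternating chain. *)
Lemma alternating_invariant m (Pc Pb H0 Hb : 'M[R]_m) : (0 < m)%N ->
  stochastic Pc -> stochastic Pb -> stochastic H0 -> stochastic Hb ->
  irreducible_mx (Dinf Pc Pb H0 Hb) ->
  exists nu0 : 'rV[R]_m,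
    [/\ nu0 != 0 /\ (forall i, 0 <= nu0 0 i),
        nu0 = nu0 *m H0 *m Pb *m Hb *m Pc,
        (forall nu' : 'rV[R]_m, nu' = nu' *m H0 *m Pb *m Hb *m Pc ->
           exists c : R, nu' = c *: nu0) &
        forall f0 fb : 'cV[R]_m, nu0 *m f0 + nu0 *m H0 *m Pb *m fb = 0 ->
          exists g0 gb : 'cV[R]_m,
            f0 = g0 - H0 *m Pb *m gb /\ fb = gb - Hb *m Pc *m g0].
Proof.
move=> m0 sPc sPb sH0 sHb iD.
have [PH0 PH1] := stochastic_mul sPc sH0.
have [PHb0 PHb1] := stochastic_mul sPb sHb.
have sD : stochastic (Dinf Pc Pb H0 Hb).
  split=> [i j|i].
    rewrite /Dinf; case: (split_ordP i) => {}i ->; case: (split_ordP j) => {}j ->.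
    - by rewrite block_mxEul mxE.
    - by rewrite block_mxEur.
    - by rewrite block_mxEdl.
    - by rewrite block_mxEdr mxE.
  rewrite big_split_ord /= /Dinf; case: (split_ordP i) => {}i ->.
    under eq_bigr do rewrite block_mxEul mxE.
    under [X in _ + X]eq_bigr do rewrite block_mxEur.
    by rewrite big1 // add0r.
  under eq_bigr do rewrite block_mxEdl.
  under [X in _ + X]eq_bigr do rewrite block_mxEdr mxE.
  by rewrite [X in _ + X]big1 // addr0.
have mm : (0 < m + m)%N by rewrite addn_gt0 m0.
have [u [un u0 uD uU]] := irreducible_invariant mm sD iD.
have rowD (v1 v2 : 'rV[R]_m) : row_mx v1 v2 *m Dinf Pc Pb H0 Hb =
    row_mx (v2 *m Pb *m Hb) (v1 *m Pc *m H0).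
  by rewrite /Dinf mul_row_block !mulmx0 add0r addr0 !mulmxA.
pose u1 := lsubmx u; pose u2 := rsubmx u.
have uE : u = row_mx u1 u2 by rewrite hsubmxK.
move: (uD); rewrite {1}uE rowD uE => /eq_row_mx[E1 E2].
pose nu := u1 *m Pc.
have nuH : nu *m H0 *m Pb *m Hb *m Pc = nu by rewrite /nu E2 E1.
have nuU (v : 'rV[R]_m) : v = v *m H0 *m Pb *m Hb *m Pc -> exists c, v = c *: nu.
  move=> vE; pose v2 := v *m H0; pose v1 := v2 *m Pb *m Hb.
  have [|c] := uU (row_mx v1 v2).
    by rewrite rowD; congr row_mx; rewrite /v1 /v2 -vE.
  rewrite uE scale_row_mx => /eq_row_mx[v1E _]; exists c.
  by rewrite /nu scalemxAl -v1E {1}vE.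
exists nu; split=> //.
- split; last first.
    move=> i; rewrite mxE sumr_ge0 // => k _; rewrite mulr_ge0 ?(proj1 sPc) //.
    by rewrite mxE; exact: u0.
  apply: contra_neq un => nu_0.
  have u20 : u2 = 0 by rewrite -E2 -/nu nu_0 mul0mx.
  have u10 : u1 = 0 by rewrite -E1 u20 !mul0mx.
  by rewrite uE u10 u20 row_mx0.
- move=> f0 fb nuf.
  (* Matrix of the Poisson system; the rows that it kills are the multiples of
     [row_mx nu (nu *m H0 *m Pb)], hence they also kill the right-hand side [x]. *)
  pose M := block_mx (1%:M : 'M[R]_m) (- (H0 *m Pb)) (- (Hb *m Pc)) 1%:M.
  pose x := col_mx f0 fb.
  have lker (w : 'rV[R]_(m + m)) : w *m M = 0 -> w *m x = 0.
    rewrite -[w]hsubmxK; move: (lsubmx w) (rsubmx w) => w1 w2.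
    rewrite mul_row_block !mulmx1 !mulmxN -row_mx0 => /eq_row_mx[/eqP e1 /eqP e2].
    move: e1 e2; rewrite subr_eq0 addrC subr_eq0 => /eqP e1 /eqP e2.
    have [|c cE] := nuU w1; first by rewrite -!mulmxA [H0 *m _]mulmxA mulmxA -e2.
    by rewrite mul_row_col e2 cE -!scalemxAl -scalerDr !mulmxA nuf scaler0.
  have : (x^T <= M^T)%MS.
    rewrite submxE; apply/eqP; rewrite -[LHS]trmxK trmx_mul trmxK.
    suff -> : (cokermx M^T)^T *m x = 0 by rewrite trmx0.
    apply/row_matrixP => i; rewrite row_mul row0; apply: lker.
    by rewrite -row_mul -[_ *m M]trmxK trmx_mul trmxK mulmx_coker trmx0 row0.
  case/submxP => g /(congr1 trmx); rewrite trmxK trmx_mul trmxK => xE.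
  exists (usubmx g^T), (dsubmx g^T); move: xE; rewrite -{1}[g^T]vsubmxK.
  rewrite mul_block_col !mul1mx !mulNmx => /eq_col_mx[-> ->].
  by rewrite [in X in _ /\ X]addrC.
Qed.

End StochasticMatrices.

(** * Averages and orthogonal sums *)

Section AverageConvergence.
Context {R : realType}.

(** Partial sums of nonnegative terms are monotone, so between two consecutive squares the average
    is squeezed between the averages at these squares, up to ratios of consecutive squares that tend
    to 1. *)
Lemma cvg_div_of_squares (V : nat -> R) (c : R) : (forall k, 0 <= V k) ->
  (\sum_(k < n.+1 ^ 2) V k) / (n.+1 ^ 2)%:R @[n --> \oo] --> c ->
  (\sum_(k < n) V k) / n%:R @[n --> \oo] --> c.
Proof.
move=> V0; set a := (X in X @ _ --> _ -> _) => ac.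
have S_le p q : (p <= q)%N -> \sum_(k < p) V k <= \sum_(k < q) V k.
  move=> pq; rewrite -!(big_mkord xpredT) (@big_cat_nat _ _ _ p 0 q) //=.
  by rewrite lerDl sumr_ge0.
have h0 : (n.+1%:R^-1 : R) @[n --> \oo] --> (0 : R) by exact: cvg_harmonic.
(* [lo n] is the sum up to [n.+1 ^ 2] divided by [n.+2 ^ 2]; [up n] is the sum up to [n.+2 ^ 2]
   divided by [n.+1 ^ 2]. *)
pose lo n := a n * (1 - n.+2%:R^-1) ^+ 2.
pose up n := a n.+1 * (1 + n.+1%:R^-1) ^+ 2.
have loc : lo n @[n --> \oo] --> c.
  rewrite -[c]mulr1 -[X in _ * X](expr1n _ 2) -[X in _ * X ^+ _](subr0 1).
  have h1 : (1 - n.+2%:R^-1 : R) @[n --> \oo] --> (1 - 0 : R).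
    apply: cvgB; first exact: cvg_cst.
    by move: h0; rewrite -(cvg_shiftS (fun n => n.+1%:R^-1 : R)).
  by apply: cvgM => //; exact: cvgM.
have upc : up n @[n --> \oo] --> c.
  rewrite -[c]mulr1 -[X in _ * X](expr1n _ 2) -[X in _ * X ^+ _](addr0 1).
  apply: cvgM; first by rewrite (cvg_shiftS a).
  have h1 : (1 + n.+1%:R^-1 : R) @[n --> \oo] --> (1 + 0 : R).
    by apply: cvgD => //; exact: cvg_cst.
  exact: cvgM.
apply/cvgrPdist_lt => e e0.
move/cvgrPdist_lt : loc => /(_ _ e0) [N1 _ H1].
move/cvgrPdist_lt : upc => /(_ _ e0) [N2 _ H2].
exists ((N1 + N2).+1 ^ 2)%N => //= n nN.
have [k /andP[kn nk]] : exists k, ((k.+1 ^ 2 <= n) && (n < k.+2 ^ 2))%N.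
  pose k := ex_maxn (ex_intro (fun k => k.+1 ^ 2 <= n)%N _
     (leq_trans (leq_pexp2l (ltn0Sn _) (leqnn 2)) nN))
     (fun k (h : (k.+1 ^ 2 <= n)%N) => leq_trans (leq_trans (leqnSn k)
       (leq_trans (leq_pexp2l (ltn0Sn k) (leqnSn 1)) h)) (leqnn n)).
  exists k; rewrite /k; case: ex_maxnP => {}k -> kmax /=; rewrite ltnNge.
  by apply/negP => /kmax; rewrite ltnn.
have kN : (N1 + N2 <= k)%N.
  rewrite -ltnS -ltnS -(@ltn_exp2r _ _ 2) //.
  exact: leq_ltn_trans nN nk.
have [k0 n0] : (0 < k.+1 /\ 0 < n)%N.
  by split => //; apply: leq_trans kn; rewrite expn_gt0.
have k1 : (0 : R) < k.+1%:R by rewrite ltr0n.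
have k2 : (0 : R) < k.+2%:R by rewrite ltr0n.
have e2 : (k.+2%:R : R) = k.+1%:R + 1 by rewrite natr1.
have lo_le : lo k <= (\sum_(k < n) V k) / n%:R.
  have -> : lo k = (\sum_(j < k.+1 ^ 2) V j) / (k.+2 ^ 2)%:R.
    rewrite /lo /a !natrX e2.
    move: (\sum_(j < k.+1 ^ 2) V j) (k.+1%:R : R) k1 => s x x0; field.
    by rewrite !gt_eqF // addr_gt0.
  rewrite ler_pdivlMr ?ltr0n // -mulrA mulrC -mulrA.
  apply: (@le_trans _ _ (\sum_(j < k.+1 ^ 2) V j)); last exact: S_le.
  rewrite mulrA -[leRHS]mul1r ler_wpM2r ?sumr_ge0 //.
  by rewrite mulrC ler_pdivrMr ?ltr0n ?expn_gt0 // mul1r ler_nat ltnW.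
have up_ge : (\sum_(k < n) V k) / n%:R <= up k.
  have -> : up k = (\sum_(j < k.+2 ^ 2) V j) / (k.+1 ^ 2)%:R.
    rewrite /up /a !natrX e2.
    move: (\sum_(j < k.+2 ^ 2) V j) (k.+1%:R : R) k1 => s x x0; field.
    by rewrite !gt_eqF // addr_gt0.
  apply: ler_pM; rewrite ?sumr_ge0 ?invr_ge0 //; first by apply: S_le; rewrite ltnW.
  by rewrite lef_pV2 ?posrE ?ltr0n ?expn_gt0 // ler_nat.
have := H1 k (leq_trans (leq_addr _ _) kN).
have := H2 k (leq_trans (leq_addl _ _) kN).
rewrite /= !ltr_distlC => /andP[_ u] /andP[l _]; apply/andP; split.
  exact: lt_le_trans lo_le.
exact: le_lt_trans up_ge _.
Qed.

(** For [t] between two epochs, [U t / t] lies between [U (th n) / th n.+1] and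
    [U (th n.+1) / th n], and both tend to [cV / cT]. In the application [th] lists the switching
    epochs and [U] is a cumulated occupation time. *)
Lemma cvg_renewal (U : R -> R) (th : nat -> R) (cV cT : R) :
  (forall t, 0 <= t -> 0 <= U t) ->
  (forall s t, 0 <= s <= t -> U s <= U t) -> th 0%N = 0 ->
  (forall n, 0 <= th n) -> 0 < cT ->
  U (th n) / n%:R @[n --> \oo] --> cV -> th n / n%:R @[n --> \oo] --> cT ->
  U t / t @[t --> +oo] --> cV / cT.
Proof.
move=> U0 Umon th0 th_ge0 cT0 Uc tc.
have cT_neq0 : cT != 0 by rewrite gt_eqF.
pose ratio n := (n%:R + 1 : R) / n%:R.
have ratioc : ratio n @[n --> \oo] --> (1 : R).
  rewrite -(cvg_shiftS ratio).
  rewrite (_ : (fun n => _) = fun n => 1 + n.+1%:R^-1); last first.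
    by apply/funext => n; rewrite /ratio mulrDl divff ?mul1r // pnatr_eq0.
  have H : (1 + n.+1%:R^-1 : R) @[n --> \oo] --> (1 + 0 : R).
    by apply: cvgD; [exact: cvg_cst|exact: cvg_harmonic].
  by rewrite addr0 in H.
have Uc1 : U (th n.+1) / n.+1%:R @[n --> \oo] --> cV.
  by rewrite (cvg_shiftS (fun n => U (th n) / n%:R)).
have tc1 : th n.+1 / n.+1%:R @[n --> \oo] --> cT.
  by rewrite (cvg_shiftS (fun n => th n / n%:R)).
pose lo n := (U (th n) / n%:R) / (th n.+1 / n.+1%:R * ratio n).
pose up n := (U (th n.+1) / n.+1%:R * ratio n) / (th n / n%:R).
have loc : lo n @[n --> \oo] --> cV / cT.
  by apply: cvgM => //; apply: cvgV => //; rewrite -[cT]mulr1; exact: cvgM.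
have upc : up n @[n --> \oo] --> cV / cT.
  by apply: cvgM; [rewrite -[cV]mulr1; exact: cvgM|exact: cvgV].
apply/cvgrPdist_lt => e e0.
move/cvgrPdist_lt : loc => /(_ _ e0) [N1 _ H1].
move/cvgrPdist_lt : upc => /(_ _ e0) [N2 _ H2].
have c2 : 0 < cT / 2 by rewrite divr_gt0.
move/cvgrPdist_lt : tc => /(_ _ c2) [N3 _ H3].
have th_lb n : (N3 <= n)%N -> (0 < n)%N -> cT / 2 * n%:R < th n.
  move=> nN n0; have := H3 n nN; rewrite /= ltr_distlC => /andP[+ _].
  have -> : cT - cT / 2 = cT / 2 by field.
  by rewrite ltr_pdivlMr ?ltr0n.
(* Beyond this sum [t] exceeds each of the first epochs, so the index of the cell that contains [t]
   is as large as required. *)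
pose M := \sum_(k < (N1 + N2 + N3).+2) th k.
exists M; split; first by rewrite num_real.
move=> t Mt.
have thM k : (k < (N1 + N2 + N3).+2)%N -> th k < t.
  move=> kN; apply: le_lt_trans Mt; rewrite /M (bigD1 (Ordinal kN)) //=.
  by rewrite lerDl sumr_ge0.
have t0 : 0 < t by rewrite -th0; exact: thM.
have [n0 hn0] : exists n, t < th n.
  pose n := (Num.trunc (t / (cT / 2)) + N3).+1.
  exists n; apply: (le_lt_trans _ (th_lb n _ _)) => //; last first.
    by rewrite /n -addSn leq_addl.
  rewrite -ler_pdivrMl // mulrC ltW //.
  apply: (@lt_le_trans _ _ (Num.trunc (t / (cT / 2))).+1%:R).
    by rewrite truncnS_gt.
  by rewrite ler_nat /n -addSn leq_addr.
have [n [tn nt]] : exists n, th n <= t /\ t < th n.+1.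
  have ex : exists n, t < th n by exists n0.
  case: (ex_minnP ex) => -[|n] hn hmin; first by rewrite th0 ltNge ltW in hn.
  exists n; split=> //; rewrite leNgt; apply/negP => /hmin.
  by rewrite ltnn.
have nN : (N1 + N2 + N3 < n)%N.
  rewrite ltnNge; apply/negP => nN; have := thM n.+1.
  by rewrite ltnS ltnS => /(_ nN) /ltW; rewrite leNgt nt.
have n1 : (0 < n)%N by exact: leq_ltn_trans nN.
have thn : 0 < th n.
  apply: le_lt_trans (th_lb n _ n1); last by move: nN; clear; lia.
  by rewrite mulr_ge0 // ltW.
have thn1 : 0 < th n.+1 by exact: lt_trans t0 nt.
have nR : (0 : R) < n%:R by rewrite ltr0n.
have nR1 : (0 : R) < n%:R + 1 by rewrite ltr_wpDl.
have loE : lo n = U (th n) / th n.+1.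
  rewrite /lo /ratio -[n.+1 in X in _ / (th _ / X%:R * _)]addn1 natrD; field.
  by rewrite !gt_eqF.
have upE : up n = U (th n.+1) / th n.
  rewrite /up /ratio -[n.+1 in X in (_ / X%:R * _) / _]addn1 natrD; field.
  by rewrite !gt_eqF.
have lo_le : lo n <= U t / t.
  rewrite loE; apply: ler_pM; rewrite ?invr_ge0 ?U0 ?(ltW thn1) ?(ltW thn) //.
    by apply: Umon; rewrite th_ge0.
  by rewrite lef_pV2 ?posrE // ltW.
have up_ge : U t / t <= up n.
  rewrite upE; apply: ler_pM; rewrite ?invr_ge0 ?U0 ?(ltW t0) //.
    by apply: Umon; rewrite !ltW.
  by rewrite lef_pV2 ?posrE.
have [n1N n2N] : (N1 <= n)%N /\ (N2 <= n)%N by move: nN; clear; lia.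
have := H1 n n1N; have := H2 n n2N; rewrite /= !ltr_distlC.
move=> /andP[_ u] /andP[l _].
apply/andP; split; first exact: lt_le_trans lo_le.
exact: le_lt_trans up_ge _.
Qed.

End AverageConvergence.

(** * Strong law along squares for orthogonal increments *)

Section OrthogonalSums.
Context {R : realType} d (T : measurableType d) (P : probability T R).
Implicit Types X Y : T -> R.

Local Notation sqint X := (P.-integrable setT (EFin \o (fun w => X w ^+ 2))).

Lemma integrable_mul_sq X Y : measurable_fun setT X -> measurable_fun setT Y ->
  sqint X -> sqint Y -> P.-integrable setT (EFin \o (fun w => X w * Y w)).
Proof.
move=> mX mY iX iY.
apply: (le_integrable measurableT _ _ (integrableD measurableT iX iY)).
  by apply/measurable_EFinP; exact: measurable_funM.
move=> w _ /=; rewrite lee_fin (ger0_norm (addr_ge0 (sqr_ge0 _) (sqr_ge0 _))).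
rewrite ler_norml; apply/andP; split; rewrite -subr_ge0.
  rewrite (_ : _ - _ = ((X w + Y w) ^+ 2 + X w ^+ 2 + Y w ^+ 2) / 2); last by field.
  by rewrite divr_ge0 // !addr_ge0 ?sqr_ge0.
rewrite (_ : _ - _ = ((X w - Y w) ^+ 2 + X w ^+ 2 + Y w ^+ 2) / 2); last by field.
by rewrite divr_ge0 // !addr_ge0 ?sqr_ge0.
Qed.

Lemma sqintD X Y : measurable_fun setT X -> measurable_fun setT Y ->
  sqint X -> sqint Y -> sqint (fun w => X w + Y w).
Proof.
move=> mX mY iX iY; have iXY := integrable_mul_sq mX mY iX iY.
have := integrableD measurableT (integrableD measurableT iX iY)
   (integrableZl measurableT 2 iXY).
apply: eq_integrable => // w _ /=.
by rewrite -!EFinD; congr EFin; ring.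
Qed.

Variable D : nat -> T -> R.
Variable C : R.
Hypothesis mD : forall n, measurable_fun setT (D n).
Hypothesis iD : forall n, sqint (D n).
Hypothesis leD : forall n, \int[P]_w (D n w ^+ 2) <= C.
Let S n w := \sum_(k < n) D k w.
Hypothesis orthD : forall n, \int[P]_w (S n w * D n w) = 0.

Let mS n : measurable_fun setT (S n).
Proof. exact: measurable_sum. Qed.

(** The cross term of the expanded square integrates to 0, so the second moments add up. *)
Lemma sq_orthogonal_sum n :
  sqint (S n) /\ \int[P]_w (S n w ^+ 2) <= n%:R * C.
Proof.
elim: n => [|n [iS leS]].
  rewrite /S; under [X in EFin \o X]eq_fun do rewrite big_ord0 expr0n.
  split; first exact: (finite_measure_integrable_cst P 0).
  by under eq_Rintegral do rewrite big_ord0 expr0n; rewrite Rintegral_cst // !mul0r.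
have SE : S n.+1 = fun w => S n w + D n w.
  by apply/funext => w; rewrite /S big_ord_recr.
have iSD := integrable_mul_sq (mS n) (mD n) iS (iD n).
split; first by rewrite SE; exact: sqintD.
rewrite SE; under eq_Rintegral => w _ do rewrite sqrrD -mulr_natl.
rewrite RintegralD //; last first.
  apply: (integrableD measurableT iS (integrableZl measurableT 2 iSD)).
rewrite RintegralD //; last exact: (integrableZl measurableT 2 iSD).
rewrite RintegralZl // orthD mulr0 addr0 -natr1 mulrDl mul1r.
exact: lerD.
Qed.

Lemma sum_inv_sq_le N : \sum_(0 <= n < N) ((n.+1 ^ 2)%:R^-1 : R) <= 2.
Proof.
case: N => [|N]; first by rewrite big_nil.
(* The sharper bound [2 - N.+1%:R^-1] passes through the induction, because 1/(a+1)^2 is at most 1/a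
   - 1/(a+1). *)
suff : \sum_(0 <= n < N.+1) ((n.+1 ^ 2)%:R^-1 : R) <= 2 - N.+1%:R^-1.
  by move/le_trans; apply; rewrite gerBl invr_ge0.
elim: N => [|N IH]; first by rewrite big_nat1 exp1n !invr1; lra.
rewrite big_nat_recr //=; apply: (le_trans (lerD IH (lexx _))).
rewrite -addrA lerD2l natrX.
have a0 : (0 : R) < N.+1%:R by rewrite ltr0n.
rewrite (_ : N.+2%:R = N.+1%:R + 1 :> R); last by rewrite natr1.
move: (N.+1%:R : R) a0 => a a0.
rewrite -subr_ge0 (_ : _ - _ = (a * (a + 1) ^+ 2)^-1); last first.
  by field; rewrite !gt_eqF // addr_gt0.
by rewrite invr_ge0 mulr_ge0 ?(ltW a0) ?sqr_ge0.
Qed.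

(** The average of the first n terms has second moment at most C/n, which is not summable; along
    squares it becomes summable. The series of squared averages then has a finite integral, so it
    converges almost surely and its terms tend to 0. *)
Lemma lln_squares :
  {ae P, forall w, S (n.+1 ^ 2) w / (n.+1 ^ 2)%:R @[n --> \oo] --> (0 : R)}.
Proof.
pose f n w := ((S (n.+1 ^ 2) w / (n.+1 ^ 2)%:R) ^+ 2)%:E.
have mf n : measurable_fun setT (f n).
  apply/measurable_EFinP; apply: measurable_funX.
  by apply: measurable_funM; [exact: mS|exact: measurable_cst].
have f0 n w : (0 <= f n w)%E by rewrite lee_fin sqr_ge0.
have C0 : 0 <= C.
  apply: le_trans (leD 0%N); apply: Rintegral_ge0 => w _; exact: sqr_ge0.
have If n : (\int[P]_w f n w <= (C * (n.+1 ^ 2)%:R^-1)%:E)%E.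
  have [iS leS] := sq_orthogonal_sum (n.+1 ^ 2).
  have q0 : (0 : R) < (n.+1 ^ 2)%:R by rewrite ltr0n expn_gt0.
  under eq_integral => w _ do
    rewrite /f exprMn mulrC EFinM.
  rewrite integralZl // -[X in (_ * X)%E]fineK ?integrable_fin_num // -EFinM lee_fin.
  apply: (le_trans (ler_wpM2l (sqr_ge0 _) leS)).
  by rewrite le_eqVlt; apply/orP; left; apply/eqP; field; rewrite gt_eqF.
have Isum : (\int[P]_w (\sum_(0 <= n <oo) f n w) < +oo)%E.
  rewrite integral_nneseries //; apply: (@le_lt_trans _ _ (C * 2)%:E); last exact: ltry.
  apply: lime_le; first by apply: is_cvg_nneseries => n _ _; exact: integral_ge0.
  apply: nearW => N; apply: (@le_trans _ _ (\sum_(0 <= n < N) (C * (n.+1 ^ 2)%:R^-1)%:E)%E).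
    by apply: lee_sum => n _; exact: If.
  by rewrite sumEFin lee_fin -mulr_sumr ler_wpM2l // sum_inv_sq_le.
have sum0 w : (0 <= \sum_(0 <= n <oo) f n w)%E by exact: nneseries_ge0.
have isum : P.-integrable setT (fun w => \sum_(0 <= n <oo) f n w)%E.
  apply/integrableP; split; first exact: ge0_emeasurable_sum.
  by under eq_integral => w _ do rewrite gee0_abs //.
have := integrable_ae measurableT isum; apply: filterS => w /(_ I) fin.
pose g n := (S (n.+1 ^ 2) w / (n.+1 ^ 2)%:R) ^+ 2.
have g0 : g n @[n --> \oo] --> 0.
  apply: cvg_series_cvg_0; apply: nondecreasing_is_cvgn.
    apply/nondecreasing_seqP => n; rewrite /series /= big_nat_recr //=.
    by rewrite lerDl sqr_ge0.
  exists (fine (\sum_(0 <= n <oo) f n w)%E) => _ [N _ <-].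
  rewrite -lee_fin fineK // /series /= -sumEFin.
  by apply: (@nneseries_lim_ge _ (f ^~ w) xpredT 0%N) => n _ _; exact: f0.
apply/cvgrPdist_lt => e e0; move/cvgrPdist_lt : g0 => /(_ (e ^+ 2)).
rewrite exprn_gt0 // => /(_ isT) [N _ HN]; exists N => // n /HN /=.
rewrite !sub0r !normrN /g normrX ltr_pXn2r // ?nnegrE //.
exact: ltW.
Qed.

End OrthogonalSums.

(** * Independence *)

Section Independence.
Context {R : realType} d (T : measurableType d) (P : probability T R).

(** Both sides are finite measures in [A] that agree on a pi-system. The event [F] plays the role of
    a conditioning event and [c] that of the conditional probability of the rest. *)
Lemma pi_lambda_scale (G : set (set T)) (g : (set T)^nat) (E F : set T) (c : R) :
  G `<=` measurable -> setI_closed G -> (forall n, G (g n)) ->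
  \bigcup_k g k = setT -> measurable E -> measurable F -> 0 <= c ->
  (forall A, G A -> P (A `&` E) = (P (A `&` F) * c%:E)%E) ->
  forall A, <<s G >> A -> P (A `&` E) = (P (A `&` F) * c%:E)%E.
Proof.
move=> Gm GI Gg gT mE mF c0 GE A sA.
rewrite muleC; pose m1 := mrestr P mE.
pose m2 := mscale (NngNum c0) (mrestr P mF).
change (m1 A = m2 A).
apply: (g_sigma_algebra_measure_unique G Gm g) => //.
  by move=> B GB; rewrite /m2 /mscale /= /m1 /mrestr GE // muleC.
move=> k; apply: (@le_lt_trans _ _ (P setT)); last by rewrite probability_setT ltry.
by apply: le_measure => //; rewrite inE //; apply: measurableI => //; exact: Gm.
Qed.

(** One side is extended at a time: first [A] with [B] kept in its pi-system, then [B] with [A]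
    already arbitrary. *)
Lemma indep_sigma (G1 G2 : set (set T)) :
  G1 `<=` measurable -> G2 `<=` measurable -> setI_closed G1 -> setI_closed G2 ->
  G1 setT -> G2 setT ->
  (forall A B, G1 A -> G2 B -> P (A `&` B) = (P A * P B)%E) ->
  forall A B, <<s G1 >> A -> <<s G2 >> B -> P (A `&` B) = (P A * P B)%E.
Proof.
have gen (H1 H2 : set (set T)) : H1 `<=` measurable -> H2 `<=` measurable ->
    setI_closed H1 -> H1 setT ->
    (forall A B, H1 A -> H2 B -> P (A `&` B) = (P A * P B)%E) ->
    forall A B, <<s H1 >> A -> H2 B -> P (A `&` B) = (P A * P B)%E.
  move=> m1 m2 I1 T1 H A B sA HB.
  have -> : P B = (fine (P B))%:E by rewrite fineK // fin_num_measure //; exact: m2.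
  rewrite -[X in (P X * _)%E](setIT A).
  apply: (pi_lambda_scale (G := H1) (g := fun=> setT)) => //.
  - by rewrite bigcup_const.
  - exact: m2.
  - exact: fine_ge0.
  - move=> A' HA'; rewrite setIT fineK ?H // fin_num_measure //; exact: m2.
move=> m1 m2 I1 I2 T1 T2 H A B sA sB.
have sm : <<s G1 >> `<=` measurable.
  by apply: smallest_sub => //; exact: sigma_algebra_measurable.
rewrite setIC muleC.
apply: (gen G2 (<<s G1 >>)) => // A' B' GA' sB'.
by rewrite setIC muleC; apply: (gen G1 G2).
Qed.

(** Independence identifies the joint law of [(X, Y)] with the product of the laws, and Fubini's
    theorem splits the integral. *)
Lemma Rintegral_mul_indep (X Y : T -> R) :
  measurable_fun setT X -> measurable_fun setT Y ->
  P.-integrable setT (EFin \o X) -> P.-integrable setT (EFin \o Y) ->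
  (forall A B : set R, measurable A -> measurable B ->
     P (X @^-1` A `&` Y @^-1` B) = (P (X @^-1` A) * P (Y @^-1` B))%E) ->
  P.-integrable setT (EFin \o (fun w => X w * Y w)) ->
  \int[P]_w (X w * Y w) = \int[P]_w X w * \int[P]_w Y w.
Proof.
move=> mX mY iX iY ind iXY.
pose X' : {mfun T >-> R} := mfun_Sub (mem_set mX).
pose Y' : {mfun T >-> R} := mfun_Sub (mem_set mY).
have mh : measurable_fun setT (fun w => (X w, Y w)) by exact: measurable_fun_pair.
pose h : {mfun T >-> (R * R)%type} := mfun_Sub (mem_set mh).
pose PX := distribution P X'; pose PY := distribution P Y'.
have lawE A : measurable A -> (PX \x PY)%E A = distribution P h A.
  apply: product_measure_unique => A1 A2 m1 m2.
  by rewrite /distribution /pushforward -ind.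
pose f (z : R * R) := (z.1 * z.2)%:E.
have mf : measurable_fun setT f.
  by apply/measurable_EFinP; apply: measurable_funM; [exact: measurable_fst|exact: measurable_snd].
have absE Z : (P.-integrable setT (EFin \o Z)) -> measurable_fun setT Z ->
    (\int[P]_w `|(Z w)%:E| < +oo)%E by move=> /integrableP[].
have if_ : (PX \x PY)%E.-integrable setT f.
  apply/integrableP; split=> //.
  rewrite (eq_measure_integral (distribution P h)); last by move=> A mA _; exact: lawE.
  rewrite ge0_integral_distribution //; last exact: measurableT_comp.
  by have /integrableP[] := iXY.
have idE : P.-integrable setT (f \o h) by [].
have E1 : (\int[P]_w (X w * Y w)%:E = \int[(PX \x PY)%E]_z f z)%E.
  rewrite (eq_measure_integral (distribution P h)); last by move=> A mA _; exact: lawE.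
  by rewrite integral_distribution.
have intE (Z : T -> R) (mZ : measurable_fun setT Z) :
    P.-integrable setT (EFin \o Z) ->
    (\int[distribution P (mfun_Sub (mem_set mZ))]_x x%:E = \int[P]_w (Z w)%:E)%E.
  by move=> iZ; rewrite integral_distribution.
rewrite /Rintegral E1 -(integral12_prod_meas1 if_) /fubini_F /f /=.
have iYl : PY.-integrable setT (EFin : R -> \bar R).
  apply/integrableP; split; first exact: EFin_measurable.
  rewrite ge0_integral_distribution //; last exact: measurableT_comp.
  by have /integrableP[] := iY.
have iXl : PX.-integrable setT (EFin : R -> \bar R).
  apply/integrableP; split; first exact: EFin_measurable.
  rewrite ge0_integral_distribution //; last exact: measurableT_comp.
  by have /integrableP[] := iX.
have iYf : (\int[PY]_y y%:E)%E \is a fin_num by exact: integrable_fin_num.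
have -> : (\int[PX]_x \int[PY]_y (x * y)%:E =
    \int[PX]_x ((fine (\int[PY]_y y%:E))%:E * x%:E))%E.
  apply: eq_integral => x _.
  under eq_integral => y _ do rewrite EFinM.
  by rewrite integralZl // fineK // muleC.
by rewrite integralZl // fineM ?integrable_fin_num //= !intE // mulrC.
Qed.

Variables (I : eqType) (F : I -> set (set T)).
Hypothesis Fm : forall s, F s `<=` measurable.
Hypothesis FT : forall s, F s setT.
Hypothesis FI : forall s, setI_closed (F s).
Hypothesis indF : mutually_independent P F.

(** A pi-system for the joint sigma-algebra of the indices in [p]. The family [E] is required to be
    admissible at every index, also outside [S], so that families can be merged without case
    distinctions on membership. *)
Definition block (p : pred I) : set (set T) :=
  [set A | exists (S : seq I) (E : I -> set T),
     [/\ uniq S, all p S, forall s, F s (E s) & A = \big[setI/setT]_(s <- S) E s]].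

Lemma block_measurable p : block p `<=` measurable.
Proof.
by move=> _ [S [E [_ _ FE ->]]]; apply: bigsetI_measurable => s _; apply: Fm.
Qed.

Lemma in_bigsetI (S : seq I) (E : I -> set T) w :
  (\big[setI/setT]_(s <- S) E s) w <-> forall s, s \in S -> E s w.
Proof.
elim: S => [|s S IH]; first by rewrite big_nil.
rewrite big_cons; split=> [[Es /IH ES] t|ES].
  by rewrite inE => /predU1P[->//|/ES].
split; first by apply: ES; rewrite mem_head.
by apply/IH => t tS; apply: ES; rewrite inE tS orbT.
Qed.

Lemma blockT p : block p setT.
Proof. by exists [::], (fun=> setT); split=> //; rewrite big_nil. Qed.

Lemma block_setI p : setI_closed (block p).
Proof.
move=> _ _ [S1 [E1 [u1 p1 F1 ->]]] [S2 [E2 [u2 p2 F2 ->]]].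
exists (undup (S1 ++ S2)), (fun s => (if s \in S1 then E1 s else setT) `&`
  (if s \in S2 then E2 s else setT)); split.
- exact: undup_uniq.
- by rewrite all_undup all_cat p1.
- by move=> s; apply: FI; case: ifP.
- apply/seteqP; split=> [w [/in_bigsetI h1 /in_bigsetI h2]|w /in_bigsetI h].
    apply/in_bigsetI => s _.
    by split; case: ifP => // sS; [exact: h1|exact: h2].
  split; apply/in_bigsetI => s sS.
    by have := h s; rewrite mem_undup mem_cat sS => /(_ isT) [].
  by have := h s; rewrite mem_undup mem_cat sS orbT => /(_ isT) [].
Qed.

Lemma sub_block (p : pred I) s : p s -> F s `<=` block p.
Proof.
move=> ps A FA; exists [:: s], (fun t => if t == s then A else setT); split=> //=.
- by rewrite ps.
- by move=> t; case: eqP => // ->.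
- by rewrite big_seq1 eqxx.
Qed.

Lemma block_mono (p q : pred I) : (forall s, p s -> q s) -> block p `<=` block q.
Proof.
move=> pq A [S [E [uS pS FE AE]]]; exists S, E; split=> //.
by apply/allP => s /(allP pS) /pq.
Qed.

(** Since [p] and [q] are disjoint, two finite families can be glued into a single one over the
    concatenated list, to which mutual independence applies. *)
Lemma block_indep (p q : pred I) : (forall s, p s -> ~~ q s) ->
  forall A B, <<s block p >> A -> <<s block q >> B ->
  P (A `&` B) = (P A * P B)%E.
Proof.
move=> pq; apply: indep_sigma; try exact: block_measurable;
  try exact: block_setI; try exact: blockT.
move=> _ _ [S1 [E1 [u1 p1 F1 ->]]] [S2 [E2 [u2 q2 F2 ->]]].
pose E s := if p s then E1 s else E2 s.
have E1E : \big[setI/setT]_(s <- S1) E1 s = \big[setI/setT]_(s <- S1) E s.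
  by apply: eq_big_seq => s /(allP p1); rewrite /E => ->.
have E2E : \big[setI/setT]_(s <- S2) E2 s = \big[setI/setT]_(s <- S2) E s.
  apply: eq_big_seq => s /(allP q2) qs; rewrite /E ifN //.
  by apply/negP => /pq; rewrite qs.
have FE s : F s (E s) by rewrite /E; case: ifP.
rewrite E1E E2E -big_cat !indF ?big_cat //=.
rewrite cat_uniq u1 u2 andbT /=; apply/hasPn => s /(allP q2) qs.
by apply/negP => /(allP p1) /pq; rewrite qs.
Qed.

End Independence.

(** * Dyadic times *)

Section Dyadic.
Context {R : realType}.

Definition dyad (N j : nat) : R := j%:R / 2 ^+ N.

Let pow_gt0 N : (0 : R) < 2 ^+ N. Proof. by rewrite exprn_gt0. Qed.

Lemma dyad0 N : dyad N 0 = 0. Proof. by rewrite /dyad mul0r. Qed.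

Lemma dyad_ge0 N j : 0 <= dyad N j.
Proof. by rewrite /dyad divr_ge0 // ltW. Qed.

Lemma dyad_gt0 N j : 0 < dyad N j.+1.
Proof. by rewrite /dyad divr_gt0. Qed.

Lemma dyad_refine N M j : dyad (N + M) (j * 2 ^ M) = dyad N j.
Proof.
rewrite /dyad exprD natrM natrX; field.
by rewrite !gt_eqF.
Qed.

Lemma ler_dyad N i j : (dyad N i <= dyad N j) = (i <= j)%N.
Proof. by rewrite /dyad ler_pM2r ?invr_gt0 // ler_nat. Qed.

Lemma ltr_dyad N i j : (dyad N i < dyad N j) = (i < j)%N.
Proof. by rewrite ltNge ler_dyad -ltnNge. Qed.

Lemma dyadS N j : dyad N j.+1 = dyad N j + (2 ^+ N)^-1.
Proof. by rewrite /dyad -natr1 mulrDl mul1r. Qed.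

(** Index of the dyadic cell of level [N] that contains [t]; a negative time gets index 0. *)
Definition dfloor N (t : R) : nat := Num.trunc (t * 2 ^+ N).

Lemma dfloor_itv N t : 0 <= t ->
  dyad N (dfloor N t) <= t < dyad N (dfloor N t).+1.
Proof.
move=> t0; rewrite /dyad ler_pdivrMr // ltr_pdivlMr //.
by apply: truncn_itv; rewrite mulr_ge0 // ltW.
Qed.

Lemma cvg_half_pow : ((2 ^+ N)^-1 : R) @[N --> \oo] --> (0 : R).
Proof.
have := @cvg_geometric R 1 2^-1; rewrite ger0_norm // => /(_ ltac:(lra)).
by apply: cvg_trans; apply: near_eq_cvg; near=> N; rewrite /= mul1r exprVn.
Unshelve. all: by end_near. Qed.

Lemma half_pow_lt (e : R) : 0 < e ->
  exists N0, forall N, (N0 <= N)%N -> (2 ^+ N)^-1 < e.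
Proof.
move=> e0; have /cvgrPdist_lt /(_ _ e0) [N0 _ H] := cvg_half_pow.
by exists N0 => N /H /=; rewrite sub0r normrN ger0_norm // invr_ge0 ltW.
Qed.

Definition dyadic : set R := [set t | exists N j, t = dyad N j].

Definition grid (N J : nat) : set R := [set t | exists2 j, (j <= J)%N & t = dyad N j].

End Dyadic.

Section Coordinates.
Context {R : realType} {m : nat} {T : Type}.
Variables (kap : R -> T -> 'I_m) (W : R -> T -> R).

(** Single-time events; they generate the sigma-algebra of the process observed at the times of
    [D]. *)
Definition coord (D : set R) : set (set T) :=
  [set E | exists2 t, D t & (exists k, E = [set w | kap t w = k]) \/
    (exists2 A : set R, measurable A & E = W t @^-1` A)].

End Coordinates.

(** * Measures determined by dyadic grids *)

Section GridFiltration.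
Context {R : realType} {m : nat} d (T : measurableType d).
Variables (kap : R -> T -> 'I_m) (W : R -> T -> R) (i : 'I_m).
Hypothesis kap0 : forall w, kap 0 w = i.
Hypothesis W0 : forall w, W 0 w = 0.
Hypothesis mkap : forall t, dyadic t -> forall k, measurable [set w | kap t w = k].
Hypothesis mW : forall t, dyadic t -> measurable_fun setT (W t).

Local Notation coord := (coord kap W).

Lemma coord_mono (D D' : set R) : D `<=` D' -> coord D `<=` coord D'.
Proof. by move=> DD E [t /DD Dt h]; exists t. Qed.

Lemma coord_measurable (D : set R) : D `<=` dyadic -> coord D `<=` measurable.
Proof.
move=> DD E [t /DD Dt [[k ->]|[A mA ->]]]; first exact: mkap.
by rewrite -[_ @^-1` _]setTI; exact: mW.
Qed.

Definition gtime (N l : nat) : R := dyad N l.+1.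

Lemma gtime_grid N J : time_grid J (gtime N).
Proof. by split=> [|l _]; rewrite /gtime ?dyad_gt0 // ltr_dyad. Qed.

Lemma tprev_gtime N l : tprev (gtime N) l = dyad N l.
Proof. by case: l => [|l] //=; rewrite dyad0. Qed.

Definition gridcyl (t : nat -> R) (J : nat) : set (set T) :=
  [set E | exists K A, (forall l, measurable (A l)) /\ E = cyl_event kap W J t K A].

(** Enumerates the finite phase words (padded with [i]), so that countably many cylinders cover the
    sample space, as uniqueness of measures requires. *)
Definition all_K (n : nat) (l : nat) : 'I_m := nth i (odflt [::] (unpickle n)) l.

Lemma all_K_onto (J : nat) (K : nat -> 'I_m) :
  exists n, forall l, (l < J)%N -> all_K n l = K l.
Proof.
exists (pickle (mkseq K J)) => l lJ.
by rewrite /all_K pickleK /= nth_mkseq.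
Qed.

Lemma cyl_cover J t : \bigcup_n cyl_event kap W J t (all_K n) (fun=> setT) = setT.
Proof.
apply/seteqP; split=> // w _.
have [n nK] := all_K_onto J (fun l => kap (t l) w).
by exists n => // l lJ; rewrite nK.
Qed.

Lemma gridcyl_setI J t : setI_closed (gridcyl t J).
Proof.
move=> _ _ [K1 [A1 [m1 ->]]] [K2 [A2 [m2 ->]]].
have [KE|] := pselect (forall l, (l < J)%N -> K1 l = K2 l).
  exists K1, (fun l => A1 l `&` A2 l); split; first by move=> l; exact: measurableI.
  apply/seteqP; split=> [w [h1 h2] l lJ|w h].
    by have [-> ?] := h1 l lJ; have [_ ?] := h2 l lJ.
  by split=> l lJ; have [kl [? ?]] := h l lJ; split=> //; rewrite -KE.
move=> /existsNP[l /not_implyP[lJ nK]].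
exists K1, (fun=> set0); split=> //.
apply/seteqP; split=> [w [h1 h2]|w h]; last by have [] := h l lJ.
by have [e1 _] := h1 l lJ; have [e2 _] := h2 l lJ; rewrite -e1 e2 in nK.
Qed.

Lemma cyl_measurable J t K A :
  (forall l, (l < J)%N -> (forall k, measurable [set w | kap (t l) w = k]) /\
     measurable_fun setT (W (t l))) ->
  (forall l, measurable (A l)) -> measurable (cyl_event kap W J t K A).
Proof.
move=> dt mA.
have -> : cyl_event kap W J t K A = \bigcap_(l in [set l | (l < J)%N])
    ([set w | kap (t l) w = K l] `&` (fun w => W (t l) w - W (tprev t l) w) @^-1` A l).
  by apply/seteqP; split=> w h l lJ; exact: h.
apply: bigcap_measurableType => l lJ; apply: measurableI; first by have [] := dt l lJ.
rewrite -[X in measurable X]setTI; apply: measurable_funB => //.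
  by have [] := dt l lJ.
case: l lJ => [|l] /= lJ; first by apply: mW; exists 0%N, 0%N; rewrite dyad0.
by have [] := dt l (ltnW lJ).
Qed.

Lemma gtime_dyadic N l : dyadic (gtime N l).
Proof. by exists N, l.+1. Qed.

Lemma gridcyl_measurable N J : gridcyl (gtime N) J `<=` measurable.
Proof.
by move=> _ [K [A [mA ->]]]; apply: cyl_measurable => // l _; split=> [k|];
  [apply: mkap|apply: mW]; exact: gtime_dyadic.
Qed.

(** Cylinders constrain increments of [W] together with a full phase word. A countable union over
    words isolates a single increment, and [W] at a grid time is the sum of the increments before
    it. *)
Lemma coord_sub_gridcyl N J : coord (grid N J) `<=` <<s gridcyl (gtime N) J >>.
Proof.
pose GT := g_sigma_algebraType (gridcyl (gtime N) J).
have gen K A : (forall l, measurable (A l)) ->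
    measurable (cyl_event kap W J (gtime N) K A : set GT).
  by move=> mA; apply: sub_sigma_algebra; exists K, A.
have inc l (A : set R) : (l < J)%N -> measurable A ->
    measurable ((fun w => W (dyad N l.+1) w - W (dyad N l) w) @^-1` A : set GT).
  move=> lJ mA.
  rewrite (_ : _ @^-1` _ = \bigcup_n cyl_event kap W J (gtime N) (all_K n)
      (fun l' => if l' == l then A else setT)).
    by apply: bigcupT_measurable => n; apply: gen => l'; case: ifP.
  apply/seteqP; split=> [w Aw|w [n _ h]].
    have [n nK] := all_K_onto J (fun l => kap (gtime N l) w).
    exists n => // l' l'J; rewrite nK //; split=> //.
    by case: eqP => // ->; rewrite tprev_gtime.
  by have [_] := h l lJ; rewrite eqxx tprev_gtime.
move=> _ [_ [j jJ ->] [[k ->]|[A mA ->]]].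
- case: j jJ => [_|l lJ].
    rewrite dyad0; have [ik|ik] := eqVneq i k.
      rewrite (_ : [set _ | _] = setT); first exact: (@measurableT _ GT).
      by apply/seteqP; split=> // w _ /=; rewrite kap0.
    rewrite (_ : [set _ | _] = set0); first exact: (@measurable0 _ GT).
    by apply/seteqP; split=> // w /=; rewrite kap0; exact/eqP.
  rewrite (_ : [set _ | _] = \bigcup_(n in [set n | all_K n l = k])
     cyl_event kap W J (gtime N) (all_K n) (fun=> setT)).
    by apply: (@bigcup_measurable _ GT) => n _; exact: gen.
  apply/seteqP; split=> [w /= kw|w [n /= nk h]].
    have [n nK] := all_K_onto J (fun l => kap (gtime N l) w).
    by exists n => /=; [rewrite nK|move=> l' l'J; rewrite nK].
  by have [+ _] := h l lJ; rewrite nk.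
- have mWj : measurable_fun (setT : set GT) (W (dyad N j) : GT -> R).
    have -> : W (dyad N j) = fun w => \sum_(l < j) (W (dyad N l.+1) w - W (dyad N l) w).
      apply/funext => w; rewrite -(big_mkord xpredT
        (fun l => W (dyad N l.+1) w - W (dyad N l) w)).
      by rewrite (telescope_sumr (fun l => W (dyad N l) w)) // dyad0 W0 subr0.
    apply: measurable_sum => l _ B mB.
    by rewrite setTI; apply: inc => //; exact: leq_trans jJ.
  by have := mWj measurableT _ mA; rewrite setTI.
Qed.

(** Cylinders of one grid form a pi-system, but a constraint on a coarse increment is not a product
    of constraints on finer ones, so cylinders of different grids do not. Equality is therefore
    extended to the sigma-algebra of each grid first; these increase, and their union is a pi-system
    for all the times together. *)
Lemma two_stage (m1 m2 : {measure set T -> \bar R}) (N_ J_ : nat -> nat) :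
  (m1 setT < +oo)%E ->
  (forall n, grid (N_ n) (J_ n) `<=` @grid R (N_ n.+1) (J_ n.+1)) ->
  (forall n E, gridcyl (gtime (N_ n)) (J_ n) E -> m1 E = m2 E) ->
  forall E, <<s coord (\bigcup_n grid (N_ n) (J_ n)) >> E -> m1 E = m2 E.
Proof.
move=> fin mono eqm.
have mfin E : measurable E -> (m1 E < +oo)%E.
  by move=> mE; apply: le_lt_trans fin; apply: le_measure; rewrite ?inE.
have stage1 n E : <<s coord (grid (N_ n) (J_ n)) >> E -> m1 E = m2 E.
  move=> sE; have {}sE : <<s gridcyl (gtime (N_ n)) (J_ n) >> E.
    move: E sE; apply: smallest_sub; last exact: coord_sub_gridcyl.
    exact: smallest_sigma_algebra.
  have gen q : gridcyl (gtime (N_ n)) (J_ n)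
      (cyl_event kap W (J_ n) (gtime (N_ n)) (all_K q) (fun=> setT)).
    by exists (all_K q), (fun=> setT).
  apply: (g_sigma_algebra_measure_unique (gridcyl (gtime (N_ n)) (J_ n))
     (@gridcyl_measurable _ _) (fun q => cyl_event kap W (J_ n) (gtime (N_ n))
     (all_K q) (fun=> setT)) gen) sE.
  - exact: cyl_cover.
  - exact: gridcyl_setI.
  - exact: eqm.
  - move=> q; apply: mfin; apply: gridcyl_measurable; exact: gen.
have grid_mono p q : (p <= q)%N -> grid (N_ p) (J_ p) `<=` @grid R (N_ q) (J_ q).
  elim: q => [|q IH]; first by rewrite leqn0 => /eqP ->.
  by rewrite leq_eqVlt => /predU1P[->//|/IH h] t /h; exact: mono.
pose Pi := \bigcup_n <<s coord (grid (N_ n) (J_ n)) >>.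
have smono p q : (p <= q)%N -> <<s coord (grid (N_ p) (J_ p)) >> `<=`
    <<s coord (grid (N_ q) (J_ q)) >>.
  by move=> pq; apply: sub_sigma_algebra2; apply: coord_mono; exact: grid_mono.
have PiI : setI_closed Pi.
  move=> A B [p _ pA] [q _ qB]; exists (maxn p q) => //.
  apply: (@measurableI _ (g_sigma_algebraType (coord (grid (N_ (maxn p q)) (J_ (maxn p q)))))).
    by apply: smono pA; exact: leq_maxl.
  by apply: smono qB; exact: leq_maxr.
have Pim : Pi `<=` measurable.
  move=> A [p _]; apply: smallest_sub; first exact: sigma_algebra_measurable.
  by apply: coord_measurable => _ [j _ ->]; exists (N_ p), j.
move=> E sE; have {}sE : <<s Pi >> E.
  apply: sub_sigma_algebra2 sE => A [t [n _ nt] h].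
  by exists n => //; apply: sub_sigma_algebra; exists t.
have PiT : Pi setT.
  exists 0%N => //.
  exact: (@measurableT _ (g_sigma_algebraType (coord (grid (N_ 0%N) (J_ 0%N))))).
apply: (g_sigma_algebra_measure_unique Pi Pim (fun=> setT)) sE => //.
- by rewrite bigcup_const.
- by move=> A [p _ pA]; exact: stage1 pA.
Qed.

Lemma filtration_grid N0 j0 n :
  grid (N0 + n) (j0 * 2 ^ n) `<=` @grid R (N0 + n.+1) (j0 * 2 ^ n.+1).
Proof.
move=> _ [j jJ ->]; exists (j * 2)%N; last by rewrite addnS -addn1 (dyad_refine _ 1).
by rewrite expnSr mulnA leq_mul2r jJ orbT.
Qed.

Lemma filtration_dyadic N0 j0 :
  [set t | dyadic t /\ t <= @dyad R N0 j0] `<=`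
  \bigcup_n grid (N0 + n) (j0 * 2 ^ n).
Proof.
move=> _ [[N [j ->]] le]; exists N => //; exists (j * 2 ^ N0)%N.
  by rewrite -(ler_dyad (R := R) (N0 + N)) dyad_refine addnC dyad_refine.
by rewrite addnC dyad_refine.
Qed.

Lemma all_grid n : grid n (n * 2 ^ n) `<=` @grid R n.+1 (n.+1 * 2 ^ n.+1).
Proof.
move=> _ [j jJ ->]; exists (j * 2)%N; last by rewrite -addn1 (dyad_refine _ 1).
by rewrite expnSr mulnA leq_mul2r (leq_trans jJ) // leq_mul2r leqnSn orbT.
Qed.

Lemma all_dyadic : @dyadic R `<=` \bigcup_n grid n (n * 2 ^ n).
Proof.
move=> _ [N [j ->]]; exists (N + j)%N => //; exists (j * 2 ^ j)%N.
  by apply: leq_mul; [exact: leq_addl|rewrite leq_exp2l // leq_addl].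
by rewrite dyad_refine.
Qed.

End GridFiltration.

(** * The Markov property of phases and Brownian increments *)

Section MatrixExponential.
Context {R : realType} {m : nat}.

(** Dominates every absolute row sum, so its powers bound the entries of the powers of [Q]. *)
Definition mx_total (Q : 'M[R]_m) : R := \sum_i \sum_j `|Q i j|.

Lemma mx_pow_le (Q : 'M[R]_m) n i j : `|(Q ^+ n) i j| <= mx_total Q ^+ n.
Proof.
elim: n i j => [|n IH] i j.
  by rewrite !expr0 mxE; case: eqP => _; rewrite ?normr1 // normr0.
have q0 : 0 <= mx_total Q by rewrite !sumr_ge0 // => k _; rewrite sumr_ge0.
rewrite exprS mxE exprS (le_trans (ler_norm_sum _ _ _)) //.
apply: (@le_trans _ _ (\sum_l `|Q i l| * mx_total Q ^+ n)).
  by apply: ler_sum => l _; rewrite normrM ler_wpM2l.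
rewrite -mulr_suml ler_wpM2r ?exprn_ge0 //.
by rewrite /mx_total [leRHS](bigD1 i) //= lerDl sumr_ge0 // => k _; rewrite sumr_ge0.
Qed.

Lemma series_exp_coeff_le (q : R) N : 0 <= q -> \sum_(n < N) exp_coeff q n <= expR q.
Proof.
move=> q0; rewrite -(big_mkord xpredT (exp_coeff q)).
have := @nondecreasing_cvgn_le _ (series (exp_coeff q)).
apply; last exact: is_cvg_series_exp_coeff.
apply/nondecreasing_seqP => n; rewrite /series /= big_nat_recr //= lerDl.
by rewrite /exp_coeff /= divr_ge0 // exprn_ge0.
Qed.

(** For [h <= 1] the term of index n >= 1 is at most h q^n / n!, so the diagonal entry falls below
    its constant term 1 by at most h exp q. *)
Lemma expmx_diag_ge (Q : 'M[R]_m) (h : R) k : 0 <= h <= 1 ->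
  1 - expR (mx_total Q) * h <= expmx Q h k k.
Proof.
move=> /andP[h0 h1]; rewrite mxE.
set q := mx_total Q.
have q0 : 0 <= q by rewrite !sumr_ge0 // => i _; rewrite sumr_ge0.
pose f n := h ^+ n / n`!%:R * (Q ^+ n) k k.
have fE : (fun N => \sum_(n < N) f n) = series f.
  by apply/funext => N; rewrite /series /= big_mkord.
have f_le n : `|f n| <= exp_coeff (h * q) n.
  rewrite /f /exp_coeff /= normrM exprMn -mulrA [_ * _^-1 in leRHS]mulrC mulrA.
  rewrite (ger0_norm (divr_ge0 (exprn_ge0 _ h0) _)) //.
  by rewrite ler_wpM2l ?divr_ge0 ?exprn_ge0 // mx_pow_le.
have cf : cvgn (series f).
  apply: normed_cvg; apply: series_le_cvg (is_cvg_series_exp_coeff (h * q)) => //.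
    by move=> n /=.
  by move=> n; rewrite /exp_coeff /= divr_ge0 // exprn_ge0 // mulr_ge0.
change (1 - expR q * h <= limn (fun N => \sum_(n < N) f n)).
rewrite fE; apply: limr_ge => //; near=> N.
rewrite -fE; have N0 : (0 < N)%N by near: N; exists 1%N.
apply: (@le_trans _ _ (\sum_(n < N) ((n == 0%N :> nat)%:R - h * exp_coeff q n))).
  rewrite sumrB -mulr_sumr; apply: lerB.
    by rewrite (bigD1 (Ordinal N0)) //= lerDl sumr_ge0.
  by rewrite [leRHS]mulrC ler_wpM2l // series_exp_coeff_le.
apply: ler_sum => -[[|n] /= _] _.
  by rewrite /f /exp_coeff /= !expr0 fact0 !divr1 mulr1 mul1r mxE eqxx gerBl.
rewrite sub0r lerNl (le_trans (ler_norm _)) // normrN /f normrM /exp_coeff /=.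
rewrite (ger0_norm (divr_ge0 (exprn_ge0 _ h0) _)) // mulrCA -!mulrA.
have e1 : h ^+ n.+1 <= h by rewrite exprS ler_piMr // exprn_ile1.
rewrite mulrA [X in _ <= X](_ : _ = h * (n.+1`!%:R^-1 * q ^+ n.+1)); last by ring.
by rewrite -mulrA ler_pM ?exprn_ge0 ?mulr_ge0 ?invr_ge0 // ler_wpM2l ?invr_ge0 // mx_pow_le.
Unshelve. all: by end_near. Qed.

(** Bernoulli's inequality. It bounds the chance of keeping the same phase at [e] successive steps
    by a quantity that depends on the total time only. *)
Lemma pow_one_sub_ge (x : R) n : 0 <= x <= 1 -> 1 - n%:R * x <= (1 - x) ^+ n.
Proof.
move=> /andP[x0 x1]; elim: n => [|n IH]; first by rewrite mul0r subr0 expr0.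
rewrite exprS; apply: (@le_trans _ _ ((1 - x) * (1 - n%:R * x))); last first.
  by rewrite ler_wpM2l // subr_ge0.
rewrite -natr1 -subr_ge0 (_ : _ - _ = n%:R * x ^+ 2); last by ring.
by rewrite mulr_ge0 // exprn_ge0.
Qed.

End MatrixExponential.

(** * Gaussian probabilities of unit intervals *)

Section NormalPositive.
Context {R : realType}.

(** On the interval the density is at least its value at [|a| + 1], since every point of the
    interval has modulus at most that. *)
Lemma normal_prob_gt0 (s a : R) : s != 0 ->
  (0 < normal_prob 0 s `]a, (a + 1)%R]%classic)%E.
Proof.
move=> s0.
have m1 : measurable `]a, (a + 1)%R]%classic by exact: measurable_itv.
have pdf_ge x : x \in `]a, a + 1] -> normal_pdf 0 s (`|a| + 1) <= normal_pdf 0 s x.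
  rewrite in_itv /= => /andP[ax xa]; rewrite !normal_pdfE //.
  rewrite ler_wpM2l ?normal_peak_ge0 // /normal_fun ler_expR.
  rewrite ler_wpM2r ?invr_ge0 ?mulrn_wge0 ?sqr_ge0 // lerN2 !subr0.
  have := ler_norm a; have := ler_norm (- a); rewrite normrN.
  move: `|a| => c a1 a2; rewrite -subr_ge0 subr_sqr mulr_ge0 //; lra.
have pdf0 : 0 < normal_pdf 0 s (`|a| + 1).
  by rewrite normal_pdfE // mulr_gt0 ?expR_gt0 // normal_peak_gt0.
apply: (@lt_le_trans _ _
  (\int[lebesgue_measure]_(x in `]a, (a + 1)%R]%classic) (normal_pdf 0 s (`|a| + 1)%R)%:E)%E).
  rewrite integral_cst //.
  have := lebesgue_measure_itv `]a, (a + 1)%R].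
  rewrite /= lte_fin ltrDl ltr01 => ->.
  by rewrite -EFinB -EFinM lte_fin addrAC subrr add0r mulr1.
apply: ge0_le_integral => //.
- by move=> x _; rewrite lee_fin ltW.
- apply/measurable_EFinP; apply: measurable_funTS.
  exact: measurable_normal_pdf.
Qed.

(* Sealed: unification would otherwise unfold [normal_prob]. *)
Fact gauss_key :
  {g : R -> set R -> \bar R | g = fun h A => normal_prob 0 (Num.sqrt h) A}.
Proof. by eexists. Qed.

Definition gauss : R -> set R -> \bar R := sval gauss_key.

Lemma gaussE h A : gauss h A = normal_prob 0 (Num.sqrt h) A.
Proof. by rewrite /gauss; case: gauss_key => g /= ->. Qed.

Lemma gauss_setT h : gauss h setT = 1%E.
Proof. by rewrite gaussE; exact: probability_setT. Qed.

Lemma gauss_ge0 h A : (0 <= gauss h A)%E.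
Proof. by rewrite gaussE; exact: measure_ge0. Qed.

Lemma gauss_fin_num h A : measurable A -> gauss h A \is a fin_num.
Proof. by move=> mA; rewrite gaussE; exact: fin_num_measure. Qed.

Lemma gauss_le1 h A : measurable A -> (gauss h A <= 1)%E.
Proof. by move=> mA; rewrite gaussE; exact: probability_le1. Qed.

Lemma gauss_gt0 h a : 0 < h -> (0 < gauss h `]a, (a + 1)%R]%classic)%E.
Proof.
by move=> h0; rewrite gaussE; apply: normal_prob_gt0; rewrite gt_eqF // sqrtr_gt0.
Qed.

End NormalPositive.

(** * Factorisation over past and future *)

Section MarkovProperty.
Context {R : realType} {m : nat} d (T : measurableType d) (P : probability T R).
Variables (Q : 'M[R]_m) (kap : R -> T -> 'I_m) (W : R -> T -> R) (i : 'I_m).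
Hypothesis kap0 : forall w, kap 0 w = i.
Hypothesis W0 : forall w, W 0 w = 0.
Hypothesis mkap : forall t k, measurable [set w | kap t w = k].
Hypothesis mW : forall t, measurable_fun setT (W t).
Hypothesis fdd : MC_BM_fdd P Q i kap W.

Lemma fdd_gauss L t k A : time_grid L t -> (forall l, measurable (A l)) ->
  P (cyl_event kap W L t k A) =
  ((\prod_(l < L) expmx Q (t l - tprev t l) (kprev i k l) (k l))%:E *
   \prod_(l < L) gauss (t l - tprev t l) (A l))%E.
Proof.
by move=> ht mA; rewrite fdd //; congr (_ * _)%E; apply: eq_bigr => l _; rewrite gaussE.
Qed.

Variables (N0 j0 : nat).
Let t0 : R := dyad N0 j0.

Definition past : set (set T) := coord kap W [set t | dyadic t /\ t <= t0].

Lemma past_measurable : <<s past >> `<=` measurable.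
Proof.
apply: smallest_sub; first exact: sigma_algebra_measurable.
by apply: coord_measurable => // t [].
Qed.

Variables (h : R) (e : nat).
Hypothesis h0 : 0 < h.

Let fut_time (l : nat) : R := t0 + h * l%:R.

Definition future (K : nat -> 'I_m) (B : nat -> set R) : set T :=
  [set w | forall l, (l < e)%N -> kap (fut_time l.+1) w = K l /\
     B l (W (fut_time l.+1) w - W (fut_time l) w)].

Lemma future_measurable K B : (forall l, measurable (B l)) -> measurable (future K B).
Proof.
move=> mB.
have -> : future K B = \bigcap_(l in [set l | (l < e)%N])
    ([set w | kap (fut_time l.+1) w = K l] `&`
     (fun w => W (fut_time l.+1) w - W (fut_time l) w) @^-1` B l).
  by apply/seteqP; split=> w H l le; exact: H.
apply: bigcap_measurableType => l _; apply: measurableI; first exact: mkap.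
by rewrite -[X in measurable X]setTI; apply: measurable_funB.
Qed.

Definition fut_prob (k : 'I_m) (K : nat -> 'I_m) (B : nat -> set R) : \bar R :=
  ((\prod_(l < e) expmx Q h (kprev k K l) (K l))%:E *
   \prod_(l < e) gauss h (B l))%E.

Let regroup (a a' b b' : R) (x x' y y' : \bar R) :
  a = a' -> b = b' -> x = x' -> y = y' ->
  ((a * b)%:E * (x * y) = a'%:E * x' * (b'%:E * y'))%E.
Proof. by move=> -> -> -> ->; rewrite EFinM muleACA. Qed.

(** The past grid up to [t0] and the [e] future steps of length [h] form one time grid, over which
    the product formula splits at index [J]. *)
Lemma fdd_future N J (k : 'I_m) K B A : dyad N J = t0 ->
  (forall l, measurable (B l)) -> gridcyl kap W (gtime N) J A ->
  P (A `&` ([set w | kap t0 w = k] `&` future K B)) =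
  (P (A `&` [set w | kap t0 w = k]) * fut_prob k K B)%E.
Proof.
move=> NJ mB [Kp [Ap [mA ->]]].
set C := cyl_event _ _ _ _ _ _.
(* A past cylinder fixes the phase at [t0]: either it is incompatible with [k] or it implies it. *)
have kE w : C w -> kap t0 w = kprev i Kp J.
  rewrite -NJ /C; case: (J) => [|l] Cw; first by rewrite dyad0 kap0.
  by have [] := Cw l (ltnSn l).
have [kJ|kJ] := eqVneq (kprev i Kp J) k; last first.
  have H0 (X : set T) : C `&` ([set w | kap t0 w = k] `&` X) = set0.
    apply/seteqP; split=> // w [Cw [/= kw _]].
    by rewrite -kw kE ?eqxx in kJ.
  by rewrite H0 -[X in C `&` X]setIT H0 measure0 mul0e.
have CI (X : set T) : C `&` ([set w | kap t0 w = k] `&` X) = C `&` X.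
  apply/seteqP; split=> w [Cw]; first by case.
  by move=> Xw; split=> //; split=> //=; rewrite kE.
have CI0 : C `&` [set w | kap t0 w = k] = C.
  by apply/seteqP; split=> w; [case|move=> Cw; split=> //=; rewrite kE].
rewrite CI CI0.
(* Concatenated times, phases and increment sets: the past for indices below [J], the future from
   [J] on. *)
pose tt l := if (l < J)%N then gtime N l else fut_time (l - J).+1.
pose KK l := if (l < J)%N then Kp l else K (l - J)%N.
pose AA l := if (l < J)%N then Ap l else B (l - J)%N.
have tt_past l : (l < J)%N -> tt l = gtime N l by rewrite /tt => ->.
have tt_fut l : tt (J + l)%N = fut_time l.+1.
  by rewrite /tt ltnNge leq_addr /= addKn.
have prev_past l : (l < J)%N -> tprev tt l = tprev (gtime N) l.
  by case: l => [//|l] lJ /=; rewrite tt_past // ltnW.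
have prev_fut l : tprev tt (J + l)%N = fut_time l.
  case: l => [|l]; last by rewrite addnS /= tt_fut.
  rewrite addn0 /fut_time mulr0 addr0 -NJ; case: (J) tt_past => [|j] H /=.
    by rewrite dyad0.
  by rewrite H.
have gtt : time_grid (J + e) tt.
  split.
    rewrite /tt; case: ifP => _; first by rewrite /gtime dyad_gt0.
    by rewrite /fut_time ltr_wpDl ?dyad_ge0 // mulr_gt0 // ltr0n.
  move=> l _; have [lJ|lJ] := ltnP l.+1 J.
    by rewrite !tt_past ?(ltnW lJ) // /gtime ltr_dyad.
  rewrite -(subnKC lJ) tt_fut; move: lJ; rewrite leq_eqVlt => /predU1P[JE|lJ].
    rewrite -JE subnn tt_past; last by rewrite JE.
    rewrite /gtime -JE NJ /fut_time.
    by rewrite ltrDl mulr_gt0 // ltr0n.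
  have lJ' : (J <= l)%N by rewrite -ltnS.
  rewrite -[l in tt l](subnKC lJ') tt_fut /fut_time ltrD2l ltr_pM2l // ltr_nat.
  by rewrite subSn.
have step l : tt (J + l)%N - tprev tt (J + l)%N = h.
  by rewrite tt_fut prev_fut /fut_time -natr1; ring.
have mAA l : measurable (AA l) by rewrite /AA; case: ifP.
have -> : C `&` future K B = cyl_event kap W (J + e) tt KK AA.
  apply/seteqP; split=> [w [Cw Fw] l lJe|w H]; last first.
    split=> l lJ.
      have := H l (leq_trans lJ (leq_addr _ _)).
      by rewrite tt_past // prev_past // /KK /AA lJ.
    have := H (J + l)%N; rewrite ltn_add2l => /(_ lJ).
    by rewrite tt_fut prev_fut /KK /AA ltnNge leq_addr /= addKn.
  have [lJ|lJ] := ltnP l J.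
    by rewrite tt_past // prev_past // /KK /AA lJ; exact: Cw.
  rewrite -(subnKC lJ) tt_fut prev_fut /KK /AA ltnNge leq_addr /= addKn.
  by apply: Fw; rewrite -(ltn_add2l J) subnKC.
rewrite fdd_gauss // [P C]fdd_gauss //; last exact: gtime_grid.
rewrite !big_split_ord /= /fut_prob.
apply: regroup; last 2 first.
- by apply: eq_bigr => l _; rewrite (tt_past _ (ltn_ord l)) (prev_past _ (ltn_ord l)) /AA ltn_ord.
- by apply: eq_bigr => l _; rewrite step /AA ltnNge leq_addr /= addKn.
- apply: eq_bigr => l _; rewrite tt_past // prev_past // /KK ltn_ord.
  by congr (expmx _ _ _ _); case: (nat_of_ord l) (ltn_ord l) => [//|j] /= /ltnW ->.
- apply: eq_bigr => l _; rewrite step /KK ltnNge leq_addr /= addKn.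
  congr (expmx _ _ _ _); case: (nat_of_ord l) => [|j] /=.
    by rewrite addn0 -kJ; case: (J) => [//|j] /=; rewrite ltnSn.
  by rewrite addnS /= ltnNge leq_addr /= addKn.
Qed.

Definition future_incr (B : nat -> set R) : set T :=
  [set w | forall l, (l < e)%N -> B l (W (fut_time l.+1) w - W (fut_time l) w)].

Lemma future_incr_measurable B : (forall l, measurable (B l)) ->
  measurable (future_incr B).
Proof.
move=> mB.
have -> : future_incr B = \bigcap_(l in [set l | (l < e)%N])
     ((fun w => W (fut_time l.+1) w - W (fut_time l) w) @^-1` B l).
  by apply/seteqP; split=> w H l le; exact: H.
apply: bigcap_measurableType => l _.
by rewrite -[X in measurable X]setTI; apply: measurable_funB.
Qed.

Let Fk k := [set w | kap t0 w = k].

Let futureE k K B X :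
  future K (fun=> setT) `&` (X `&` (Fk k `&` future_incr B)) =
  X `&` (Fk k `&` future K B).
Proof.
apply/seteqP; split=> [w [fK [Xw [kw fB]]]|w [Xw [kw fKB]]].
  by split=> //; split=> // l le; split; [have [] := fK l le|exact: fB].
split; first by move=> l le; have [] := fKB l le.
by split=> //; split=> // l le; have [] := fKB l le.
Qed.

Let prod_gauss (B : nat -> set R) : (forall l, measurable (B l)) ->
  exists2 c : R, 0 <= c & (\prod_(l < e) gauss h (B l) = c%:E)%E.
Proof.
move=> mB; exists (\prod_(l < e) fine (gauss h (B l))).
  by rewrite prodr_ge0 // => l _; rewrite fine_ge0 // gauss_ge0.
elim: e => [|n IH]; first by rewrite !big_ord0.
by rewrite !big_ord_recr /= IH EFinM fineK // gauss_fin_num.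
Qed.

Let fut_probE k K B : fut_prob k K B =
  (fut_prob k K (fun=> setT) * \prod_(l < e) gauss h (B l))%E.
Proof.
rewrite /fut_prob -muleA; congr (_ * _)%E.
by rewrite [X in (X * _)%E]big1 ?mul1e // => l _; rewrite gauss_setT.
Qed.

(** The future phases are removed without summing transition probabilities: the identity factorises
    for each prescribed phase word, and the words form a covering pi-system, so it holds for the
    whole space. *)
Lemma incr_future N J k B A : dyad N J = t0 -> (forall l, measurable (B l)) ->
  gridcyl kap W (gtime N) J A -> measurable A ->
  P (A `&` (Fk k `&` future_incr B)) =
  (P (A `&` Fk k) * \prod_(l < e) gauss h (B l))%E.
Proof.
move=> NJ mB GA mA; have [c c0 cE] := prod_gauss mB.
pose G : set (set T) := [set E | E = set0 \/ exists K, E = future K (fun=> setT)].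
have mT : forall l : nat, measurable (setT : set R) by [].
rewrite cE -[X in P X = _]setTI -[X in (P X * _)%E]setTI.
apply: (pi_lambda_scale (G := G) (g := fun n => future (all_K i n) (fun=> setT))) => //.
- by move=> _ [->//|[K ->]]; exact: future_measurable.
- move=> _ _ [->|[K ->]] [->|[K' ->]]; rewrite ?set0I ?setI0; try by left.
  have [KE|] := pselect (forall l, (l < e)%N -> K l = K' l).
    right; exists K; apply/seteqP; split=> [w []//|w H]; split=> // l le.
    by have [] := H l le; rewrite KE.
  move=> /existsNP[l /not_implyP[le nK]]; left.
  apply/seteqP; split=> // w [/(_ l le)[e1 _] /(_ l le)[e2 _]].
  by apply: nK; rewrite -e1 -e2.
- by move=> n; right; exists (all_K i n).
- apply/seteqP; split=> // w _.
  have [n nK] := all_K_onto i e (fun l => kap (fut_time l.+1) w).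
  by exists n => // l le; rewrite nK.
- apply: measurableI => //; apply: measurableI; first exact: mkap.
  exact: future_incr_measurable.
- by apply: measurableI => //; exact: mkap.
- move=> _ [->|[K ->]]; first by rewrite !set0I measure0 mul0e.
  rewrite futureE (fdd_future k K NJ mB GA) fut_probE cE muleA; congr (_ * _)%E.
  rewrite -(fdd_future k K NJ mT GA); congr (P _).
  rewrite -futureE; congr (_ `&` (_ `&` _)).
  by apply/seteqP; split=> [w []//|w kw]; split.
- exact: (@measurableT _ (g_sigma_algebraType G)).
Qed.

Definition future_const (k : 'I_m) : set T :=
  [set w | forall l, (l < e)%N -> kap (fut_time l.+1) w = k].

Lemma future_const_measurable k : measurable (future_const k).
Proof.
have -> : future_const k =
    \bigcap_(l in [set l | (l < e)%N]) [set w | kap (fut_time l.+1) w = k].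
  by apply/seteqP; split=> w H l le; exact: H.
by apply: bigcap_measurableType => l _; exact: mkap.
Qed.

(** Here the phase word is fixed and the increments vary. The total increment over the [e] steps is
    measurable for the sigma-algebra of the individual increments, so the identity known for
    products extends to it. *)
Lemma const_future N J k (B : set R) A : dyad N J = t0 -> measurable B ->
  gridcyl kap W (gtime N) J A -> measurable A -> 0 <= expmx Q h k k ->
  P ([set w | B (W (fut_time e) w - W t0 w)%R] `&` (A `&` (Fk k `&` future_const k))) =
  (P ([set w | B (W (fut_time e) w - W t0 w)%R] `&` (A `&` Fk k)) *
   (expmx Q h k k ^+ e)%:E)%E.
Proof.
move=> NJ mB GA mA a0.
pose G : set (set T) := [set E | exists2 B, (forall l, measurable (B l)) & E = future_incr B].
have mT : forall l : nat, measurable (setT : set R) by [].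
have GT : G setT by exists (fun=> setT) => //; apply/seteqP; split.
apply: (pi_lambda_scale (G := G) (g := fun=> setT)) => //.
- by move=> _ [B' mB' ->]; exact: future_incr_measurable.
- move=> _ _ [B1 m1 ->] [B2 m2 ->]; exists (fun l => B1 l `&` B2 l).
    by move=> l; exact: measurableI.
  apply/seteqP; split=> [w [H1 H2] l le|w H]; first by split; [exact: H1|exact: H2].
  by split=> l le; have [] := H l le.
- by rewrite bigcup_const.
- apply: measurableI => //; apply: measurableI; first exact: mkap.
  exact: future_const_measurable.
- by apply: measurableI => //; exact: mkap.
- exact: exprn_ge0.
- move=> _ [B' mB' ->].
  have -> : future_incr B' `&` (A `&` (Fk k `&` future_const k)) =
      A `&` (Fk k `&` future (fun=> k) B').
    apply/seteqP; split=> [w [fB [Aw [kw fk]]]|w [Aw [kw fKB]]].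
      by split=> //; split=> // l le; split; [exact: fk|exact: fB].
    split; first by move=> l le; have [] := fKB l le.
    by split=> //; split=> // l le; have [] := fKB l le.
  rewrite (fdd_future k _ NJ mB' GA) /fut_prob.
  have -> : \prod_(l < e) expmx Q h (kprev k (fun=> k) l) k = expmx Q h k k ^+ e.
    rewrite (eq_bigr (fun=> expmx Q h k k)); first by rewrite prodr_const card_ord.
    by move=> l _; case: (nat_of_ord l).
  rewrite muleCA muleC; congr (_ * _)%E.
  rewrite -(incr_future k NJ mB' GA mA); congr (P _).
  by rewrite setIA [LHS]setIC.
- pose GTy := g_sigma_algebraType G.
  have mS : measurable_fun (setT : set GTy)
      (fun w => \sum_(l < e) (W (fut_time l.+1) w - W (fut_time l) w) : R).
    apply: measurable_sum => l _ B' mB'; rewrite setTI; apply: sub_sigma_algebra.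
    exists (fun l' => if l' == l :> nat then B' else setT).
      by move=> l'; case: ifP.
    apply/seteqP; split=> [w Bw l' l'e|w H]; first by case: eqP => // ->.
    by have := H l (ltn_ord l); rewrite eqxx.
  have := mS measurableT _ mB; rewrite setTI; congr (<<s _ >> _).
  apply/seteqP; split=> w /=;
    rewrite -(big_mkord xpredT (fun l => W (fut_time l.+1) w - W (fut_time l) w));
    by rewrite (telescope_sumr (fun l => W (fut_time l) w)) // /fut_time mulr0 addr0.
Qed.

End MarkovProperty.

(** * Intervals without a change of phase *)

Section QuietIntervals.
Context {R : realType} {m : nat} d (T : measurableType d) (P : probability T R).
Variables (Q : 'M[R]_m) (kap : R -> T -> 'I_m) (W : R -> T -> R) (i : 'I_m).
Hypothesis kap0 : forall w, kap 0 w = i.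
Hypothesis W0 : forall w, W 0 w = 0.
Hypothesis mkap : forall t k, measurable [set w | kap t w = k].
Hypothesis mW : forall t, measurable_fun setT (W t).
Hypothesis fdd : MC_BM_fdd P Q i kap W.

Variables (N0 j0 : nat).
Let t0 : R := dyad N0 j0.

Let Fk k := [set w | kap t0 w = k].
Let incr (eta : R) (B : set R) := [set w | B (W (t0 + eta) w - W t0 w)].

Let mincr eta B : measurable B -> measurable (incr eta B).
Proof.
move=> mB; rewrite -[X in measurable X]setTI.
by apply: (measurable_funB (mW (t0 + eta)) (mW t0)).
Qed.

(** Both sides are measures in the past event [A]; they agree on the cylinders of every refinement
    of the grid of [t0], hence on the whole past. *)
Lemma const_incr_past (h : R) (e : nat) k B A : 0 < h -> (0 < e)%N ->
  measurable B -> 0 <= expmx Q h k k -> <<s past kap W N0 j0 >> A ->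
  P (A `&` (Fk k `&` (future_const kap N0 j0 h e k `&` incr (h * e%:R) B))) =
  (P (A `&` Fk k) * (expmx Q h k k ^+ e * fine (gauss (h * e%:R) B))%:E)%E.
Proof.
move=> h0 e0 mB a0.
set c := expmx Q h k k ^+ e * _; set E := Fk k `&` _.
have c0 : 0 <= c by rewrite mulr_ge0 ?exprn_ge0 // fine_ge0 // gauss_ge0.
have mE : measurable E.
  apply: measurableI; first exact: mkap.
  by apply: measurableI; [exact: future_const_measurable|exact: mincr].
have mkap' t : dyadic t -> forall k, measurable [set w | kap t w = k] by move=> _; exact: mkap.
have mW' t : dyadic t -> measurable_fun setT (W t) by move=> _; exact: mW.
have mono n : grid (N0 + n) (j0 * 2 ^ n) `<=` @grid R (N0 + n.+1) (j0 * 2 ^ n.+1).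
  exact: filtration_grid.
pose m2 := mscale (NngNum c0) (mrestr P (mkap t0 k)).
move=> pA.
have {}pA : <<s coord kap W (\bigcup_n grid (N0 + n) (j0 * 2 ^ n)) >> A.
  by apply: sub_sigma_algebra2 pA; apply: coord_mono; exact: filtration_dyadic.
have fin : (mrestr P mE setT < +oo)%E.
  by rewrite /mrestr setTI (le_lt_trans (probability_le1 P mE)) // ltry.
have eqm n X : gridcyl kap W (gtime (N0 + n)) (j0 * 2 ^ n) X -> mrestr P mE X = m2 X.
  move=> GX; have mX : measurable X.
    by move: GX; apply: gridcyl_measurable.
  have NJ : dyad (N0 + n) (j0 * 2 ^ n) = t0 :> R by exact: dyad_refine.
  rewrite /m2 /mscale /mrestr /= muleC.
  have -> : X `&` E = incr (h * e%:R) B `&` (X `&` (Fk k `&` future_const kap N0 j0 h e k)).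
    by rewrite /E ![_ `&` incr _ _]setIC [Fk k `&` (_ `&` _)]setICA setICA.
  rewrite (const_future kap0 mkap mW fdd e h0 NJ mB GX mX a0).
  have he0 : 0 < h * e%:R by rewrite mulr_gt0 // ltr0n.
  have -> : [set w | B (W (dyad N0 j0 + h * e%:R) w - W (dyad N0 j0) w)] `&`
      (X `&` [set w | kap (dyad N0 j0) w = k]) =
      (* The total increment is read as one future step of length [h * e%:R]. *)
      X `&` (Fk k `&` future_incr W N0 j0 (h * e%:R) 1 (fun=> B)).
    rewrite setIC -setIA; congr (_ `&` (_ `&` _)).
    apply/seteqP; split=> [w Bw [|//] _|w H]; first by rewrite mulr0 mulr1 addr0.
    by have := H 0%N isT; rewrite mulr0 mulr1 addr0.
  rewrite (incr_future kap0 mkap mW fdd 1 he0 k NJ (fun=> mB) GX mX).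
  rewrite big_ord1 -muleA [(_ * _%:E)%E]muleC -[gauss _ _]fineK ?gauss_fin_num //.
rewrite muleC.
exact: (@two_stage _ _ _ _ kap W i kap0 W0 mkap' mW' (mrestr P mE)
  (mscale (NngNum c0) (mrestr P (mkap t0 k))) (fun n => N0 + n)%N
  (fun n => j0 * 2 ^ n)%N fin mono eqm A pA).
Qed.

Lemma phase_partition t A : measurable A ->
  P A = (\sum_(k < m) P (A `&` [set w | kap t w = k]))%E.
Proof.
move=> mA; rewrite -measure_bigsetU_ord.
- congr (P _); apply/seteqP; split=> w.
    by move=> Aw; rewrite (bigD1 (kap t w)) //=; left.
  by apply: (big_ind (fun X : set T => X w -> A w)) => [//|X Y hX hY [/hX|/hY]//|k _ []].
- by move=> k; apply: measurableI => //; exact: mkap.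
- by move=> k k' _ _ [w [[_ /= <-] [_ /= <-]]].
Qed.

Let c := expR (mx_total Q).

(** The step is [eta / e]. By Bernoulli's inequality the bound does not depend on the number [e] of
    observations, which permits refining them indefinitely. *)
Lemma quiet_step (eta : R) (e : nat) B A : 0 < eta <= 1 -> c * eta <= 1 ->
  (0 < e)%N -> measurable B -> <<s past kap W N0 j0 >> A ->
  ((1 - c * eta)%:E * gauss eta B * P A <=
   P (A `&` ([set w | forall l, (l < e)%N ->
      kap (t0 + eta / e%:R * l.+1%:R) w = kap t0 w] `&` incr eta B)))%E.
Proof.
move=> /andP[eta0 eta1] ceta e0 mB pA.
have mA : measurable A.
  by apply: (@past_measurable _ _ _ _ kap W mkap mW N0 j0).
pose h := eta / e%:R.
have eR : (0 : R) < e%:R by rewrite ltr0n.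
have h0 : 0 < h by rewrite divr_gt0.
have hE : h * e%:R = eta by rewrite divfK // gt_eqF.
have h1 : h <= 1.
  by apply: le_trans eta1; rewrite ler_pdivrMr // ler_peMr ?ler1n // ltW.
have c0 : 0 <= c by exact: expR_ge0.
have ch1 : c * h <= 1.
  by apply: le_trans ceta; rewrite ler_wpM2l // -hE ler_peMr ?ler1n // ltW.
have age k : 1 - c * h <= expmx Q h k k by apply: expmx_diag_ge; rewrite ltW.
have ch0 : 0 <= 1 - c * h by rewrite subr_ge0.
have a0 k : 0 <= expmx Q h k k by apply: le_trans (age k).
have aeta k : 1 - c * eta <= expmx Q h k k ^+ e.
  apply: (@le_trans _ _ ((1 - c * h) ^+ e)); last by rewrite lerXn2r // nnegrE.
  rewrite -hE mulrA mulrC; apply: pow_one_sub_ge.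
  by rewrite ch1 mulr_ge0 // ltW.
set E := _ `&` incr eta B.
have mE : measurable E.
  apply: measurableI; last exact: mincr.
  have -> : [set w | forall l, (l < e)%N -> kap (t0 + h * l.+1%:R) w = kap t0 w] =
      \bigcup_(k in [set: 'I_m]) (Fk k `&` future_const kap N0 j0 h e k).
    apply/seteqP; split=> [w H|w [k _ [/= kw H]] l le]; last by rewrite kw; exact: H.
    by exists (kap t0 w).
  apply: fin_bigcup_measurable => // k _; apply: measurableI; first exact: mkap.
  exact: future_const_measurable.
rewrite (phase_partition t0 mA) (phase_partition t0 (measurableI _ _ mA mE)).
rewrite ge0_sume_distrr; last by move=> k _; exact: measure_ge0.
apply: lee_sum => k _.
have -> : A `&` E `&` Fk k =
    A `&` (Fk k `&` (future_const kap N0 j0 h e k `&` incr (h * e%:R) B)).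
  rewrite hE; apply/seteqP; split=> w.
    by move=> [[Aw [cw iw]] kw]; split=> //; split=> //; split=> // l le; rewrite cw.
  by move=> [Aw [kw [cw iw]]]; do ![split=> //] => l le; rewrite kw; exact: cw.
rewrite const_incr_past // muleC hE EFinM fineK ?gauss_fin_num //.
apply: lee_wpmul2l; first exact: measure_ge0.
by apply: lee_wpmul2r; [exact: gauss_ge0|rewrite lee_fin].
Qed.

(** Only dyadic subdivisions of the interval are observed, which keeps the event measurable; for a
    step path it implies constancy on [[t0, t0 + eta[]. *)
Definition quiet (eta : R) : set T :=
  [set w | forall M l, (l < 2 ^ M)%N -> kap (t0 + eta / (2 ^ M)%:R * l.+1%:R) w = kap t0 w].

Let quietM (eta : R) M := [set w | forall l, (l < 2 ^ M)%N ->
  kap (t0 + eta / (2 ^ M)%:R * l.+1%:R) w = kap t0 w].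

Let mquietM eta M : measurable (quietM eta M).
Proof.
have -> : quietM eta M = \bigcup_(k in [set: 'I_m]) (Fk k `&`
    future_const kap N0 j0 (eta / (2 ^ M)%:R) (2 ^ M) k).
  apply/seteqP; split=> [w H|w [k _ [/= kw H]] l le]; last by rewrite kw; exact: H.
  by exists (kap t0 w).
apply: fin_bigcup_measurable => // k _; apply: measurableI; first exact: mkap.
exact: future_const_measurable.
Qed.

Lemma quiet_measurable eta : measurable (quiet eta).
Proof.
have -> : quiet eta = \bigcap_M quietM eta M.
  by apply/seteqP; split=> [w H M _|w H M]; [exact: H|exact: (H M I)].
exact: bigcapT_measurable.
Qed.

(** The observations at finer subdivisions give decreasing events, and the bound at each level
    survives by continuity from above. *)
Lemma quiet_prob (eta : R) B A : 0 < eta <= 1 -> c * eta <= 1 ->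
  measurable B -> <<s past kap W N0 j0 >> A ->
  ((1 - c * eta)%:E * gauss eta B * P A <= P (A `&` (quiet eta `&` incr eta B)))%E.
Proof.
move=> eta01 ceta mB pA.
have mA : measurable A.
  by apply: (@past_measurable _ _ _ _ kap W mkap mW N0 j0).
pose F M := A `&` (quietM eta M `&` incr eta B).
have mF M : measurable (F M).
  by apply: measurableI => //; apply: measurableI; [exact: mquietM|exact: mincr].
have -> : A `&` (quiet eta `&` incr eta B) = \bigcap_M F M.
  apply/seteqP; split=> [w [Aw [qw iw]] M _|w H].
    by split=> //; split=> //; exact: qw.
  have [Aw [_ iw]] := H 0%N I; split=> //; split=> // M.
  by have [_ []] := H M I.
have niF : nonincreasing_seq F.
  apply/nonincreasing_seqP => M; apply/subsetPset => w [Aw [qw iw]].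
  split=> //; split=> // l lM; have := qw (l * 2).+1.
  have lt : ((l * 2).+1 < 2 ^ M.+1)%N by rewrite expnSr; lia.
  move=> /(_ lt) <-; congr (kap _ _); rewrite expnSr natrM.
  have -> : (l * 2).+2%:R = l.+1%:R * 2 :> R by rewrite -natrM; congr (_%:R); lia.
  by congr (_ + _); field; rewrite pnatr_eq0 -lt0n expn_gt0.
have F0 : (P (F 0%N) < +oo)%E by rewrite (le_lt_trans (probability_le1 P (mF _))) ?ltry.
have cv := nonincreasing_cvg_mu F0 mF (bigcapT_measurable mF) niF.
rewrite -(cvg_lim _ cv) //; apply: lime_ge; first by apply/cvg_ex; eexists; exact: cv.
apply: nearW => M /=; apply: quiet_step => //.
by rewrite expn_gt0.
Qed.

End QuietIntervals.

(** * Regulated paths *)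

Section StepPaths.
Context {R : realType} {m : nat}.
Variable k : R -> 'I_m.
Hypothesis step_k : step_path k.

(** The horizon [t + 1] guarantees that the piece containing [t] extends to the right of [t]. *)
Lemma step_locate (t : R) : 0 <= t -> exists (N : nat) (s : nat -> R),
  [/\ s 0%N = 0, t + 1 <= s N,
      (forall l, (l < N)%N -> s l < s l.+1 /\
        forall u, s l <= u < s l.+1 -> k u = k (s l)),
      (forall l, (l <= N)%N -> 0 <= s l) &
      forall x, 0 <= x < t + 1 -> exists2 l, (l < N)%N & s l <= x < s l.+1].
Proof.
move=> t0; have t1 : 0 < t + 1 by rewrite ltr_wpDl.
have [N [s [s0 [sN H]]]] := step_k t1; exists N, s; split=> //.
  elim=> [|l IH] lN; first by rewrite s0.
  by apply: (le_trans (IH (ltnW lN))); have [/ltW] := H l lN.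
move=> x /andP[x0 xt].
have ex : exists l, x < s l by exists N; exact: lt_le_trans sN.
case: (ex_minnP ex) => -[|l] xl lmin; first by rewrite s0 ltNge x0 in xl.
exists l; first exact/lmin/(lt_le_trans xt).
by rewrite xl andbT leNgt; apply/negP => /lmin; rewrite ltnn.
Qed.

Lemma step_right (t : R) : 0 <= t ->
  exists2 e : R, 0 < e & forall u, t <= u < t + e -> k u = k t.
Proof.
move=> t0; have [N [s [s0 sN H s_ge0 loc]]] := step_locate t0.
have [|l lN /andP[sl tl]] := loc t; first by rewrite t0 ltrDl ltr01.
exists (s l.+1 - t); first by rewrite subr_gt0.
move=> u /andP[tu]; rewrite addrC subrK => ul.
by have [_ Hl] := H l lN; rewrite !Hl // ?sl ?tl // ul (le_trans sl).
Qed.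

Lemma step_left (t : R) : 0 < t -> exists l, left_lim k t l.
Proof.
move=> t0; have [N [s [s0 sN H s_ge0 loc]]] := step_locate (ltW t0).
have ex : exists l, t <= s l by exists N; apply: le_trans sN; rewrite lerDl.
case: (ex_minnP ex) => -[|l] tl lmin; first by rewrite s0 leNgt t0 in tl.
have sl : s l < t by rewrite ltNge; apply/negP => /lmin; rewrite ltnn.
have lN : (l < N)%N by apply: lmin; apply: le_trans sN; rewrite lerDl.
exists (k (s l)), (t - s l); first by rewrite subr_gt0.
move=> u; rewrite opprB addrC subrK => /andP[su ut].
by have [_ Hl] := H l lN; apply: Hl; rewrite ltW //= (lt_le_trans ut).
Qed.

Lemma left_lim_unique (t : R) l l' : left_lim k t l -> left_lim k t l' -> l = l'.
Proof.
move=> [e e0 H] [e' e0' H'].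
pose u := t - Num.min e e' / 2.
have m0 : 0 < Num.min e e' by rewrite lt_min e0.
have m1 : Num.min e e' <= e by rewrite ge_min lexx.
have m2 : Num.min e e' <= e' by rewrite ge_min lexx orbT.
by rewrite -(H u) ?(H' u) // /u; apply/andP; split; lra.
Qed.

Lemma step_breaks (t : R) : 0 <= t -> exists2 br : seq R, (forall x, x \in br -> 0 <= x) &
  forall u v, 0 <= u -> u < v -> v <= t -> (forall x, x \in br -> ~~ (u < x < v)) ->
    forall x, u <= x < v -> k x = k u.
Proof.
move=> t0; have [N [s [s0 sN H s_ge0 loc]]] := step_locate t0.
exists [seq s l | l <- iota 0 N.+1].
  by move=> _ /mapP[l + ->]; rewrite mem_iota add0n ltnS => /andP[_]; exact: s_ge0.
move=> u v u0 uv vt nobr x /andP[ux xv].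
have [|l lN /andP[sl ul]] := loc u.
  by rewrite u0 (lt_le_trans uv) // (le_trans vt) // lerDl.
have vl : v <= s l.+1.
  have := nobr (s l.+1); rewrite ul andTb -leNgt; apply.
  by apply: map_f; rewrite mem_iota add0n.
have [_ Hl] := H l lN.
by rewrite !Hl // ?sl ?ul // (le_trans sl ux) (lt_le_trans xv).
Qed.

End StepPaths.

(** * Continuous functions on the half-line *)

Section HalfLineContinuity.
Context {R : realType}.
Implicit Types f : R -> R.

Definition cont0 f := forall s, 0 <= s -> forall e, 0 < e ->
  exists2 dl, 0 < dl & forall u, 0 <= u -> `|u - s| < dl -> `|f u - f s| < e.

Lemma within_cont0 f : {within [set t | 0 <= t], continuous f} -> cont0 f.
Proof.
move=> /subspace_continuousP cf s s0 e e0.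
have /cvgrPdist_lt /(_ _ e0) := cf s s0.
rewrite near_withinE => /nbhs_ballP[dl /= dl0 H]; exists dl => // u u0 us.
by rewrite distrC; apply: H => //; rewrite /ball /= distrC.
Qed.

Lemma cont0D f g : cont0 f -> cont0 g -> cont0 (fun t => f t + g t).
Proof.
move=> cf cg s s0 e e0; have e2 : 0 < e / 2 by rewrite divr_gt0.
have [d1 d10 H1] := cf s s0 _ e2; have [d2 d20 H2] := cg s s0 _ e2.
exists (Num.min d1 d2); first by rewrite lt_min d10.
move=> u u0; rewrite lt_min => /andP[u1 u2].
rewrite (_ : _ - _ = (f u - f s) + (g u - g s)); last by ring.
rewrite (le_lt_trans (ler_normD _ _)) // [e]splitr.
by apply: ltrD; [exact: H1|exact: H2].
Qed.

Lemma cont0N f : cont0 f -> cont0 (fun t => - f t).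
Proof.
move=> cf s s0 e e0; have [d1 d10 H1] := cf s s0 _ e0; exists d1 => // u u0 us.
by rewrite -opprD normrN; exact: H1.
Qed.

Lemma cont0_left f s y : cont0 f -> 0 < s -> (forall u, 0 <= u < s -> f u = y) -> f s = y.
Proof.
move=> cf s0 fy; apply/eqP; rewrite -subr_eq0 -normr_eq0; apply/negPn/negP => ne.
have e0 : 0 < `|f s - y| by rewrite lt_def ne normr_ge0.
have [dl dl0 H] := cf s (ltW s0) _ e0.
pose u := s - Num.min s dl / 2.
have m0 : 0 < Num.min s dl by rewrite lt_min s0.
have m1 : Num.min s dl <= s by rewrite ge_min lexx.
have m2 : Num.min s dl <= dl by rewrite ge_min lexx orbT.
have u0 : 0 <= u by rewrite /u; lra.
have us : u < s by rewrite /u; lra.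
suff ud : `|u - s| < dl by have := H u u0 ud; rewrite fy ?u0 // distrC ltxx.
by rewrite ltr0_norm ?subr_lt0 // /u; lra.
Qed.

Lemma cont0_right f v t y : cont0 f -> 0 <= v < t ->
  (forall u, v < u <= t -> f u = y) -> f v = y.
Proof.
move=> cf /andP[v0 vt] fy; apply/eqP; rewrite -subr_eq0 -normr_eq0; apply/negPn/negP => ne.
have e0 : 0 < `|f v - y| by rewrite lt_def ne normr_ge0.
have [dl dl0 H] := cf v v0 _ e0.
pose u := v + Num.min (t - v) dl / 2.
have m0 : 0 < Num.min (t - v) dl by rewrite lt_min dl0 subr_gt0 vt.
have m1 : Num.min (t - v) dl <= t - v by rewrite ge_min lexx.
have m2 : Num.min (t - v) dl <= dl by rewrite ge_min lexx orbT.
have uv : v < u by rewrite /u; lra.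
have ut : u <= t by rewrite /u; lra.
suff ud : `|u - v| < dl.
  by have := H u (ltW (le_lt_trans v0 uv)) ud; rewrite fy ?uv // distrC ltxx.
by rewrite gtr0_norm ?subr_gt0 // /u; lra.
Qed.

Lemma first_hit f y t : cont0 f -> 0 <= t -> f t = y ->
  exists dl, [/\ 0 <= dl <= t, f dl = y & forall s, 0 <= s < dl -> f s != y].
Proof.
move=> cf t0 ft; pose E := [set s | 0 <= s <= t /\ f s = y].
have hE : has_inf E.
  split; first by exists t; rewrite /E /= t0 lexx.
  by exists 0 => s [/andP[]].
have lb s : E s -> inf E <= s by move=> Es; apply: ge_inf => //; have [] := hE.
have i0 : 0 <= inf E by apply: lb_le_inf; [have [] := hE|move=> s [/andP[]]].
have it : inf E <= t by apply: lb; rewrite /E /= t0 lexx.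
exists (inf E); split; first by rewrite i0.
  apply/eqP; rewrite -subr_eq0 -normr_eq0; apply/negPn/negP => ne.
  have e0 : 0 < `|f (inf E) - y| by rewrite lt_def ne normr_ge0.
  have [dl dl0 H] := cf _ i0 _ e0.
  have [s Es sl] := inf_adherent dl0 hE; have := lb s Es => ls.
  case: (Es) => /andP[s0 st] fs.
  suff sd : `|s - inf E| < dl by have := H s s0 sd; rewrite fs distrC ltxx.
  by rewrite ger0_norm ?subr_ge0 // ltrBlDr addrC.
move=> s /andP[s0 si]; apply/negP => /eqP fs.
have := lb s; rewrite leNgt si /= => H; suff: false by []; apply: H.
by split=> //; rewrite s0 ltW // (lt_le_trans si).
Qed.

Lemma last_hit f y t : cont0 f -> 0 <= t -> f 0 = y ->
  exists dl, [/\ 0 <= dl <= t, f dl = y & forall s, dl < s <= t -> f s != y].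
Proof.
move=> cf t0 ft; pose E := [set s | 0 <= s <= t /\ f s = y].
have hE : has_sup E.
  split; first by exists 0; rewrite /E /= lexx t0.
  by exists t => s [/andP[]].
have ub s : E s -> s <= sup E by move=> Es; apply: ub_le_sup => //; have [] := hE.
have it : sup E <= t by apply: ge_sup; [have [] := hE|move=> s [/andP[]]].
have i0 : 0 <= sup E by apply: ub; rewrite /E /= lexx t0.
exists (sup E); split; first by rewrite i0.
  apply/eqP; rewrite -subr_eq0 -normr_eq0; apply/negPn/negP => ne.
  have e0 : 0 < `|f (sup E) - y| by rewrite lt_def ne normr_ge0.
  have [dl dl0 H] := cf _ i0 _ e0.
  have [s Es sl] := sup_adherent dl0 hE; have := ub s Es => ls.
  case: (Es) => /andP[s0 st] fs.
  suff sd : `|s - sup E| < dl by have := H s s0 sd; rewrite fs distrC ltxx.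
  by rewrite distrC ger0_norm ?subr_ge0 // ltrBlDr addrC -ltrBlDr.
move=> s /andP[si st]; apply/negP => /eqP fs.
have := ub s; rewrite leNgt si /= => H; suff: false by []; apply: H.
by split=> //; rewrite st andbT ltW // (le_lt_trans i0).
Qed.

Lemma cont0_within f (t : R) : cont0 f -> {within `[0, t], continuous f}.
Proof.
move=> cf; apply/subspace_continuousP => s; rewrite /= in_itv /= => /andP[s0 st].
apply/cvgrPdist_lt => e e0; have [dl dl0 H] := cf s s0 _ e0.
rewrite near_withinE; apply/nbhs_ballP; exists dl => //= u us.
rewrite /= in_itv /= => /andP[u0 ut]; rewrite distrC; apply: H => //.
by rewrite distrC.
Qed.

Lemma cont0_max f (t : R) : cont0 f -> 0 <= t ->
  exists2 s, 0 <= s <= t & forall u, 0 <= u <= t -> f u <= f s.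
Proof.
move=> cf t0; have [s + H] := EVT_max t0 (cont0_within (t := t) cf).
by rewrite in_itv /= => st; exists s => // u ut; apply: H; rewrite in_itv.
Qed.

End HalfLineContinuity.

(** * Recovering the free process from dyadic times *)

Section RiemannSums.
Context {R : realType} {m : nat}.
Variables (mu sigma : 'I_m -> R).

(** Euler sum of the free process on the mesh [2 ^- N], with the phase frozen at the left end of
    each cell. *)
Definition riemann (k : R -> 'I_m) (W : R -> R) (N j : nat) : R :=
  \sum_(l < j) (mu (k (dyad N l)) * (2 ^+ N)^-1 +
                sigma (k (dyad N l)) * (W (dyad N l.+1) - W (dyad N l))).

Variables (k : R -> 'I_m) (W X : R -> R).
Hypothesis step_k : step_path k.
Hypothesis cW : cont0 W.
Hypothesis cX : cont0 X.
Hypothesis incX : forall s t, 0 <= s <= t -> (forall u, s <= u < t -> k u = k s) ->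
  X t - X s = mu (k s) * (t - s) + sigma (k s) * (W t - W s).

Let err N l : R := mu (k (dyad N l)) * (2 ^+ N)^-1 +
   sigma (k (dyad N l)) * (W (dyad N l.+1) - W (dyad N l)) -
   (X (dyad N l.+1) - X (dyad N l)).

Lemma cont0_dyad f (x : R) : cont0 f -> 0 <= x ->
  f (dyad N (dfloor N x)) @[N --> \oo] --> f x /\
  f (dyad N (dfloor N x).+1) @[N --> \oo] --> f x.
Proof.
move=> cf x0; split; apply/cvgrPdist_lt => e e0;
  have [dl dl0 H] := cf x x0 _ e0; have [N1 HN] := half_pow_lt dl0;
  exists N1 => // N /= /HN pN; rewrite distrC; apply: H; try exact: dyad_ge0;
  have /andP[le lt] := dfloor_itv N x0.
- rewrite distrC ger0_norm ?subr_ge0 //; apply: le_lt_trans pN.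
  by rewrite lerBlDr addrC -dyadS ltW.
- rewrite ger0_norm ?subr_ge0 ?(ltW lt) //; apply: le_lt_trans pN.
  by rewrite dyadS lerBlDr addrC lerD2l.
Qed.

Let err_cvg (x : R) : 0 <= x -> `|err N (dfloor N x)| @[N --> \oo] --> (0 : R).
Proof.
move=> x0.
pose C := \sum_i (`|mu i| + `|sigma i|).
have C0 : 0 <= C by apply: sumr_ge0 => i _; rewrite addr_ge0.
have muC i : `|mu i| <= C.
  rewrite /C (bigD1 i) //= -addrA lerDl addr_ge0 //.
  by apply: sumr_ge0 => j _; rewrite addr_ge0.
have sC i : `|sigma i| <= C.
  rewrite /C (bigD1 i) //= [`|mu i| + _]addrC -addrA lerDl addr_ge0 //.
  by apply: sumr_ge0 => j _; rewrite addr_ge0.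
have [W1 W2] := cont0_dyad cW x0; have [X1 X2] := cont0_dyad cX x0.
pose u N := C * (2 ^+ N)^-1 + C * `|W (dyad N (dfloor N x).+1) - W (dyad N (dfloor N x))|
   + `|X (dyad N (dfloor N x).+1) - X (dyad N (dfloor N x))|.
have u0 : u N @[N --> \oo] --> (C * 0 + C * `|W x - W x| + `|X x - X x|).
  apply: cvgD; last by apply: cvg_norm; exact: cvgB.
  apply: cvgD; first by apply: cvgM; [exact: cvg_cst|exact: cvg_half_pow].
  by apply: cvgM; [exact: cvg_cst|apply: cvg_norm; exact: cvgB].
rewrite !subrr normr0 !mulr0 !addr0 in u0.
apply: (@squeeze_cvgr _ _ _ _ (fun=> 0) u) => //; last exact: cvg_cst.
apply: nearW => N; rewrite normr_ge0 /= /err /u.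
apply: (le_trans (ler_normB _ _)); rewrite lerD2r.
apply: (le_trans (ler_normD _ _)); rewrite !normrM.
apply: lerD; last by rewrite ler_wpM2r.
by rewrite (ger0_norm (x := (2 ^+ N)^-1)) ?invr_ge0 ?exprn_ge0 // ler_wpM2r // invr_ge0 exprn_ge0.
Qed.

(** The Euler step is exact on a cell where the phase is constant. The other cells contain a
    breakpoint, so their number is bounded independently of the mesh, and each error tends to 0 by
    continuity of [W] and [X]. *)
Lemma riemann_cvg N0 j0 :
  riemann k W (N0 + M) (j0 * 2 ^ M) @[M --> \oo] --> X (dyad N0 j0) - X 0.
Proof.
have [br br0 H] := step_breaks step_k (dyad_ge0 N0 j0).
pose F N := \sum_(x <- br) `|err N (dfloor N x)|.
have F0 : F N @[N --> \oo] --> (0 : R).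
  rewrite /F; elim: br br0 {H F} => [|x br IH] br0.
    by under eq_fun do rewrite big_nil; exact: cvg_cst.
  under eq_fun do rewrite big_cons.
  suff : (`|err N (dfloor N x)| + \sum_(y <- br) `|err N (dfloor N y)|)
      @[N --> \oo] --> (0 + 0 : R) by rewrite addr0.
  apply: cvgD; first by apply: err_cvg; apply: br0; rewrite mem_head.
  by apply: IH => y yb; apply: br0; rewrite inE yb orbT.
have bound M : `|riemann k W (N0 + M) (j0 * 2 ^ M) - (X (dyad N0 j0) - X 0)| <= F (N0 + M)%N.
  set N := (N0 + M)%N; set j := (j0 * 2 ^ M)%N.
  have tE : dyad N j = dyad N0 j0 :> R by exact: dyad_refine.
  have -> : riemann k W N j - (X (dyad N0 j0) - X 0) = \sum_(l < j) err N l.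
    rewrite /err sumrB; congr (_ - _); rewrite -tE.
    rewrite -(big_mkord xpredT (fun l => X (dyad N l.+1) - X (dyad N l))).
    by rewrite (telescope_sumr (fun l => X (dyad N l))) // dyad0.
  apply: (le_trans (ler_norm_sum _ _ _)).
  (* Each inexact cell is charged to a breakpoint that it contains. *)
  apply: (@le_trans _ _ (\sum_(l < j) \sum_(x <- br) ((dfloor N x == l :> nat)%:R * `|err N l|))).
    apply: ler_sum => l _.
    have [/hasP[x xb xl]|/hasPn nobr] := boolP (has (fun x => dfloor N x == l :> nat) br).
      rewrite (big_rem x) //= xl mul1r lerDl.
      by apply: sumr_ge0 => y _; exact: mulr_ge0.
    suff -> : err N l = 0.
      by rewrite normr0; apply: sumr_ge0 => y _; exact: mulr_ge0.
    have lj : dyad N l.+1 <= dyad N0 j0 :> R by rewrite -tE ler_dyad.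
    have lt : dyad N l < dyad N l.+1 :> R by rewrite ltr_dyad.
    have := H _ _ (dyad_ge0 N l) lt lj.
    have nb x : x \in br -> ~~ (dyad N l < x < dyad N l.+1).
      move=> xb; apply/negP => /andP[lx xl].
      have /andP[fx xf] := dfloor_itv N (br0 x xb).
      move: (nobr x xb) => /negP; apply; rewrite eqn_leq; apply/andP.
      split; rewrite -ltnS -(ltr_dyad (R := R) N); first exact: le_lt_trans xl.
      exact: lt_trans xf.
    move=> /(_ nb) kc; rewrite /err incX ?dyad_ge0 ?ltW // dyadS [_ + _^-1]addrC addrK.
    by rewrite subrr.
  rewrite exchange_big /=; apply: ler_sum => x _.
  have [xj|xj] := ltnP (dfloor N x) j.
    rewrite (bigD1 (Ordinal xj)) //= eqxx mul1r big1 ?addr0 // => l lx.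
    suff /negbTE -> : dfloor N x != l by rewrite mul0r.
    by apply: contra lx => /eqP e; apply/eqP/val_inj; rewrite /= e.
  rewrite big1 // => l _; suff /negbTE -> : dfloor N x != l by rewrite mul0r.
  by apply/eqP => e; move: xj; rewrite e leqNgt ltn_ord.
apply/cvgrPdist_lt => e e0; move/cvgrPdist_lt : F0 => /(_ _ e0) [N1 _ HN].
exists N1 => // M /= NM; rewrite distrC; apply: (le_lt_trans (bound M)).
have := HN (N0 + M)%N (leq_trans NM (leq_addl _ _)).
by rewrite /= sub0r normrN; apply: le_lt_trans; exact: ler_norm.
Qed.

End RiemannSums.

(** * Regulation at 0 as a drawup *)

Section Regulation.
Context {R : realType} {m : nat}.

(** The last clause says that, up to the first visit to [b], [Z] is [X] minus its running minimum,
    expressed by a bound that is attained. *)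
Definition drawup_path (b : R) (X Z : R -> R) : Prop :=
  [/\ cont0 X, cont0 Z, Z 0 = 0, (forall t, 0 <= t -> 0 <= Z t <= b) &
    forall t, 0 <= t -> (forall s, 0 <= s < t -> Z s != b) ->
      (forall u, 0 <= u <= t -> X t - X u <= Z t) /\
      (exists2 u, 0 <= u <= t & X t - X u = Z t)].

(* Before the first visit to [b] only the reflection at 0 acts, so [Z] is the drawup
   of [X]; the extremal [u] is the last zero of [Z]. *)
Lemma regulated_drawup (mu sigma : 'I_m -> R) (b : R) k W Z : 0 < b ->
  regulated_path mu sigma b 0 k W Z ->
  exists X, [/\ drawup_path b X Z & forall s t, 0 <= s <= t ->
    (forall u, s <= u < t -> k u = k s) ->
    X t - X s = mu (k s) * (t - s) + sigma (k s) * (W t - W s)].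
Proof.
move=> b0 [X [R0 [Rb [X0 [cX [incX [R00 [Rb0 [cR0 [cRb [mono [ZE [R0c Rbc]]]]]]]]]]]]].
exists X; split=> //.
have {}cX := within_cont0 cX; have {}cR0 := within_cont0 cR0.
have {}cRb := within_cont0 cRb.
have Z0 : Z 0 = 0 by have [-> _] := ZE 0 (lexx 0); rewrite X0 R00 Rb0 addr0 subr0.
have cZ : cont0 Z.
  have cS := cont0D (cont0D cX cR0) (cont0N cRb).
  move=> s s0 e e0; have [dl dl0 H] := cS s s0 _ e0; exists dl => // u u0 us.
  by have [-> _] := ZE u u0; have [-> _] := ZE s s0; exact: H.
split=> // [t t0|t t0 Zb]; first by have [] := ZE t t0.
have Rbs s : 0 <= s < t -> Rb s = 0.
  move=> /andP[s0 st]; rewrite -Rb0; apply: Rbc; first by rewrite lexx.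
  by move=> u /andP[u0 us]; apply: Zb; rewrite u0 (le_lt_trans us).
have Rbt s : 0 <= s <= t -> Rb s = 0.
  move=> /andP[s0]; rewrite le_eqVlt => /predU1P[->|st]; last by apply: Rbs; rewrite s0.
  have [->//|tn] := eqVneq t 0.
  by apply: (cont0_left cRb _ Rbs); rewrite lt_def tn.
have ZX s : 0 <= s <= t -> Z s = X s + R0 s.
  move=> st; have /andP[s0 _] := st; have [-> _] := ZE s s0.
  by rewrite Rbt // subr0.
have tt : 0 <= t <= t by rewrite t0 lexx.
split=> [u ut|].
  have /andP[u0 ut'] := ut; have [R0m _] := mono u t ut.
  have [_ /andP[Zu _]] := ZE u u0.
  by move: Zu; rewrite (ZX u ut) (ZX t tt); lra.
have [v [/andP[v0 vt] Zv Hv]] := last_hit cZ t0 Z0.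
exists v; first by rewrite v0.
have R0v : R0 v = R0 t.
  move: vt; rewrite le_eqVlt => /predU1P[->//|vt].
  apply: (@cont0_right _ R0 v t) => //; first by rewrite v0.
  move=> u /andP[vu ut]; apply/esym; apply: R0c; first by rewrite ut ltW // (le_lt_trans v0).
  by move=> x /andP[ux xt]; apply: Hv; rewrite xt (lt_le_trans vu).
have vt' : 0 <= v <= t by rewrite v0 vt.
by move: Zv; rewrite (ZX v vt') (ZX t tt) R0v; lra.
Qed.

(** The two regulators exchange their roles. The driving path [W] is kept, so [sigma] changes sign
    along with [mu]: the reflected segment is a functional of the same coordinates. *)
Lemma regulated_flip (mu sigma : 'I_m -> R) (b : R) k W Z :
  regulated_path mu sigma b b k W Z ->
  regulated_path (fun i => - mu i) (fun i => - sigma i) b 0 k W (fun t => b - Z t).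
Proof.
have flip (f : R -> R) (c : R) : {within [set t | 0 <= t], continuous f} ->
    {within [set t | 0 <= t], continuous (fun t => c - f t)}.
  move=> cf x; apply: cvgB; [exact: cvg_cst|exact: cf].
move=> [X [R0 [Rb [X0 [cX [incX [R00 [Rb0 [cR0 [cRb [mono [ZE [R0c Rbc]]]]]]]]]]]]].
exists (fun t => b - X t), Rb, R0; do 11 ?split=> //.
- by rewrite X0 subrr.
- exact: flip.
- move=> s t st kc; have := incX s t st kc; lra.
- by have [] := mono s t H.
- by have [] := mono s t H.
- by have [-> _] := ZE t H; ring.
- by have [_] := ZE t H; lra.
- move=> s t st Zb; apply: Rbc => // u us; have := Zb u us.
  by rewrite subr_eq0 eq_sym.
- move=> s t st Zb; apply: R0c => // u us; have := Zb u us.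
  by apply: contra => /eqP ->; rewrite subr0.
Qed.

End Regulation.

(** * Level crossings and the hitting time *)

Section Crossing.
Context {R : realType}.
Variables (b : R) (X Z : R -> R).
Hypothesis b0 : 0 < b.
Hypothesis XZ : drawup_path b X Z.

(** The drawup of [X] has reached [c] by time [t]. Naming the two times instead of a running minimum
    lets dyadic times approximate them. *)
Definition crossR (X : R -> R) (c t : R) : Prop :=
  exists u s, [/\ 0 <= u, u <= s, s <= t & c <= X s - X u].

Lemma crossR_le c t t' : t <= t' -> crossR X c t -> crossR X c t'.
Proof. by move=> tt [u [s [u0 us st h]]]; exists u, s; split=> //; exact: le_trans tt. Qed.

Lemma gap_cross c t : 0 < c -> 0 <= t -> (forall s, 0 <= s < t -> Z s != b) ->
  crossR X c t <-> exists2 s, 0 <= s <= t & c <= Z s.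
Proof.
have [_ _ _ _ H] := XZ => c0 t0 Zb.
have Zs s : s <= t -> forall x, 0 <= x < s -> Z x != b.
  by move=> st x /andP[x0 xs]; apply: Zb; rewrite x0 (lt_le_trans xs).
split=> [[u [s [u0 us st h]]]|[s /andP[s0 st] cs]].
  have s0 := le_trans u0 us; exists s; first by rewrite s0.
  have [H1 _] := H s s0 (Zs s st); apply: (le_trans h); apply: H1.
  by rewrite u0.
have [_ [u /andP[u0 us] E]] := H s s0 (Zs s st).
by exists u, s; split=> //; rewrite E.
Qed.

Lemma hit_first t : 0 <= t -> Z t = b -> exists dl, [/\ 0 < dl, dl <= t, Z dl = b,
  (forall s, 0 <= s < dl -> Z s != b) & hit Z b = dl%:E].
Proof.
have [_ cZ Z0 _ _] := XZ => t0 Zt.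
have [dl [/andP[dl0 dlt] Zdl H]] := first_hit cZ t0 Zt.
have dlp : 0 < dl.
  by rewrite lt_def dl0 andbT; apply: contraTneq b0 => dE; rewrite -Zdl dE Z0 ltxx.
exists dl; split=> //; apply/eqP; rewrite eq_le; apply/andP; split.
  by apply: ereal_inf_lbound; exists dl.
apply: le_ereal_inf_tmp => _ [s [s0 Zs] <-]; rewrite lee_fin leNgt; apply/negP => sd.
by have := H s; rewrite sd (ltW s0) Zs eqxx => /(_ isT).
Qed.

Lemma lt_hit t : (t%:E < hit Z b)%E -> forall s, 0 <= s <= t -> Z s != b.
Proof.
move=> th s /andP[s0 st]; apply/eqP => Zs.
have [dl [dl0 dls _ _ hE]] := hit_first s0 Zs.
by move: th; rewrite hE lte_fin ltNge (le_trans dls).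
Qed.

Lemma hit_ge0 : (0%:E <= hit Z b)%E.
Proof. by apply: le_ereal_inf_tmp => _ [s [s0 _] <-]; rewrite lee_fin ltW. Qed.

Lemma hit_fin dl : hit Z b = dl%:E -> [/\ 0 < dl, Z dl = b &
  forall s, 0 <= s < dl -> Z s != b].
Proof.
move=> hE; have : (hit Z b < +oo)%E by rewrite hE ltry.
case/ereal_inf_lt => _ [t [t0 Zt] <-] _.
have [dl' [dl0 _ Zdl Hs hE']] := hit_first (ltW t0) Zt.
by move: hE; rewrite hE' => -[<-].
Qed.

(** After the first visit to [b] the process [Z] is no longer the drawup of [X], but both events are
    then already realised; before it, [gap_cross] applies. *)
Lemma hit_cross t : 0 <= t -> crossR X b t <-> exists2 s, 0 < s <= t & Z s = b.
Proof.
have [_ cZ Z0 Zb _] := XZ => t0; split=> [cr|[s /andP[s0 st] Zs]].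
  have [//|no] := pselect (exists2 s, 0 < s <= t & Z s = b); exfalso.
  have Znb s : 0 <= s <= t -> Z s != b.
    move=> /andP[]; rewrite le_eqVlt => /predU1P[<- _|s0 st].
      by rewrite Z0 eq_sym gt_eqF.
    by apply/eqP => Zs; apply: no; exists s => //; rewrite s0.
  have Znb' s : 0 <= s < t -> Z s != b by move=> /andP[s0 /ltW st]; apply: Znb; rewrite s0.
  have /(gap_cross b0 t0 Znb')[s st bs] := cr.
  have /andP[s0 _] := st; have /andP[_ Zle] := Zb s s0.
  by have := Znb s st; rewrite eq_le Zle bs.
have [dl [dl0 dls Zdl Hs _]] := hit_first (ltW s0) Zs.
apply: (crossR_le (le_trans dls st)); apply/(gap_cross b0 (ltW dl0) Hs).
by exists dl; rewrite ?Zdl // lexx ltW.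
Qed.

(* The crossing times of the levels [b - b / p.+2] announce the hitting time of [b]. *)
Lemma announce dl eta : 0 < dl -> Z dl = b -> (forall s, 0 <= s < dl -> Z s != b) ->
  0 < eta -> exists p0, forall p, (p0 <= p)%N -> exists N1, forall N, (N1 <= N)%N ->
    exists j, [/\ crossR X (b - b / p.+2%:R) (dyad N j),
      (forall j', (j' < j)%N -> ~ crossR X (b - b / p.+2%:R) (dyad N j')),
      dyad N j < dl & dl < dyad N j + eta].
Proof.
have [_ cZ Z0 Zb _] := XZ => dl0 Zdl Znb eta0.
pose c p := b - b / p.+2%:R.
have c0 p : 0 < c p.
  have p1 : (1 : R) < p.+2%:R by rewrite ltr1n.
  by rewrite /c subr_gt0 ltr_pdivrMr ?(lt_trans ltr01) // ltr_pMr.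
have cb p : c p < b by rewrite /c ltrBlDr ltrDl divr_gt0 // ltr0n.
have Znb' t : t < dl -> forall s, 0 <= s < t -> Z s != b.
  by move=> tdl s /andP[s0 st]; apply: Znb; rewrite s0 (lt_trans st).
have [p0 Hp0] : exists p0, forall p, (p0 <= p)%N ->
    forall s, 0 <= s <= dl - eta / 2 -> Z s < c p.
  have [neg|pos] := ltP (dl - eta / 2) 0.
    by exists 0%N => p _ s /andP[s0 /(le_trans s0)]; rewrite leNgt neg.
  have [s sI smax] := cont0_max cZ pos.
  have /andP[s0 sd] := sI.
  have sdl : s < dl by apply: le_lt_trans sd _; rewrite ltrBlDr ltrDl divr_gt0.
  have Zsb : Z s < b.
    have /andP[_ Zs] := Zb s s0; rewrite lt_def Zs andbT eq_sym.
    by apply: Znb; rewrite s0.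
  have cc : c p @[p --> \oo] --> b.
    rewrite -[X in _ --> X](subr0 b); apply: cvgB; first exact: cvg_cst.
    rewrite -[X in _ --> X](mulr0 b); apply: cvgM; first exact: cvg_cst.
    have := @cvg_harmonic R; rewrite -(cvg_shiftS (@harmonic R)).
    exact.
  have e0 : 0 < b - Z s by rewrite subr_gt0.
  move/cvgrPdist_lt : cc => /(_ _ e0) [p0 _ H]; exists p0 => p /H /= hp u uI.
  apply: (le_lt_trans (smax u uI)); move: hp.
  by rewrite gtr0_norm ?subr_gt0 // ltrD2l ltrN2.
exists p0 => p /Hp0 Hp.
have [s [s0 sdl cs]] : exists s, [/\ 0 <= s, s < dl & c p <= Z s].
  have e0 : 0 < b - c p by rewrite subr_gt0.
  have [d1 d10 Hd] := cZ dl (ltW dl0) _ e0.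
  pose s := dl - Num.min dl d1 / 2.
  have m0 : 0 < Num.min dl d1 by rewrite lt_min dl0.
  have m1 : Num.min dl d1 <= dl by rewrite ge_min lexx.
  have m2 : Num.min dl d1 <= d1 by rewrite ge_min lexx orbT.
  have s0 : 0 <= s by rewrite /s; lra.
  have sd : s < dl by rewrite /s; lra.
  exists s; split=> //; have := Hd s s0; rewrite Zdl.
  have -> : `|s - dl| < d1 by rewrite ltr0_norm ?subr_lt0 // /s; lra.
  by move=> /(_ isT); rewrite ltr_distlC => /andP[]; rewrite /s; lra.
have gap0 : 0 < dl - s by rewrite subr_gt0.
have [N1 HN1] := half_pow_lt gap0.
exists N1 => N /HN1 hN.
have /andP[fs sf] := dfloor_itv N s0.
have jd : dyad N (dfloor N s).+1 < dl.
  by rewrite dyadS (le_lt_trans (y := s + (2 ^+ N)^-1)) ?lerD2r // -ltrBrDl.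
have ex : exists j, `[< crossR X (c p) (dyad N j) >].
  exists (dfloor N s).+1; apply/asboolP.
  apply/(gap_cross (c0 p) (dyad_ge0 _ _) (Znb' _ jd)); exists s => //.
  by rewrite s0 ltW.
case: (ex_minnP ex) => j /asboolP jc jmin.
have jdl : dyad N j < dl.
  apply: (le_lt_trans _ jd); rewrite ler_dyad; apply: jmin; apply/asboolP.
  apply/(gap_cross (c0 p) (dyad_ge0 _ _) (Znb' _ jd)); exists s => //.
  by rewrite s0 ltW.
exists j; split=> //.
  by move=> j' jj /asboolP /jmin; rewrite leqNgt jj.
have /(gap_cross (c0 p) (dyad_ge0 _ _) (Znb' _ jdl))[x /andP[x0 xj] cx] := jc.
have : dl - eta / 2 < x.
  by rewrite ltNge; apply/negP => xd; have := Hp x; rewrite x0 xd ltNge cx => /(_ isT).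
by move: xj eta0; lra.
Qed.

End Crossing.

(** * Reading phases at dyadic times *)

Section QuietPaths.
Context {R : realType} {m : nat}.
Variable k : R -> 'I_m.
Hypothesis step_k : step_path k.

(** Any [u] in the interval is approached from the right by subdivision points, and a step path is
    constant just to the right of [u]. *)
Lemma quiet_const t0 eta : 0 <= t0 -> 0 < eta ->
  (forall M l, (l < 2 ^ M)%N -> k (t0 + eta / (2 ^ M)%:R * l.+1%:R) = k t0) ->
  forall u, t0 <= u < t0 + eta -> k u = k t0.
Proof.
move=> t00 eta0 H u /andP[tu ut].
have [e e0 He] := step_right step_k (le_trans t00 tu).
pose x := (u - t0) / eta.
have x0 : 0 <= x by rewrite divr_ge0 ?subr_ge0 // ltW.
have x1 : x < 1 by rewrite ltr_pdivrMr // mul1r ltrBlDl.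
have d0 : 0 < e / eta by rewrite divr_gt0.
have [M HM] := half_pow_lt d0; have {}HM := HM M (leqnn M).
have /andP[fl fu] := dfloor_itv M x0; set l := dfloor M x in fl fu.
have lM : (l < 2 ^ M)%N.
  rewrite -(ltr_dyad (R := R) M); apply: (le_lt_trans fl).
  by rewrite /dyad natrX divff // gt_eqF // exprn_gt0.
rewrite -(H M l lM).
have -> : t0 + eta / (2 ^ M)%:R * l.+1%:R = t0 + eta * dyad M l.+1.
  by rewrite /dyad natrX; ring.
have uE : u = t0 + eta * x by rewrite /x mulrC divfK ?gt_eqF // addrC subrK.
apply/esym; apply: He; rewrite {1}uE lerD2l ler_pM2l // ltW //=.
rewrite {1}uE -addrA ltrD2l dyadS mulrDr.
apply: ler_ltD; first by rewrite ler_pM2l.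
by rewrite mulrC -ltr_pdivlMr.
Qed.

Lemma quiet_left_lim t0 eta dl : 0 <= t0 -> t0 < dl < t0 + eta ->
  (forall u, t0 <= u < t0 + eta -> k u = k t0) ->
  left_lim k dl (k dl).
Proof.
move=> t00 /andP[td de] H; exists (dl - t0); first by rewrite subr_gt0.
move=> u; rewrite opprB addrC subrK => /andP[tu ud].
by rewrite !H // ?(ltW td) ?(ltW tu) // (lt_trans ud).
Qed.

(** The phase at [t] read at dyadic times just after [t], which makes it jointly measurable in the
    path and the time. *)
Definition phaseF (k : R -> 'I_m) (t : R) (j : 'I_m) : Prop :=
  exists N0, forall N, (N0 <= N)%N -> k (dyad N (dfloor N t).+1) = j.

Lemma phaseFP t j : 0 <= t -> phaseF k t j <-> k t = j.
Proof.
move=> t0; have [e e0 He] := step_right step_k t0.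
have [N1 HN] := half_pow_lt e0.
have kE N : (N1 <= N)%N -> k (dyad N (dfloor N t).+1) = k t.
  move=> /HN hN; have /andP[fl fu] := dfloor_itv N t0; apply: He.
  by rewrite (ltW fu) /= dyadS; apply: ler_ltD.
split=> [[N0 H]|<-]; last by exists N1.
by rewrite -(kE (maxn N0 N1)) ?leq_maxr // H // leq_maxl.
Qed.

(** The left limit at [tau] read at the last dyadic time strictly before [tau]. *)
Definition lastF (k : R -> 'I_m) (tau : \bar R) (j : 'I_m) : Prop :=
  exists N0, forall N, (N0 <= N)%N -> exists l,
    [/\ ((dyad N l)%:E < tau)%E, (tau <= (dyad N l.+1)%:E)%E & k (dyad N l) = j].

Lemma lastFP dl j : 0 < dl -> lastF k dl%:E j <-> left_lim k dl j.
Proof.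
move=> dl0; have [i li] := step_left step_k dl0.
have grid_at N : exists l, dyad N l < dl <= dyad N l.+1.
  have ex : exists l, dl <= dyad N l.
    by exists (dfloor N dl).+1; have /andP[_ /ltW] := dfloor_itv N (ltW dl0).
  case: (ex_minnP ex) => -[|l] hl lmin; first by rewrite dyad0 leNgt dl0 in hl.
  by exists l; rewrite hl andbT ltNge; apply/negP => /lmin; rewrite ltnn.
have [e e0 He] := li; have [N1 HN] := half_pow_lt e0.
have kE N l : (N1 <= N)%N -> dyad N l < dl -> dl <= dyad N l.+1 -> k (dyad N l) = i.
  move=> /HN hN ld dl1; apply: He; rewrite ld andbT.
  by move: dl1; rewrite dyadS; lra.
have iP : lastF k dl%:E i.
  exists N1 => N NN; have [l /andP[l1 l2]] := grid_at N.
  by exists l; rewrite lte_fin lee_fin; split=> //; exact: kE.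
split=> [[N0 H]|lj]; last by rewrite (left_lim_unique lj li).
have [l []] := H (maxn N0 N1) (leq_maxl _ _).
by rewrite lte_fin lee_fin => l1 l2 <-; rewrite (kE (maxn N0 N1)) // leq_maxr.
Qed.

End QuietPaths.

(** * Path functionals *)

Section PathFunctionals.
Context {R : realType} {m : nat}.
Variables (mu sigma : 'I_m -> R).
Implicit Types (k : R -> 'I_m) (W : R -> R).

(* [X - X 0] at a dyadic time, as a functional of the coordinates at dyadic times only;
   the limsup is a limit on the paths of interest. *)
Definition Xd k W N j : R :=
  fine (limn_esup (fun M => (riemann mu sigma k W (N + M) (j * 2 ^ M))%:E)).

(** The pair of times that realises the rise need not be dyadic; the slack [p.+1%:R^-1], required
    for every [p], absorbs the approximation. *)
Definition crossD k W (c : R) N j : Prop :=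
  forall p, exists M l l', [/\ (l <= l')%N, (l' <= j * 2 ^ M)%N &
    c - p.+1%:R^-1 < Xd k W (N + M) l' - Xd k W (N + M) l].

Definition tauF k W (c : R) : \bar R :=
  ereal_inf [set (dyad x.1 x.2)%:E | x in [set x | crossD k W c x.1 x.2]].

Definition gapD k W N j : \bar R :=
  ereal_sup [set (Xd k W N j - Xd k W (N + x.1)%N x.2)%:E |
    x in [set x : nat * nat | (x.2 <= j * 2 ^ x.1)%N]].

Definition gapF k W (t : R) : \bar R :=
  limn_esup (fun N => gapD k W N (dfloor N t).+1).

Lemma lastF_unique k t j j' : lastF k t j -> lastF k t j' -> j = j'.
Proof.
move=> [N1 H1] [N2 H2].
have [l [a1 a2 <-]] := H1 (maxn N1 N2) (leq_maxl _ _).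
have [l' [b1 b2 <-]] := H2 (maxn N1 N2) (leq_maxr _ _).
suff -> : l = l' by [].
have := lt_le_trans a1 b2; have := lt_le_trans b1 a2.
by rewrite !lte_fin !ltr_dyad !ltnS => l1 l2; apply/eqP; rewrite eqn_leq l1 l2.
Qed.

(* [i] is a junk value, taken when [c] is never reached. *)
Definition lastP (c : R) (i : 'I_m) k W : 'I_m :=
  xget i [set j | lastF k (tauF k W c) j].

Lemma lastPE c i k W j : lastF k (tauF k W c) j -> lastP c i k W = j.
Proof.
move=> Lj; rewrite /lastP; case: xgetP => [l _ /= Ll|no]; last by case: (no j Lj).
exact: lastF_unique Ll Lj.
Qed.

Variables (k : R -> 'I_m) (W X Z : R -> R) (b : R).
Hypothesis b0 : 0 < b.
Hypothesis step_k : step_path k.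
Hypothesis cW : cont0 W.
Hypothesis XZ : drawup_path b X Z.
Hypothesis incX : forall s t, 0 <= s <= t -> (forall u, s <= u < t -> k u = k s) ->
  X t - X s = mu (k s) * (t - s) + sigma (k s) * (W t - W s).

Let cX : cont0 X. Proof. by case: XZ. Qed.

Lemma XdE N j : Xd k W N j = X (dyad N j) - X 0.
Proof.
rewrite /Xd; have cv : riemann mu sigma k W (N + M) (j * 2 ^ M) @[M --> \oo] -->
    X (dyad N j) - X 0 by exact: riemann_cvg.
have cvE : (riemann mu sigma k W (N + M) (j * 2 ^ M))%:E @[M --> \oo] -->
    (X (dyad N j) - X 0)%:E by apply: cvg_EFin => //; exact: nearW.
by have [_ ->] := cvg_limn_einf_sup cvE.
Qed.

(** If [b] has been visited by that time, a rise by [b] covers [c <= b]. Otherwise [Z] is the drawup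
    and attains its maximum; were this below [c], a slack smaller than the deficit would be
    violated. Conversely, continuity of [X] moves both times down to dyadic ones within the
    slack. *)
Lemma crossDP c N j : 0 < c <= b -> crossD k W c N j <-> crossR X c (dyad N j).
Proof.
move=> /andP[c0 cb]; have t0 := dyad_ge0 (R := R) N j; set t := dyad N j.
have [_ cZ _ _ _] := XZ.
split=> [H|[u [s [u0 us st cus]]] p].
  have [[s s0t Zs]|no] := pselect (exists2 s, 0 < s <= t & Z s = b).
    have : crossR X b t by apply/(hit_cross b0 XZ t0); exists s.
    by move=> [x [y [x0 xy yt h]]]; exists x, y; split=> //; exact: le_trans cb h.
  have Znb s : 0 <= s < t -> Z s != b.
    move=> /andP[]; rewrite le_eqVlt => /predU1P[<- _|s0 st].
      by case: XZ => _ _ -> _ _; rewrite eq_sym gt_eqF.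
    by apply/eqP => Zs; apply: no; exists s => //; rewrite s0 ltW.
  have [s /andP[s0 st] smax] := cont0_max cZ t0.
  apply/(gap_cross XZ c0 t0 Znb); exists s; first by rewrite s0.
  rewrite leNgt; apply/negP => Zc.
  have [p] : exists p, p.+1%:R^-1 < c - Z s.
    have e0 : 0 < c - Z s by rewrite subr_gt0.
    have /cvgrPdist_lt /(_ _ e0) [p _ Hp] := @cvg_harmonic R.
    exists p; have := Hp p (leqnn p); rewrite /= sub0r normrN ger0_norm //.
  have [M [l [l' [ll lj]]]] := H p; rewrite !XdE => h ph.
  have tE : dyad (N + M) (j * 2 ^ M) = t by exact: dyad_refine.
  set x := dyad (N + M) l in h; set y := dyad (N + M) l' in h.
  have y0 : 0 <= y by exact: dyad_ge0.
  have yt : y <= t by rewrite -tE ler_dyad.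
  have xy : 0 <= x <= y by rewrite dyad_ge0 ler_dyad.
  have [_ _ _ _ G] := XZ.
  have [G1 _] := G y y0 (fun s sy => Znb s (ltac:(by case/andP: sy => -> /= sy; exact: lt_le_trans sy yt))).
  have := G1 x xy; have := smax y; rewrite y0 yt => /(_ isT).
  by move: h ph; move: (p.+1%:R^-1) => e; lra.
have e0 : 0 < p.+1%:R^-1 / 2 :> R by rewrite divr_gt0.
have s0 := le_trans u0 us.
have [d1 d10 H1] := cX u0 e0; have [d2 d20 H2] := cX s0 e0.
have d0 : 0 < Num.min d1 d2 by rewrite lt_min d10.
have [M HM] := half_pow_lt d0.
have {}HM : (2 ^+ (N + M))^-1 < Num.min d1 d2 by apply: HM; exact: leq_addl.
have /andP[fu uf] := dfloor_itv (N + M) u0; have /andP[fs sf] := dfloor_itv (N + M) s0.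
exists M, (dfloor (N + M) u), (dfloor (N + M) s); rewrite !XdE; split.
- rewrite -ltnS -(ltr_dyad (R := R) (N + M)); apply: le_lt_trans sf.
  exact: le_trans us.
- rewrite -(ler_dyad (R := R) (N + M)) dyad_refine; exact: le_trans st.
- move: HM; rewrite lt_min => /andP[M1 M2].
  have := H1 _ (dyad_ge0 (N + M) (dfloor (N + M) u)).
  have -> : `|dyad (N + M) (dfloor (N + M) u) - u| < d1.
    rewrite distrC ger0_norm ?subr_ge0 //; move: uf; rewrite dyadS; lra.
  move=> /(_ isT); rewrite ltr_distl => /andP[_ h1].
  have := H2 _ (dyad_ge0 (N + M) (dfloor (N + M) s)).
  have -> : `|dyad (N + M) (dfloor (N + M) s) - s| < d2.
    rewrite distrC ger0_norm ?subr_ge0 //; move: sf; rewrite dyadS; lra.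
  move=> /(_ isT); rewrite ltr_distl => /andP[h2 _].
  by move: cus h1 h2; move: (p.+1%:R^-1) => e; lra.
Qed.

Lemma tauFE : tauF k W b = hit Z b.
Proof.
have bb : 0 < b <= b by rewrite b0 lexx.
apply/eqP; rewrite eq_le; apply/andP; split.
  apply: le_ereal_inf_tmp => _ [t [t0 Zt] <-].
  apply/lee_addgt0Pr => e e0; have [N HN] := half_pow_lt e0; have {}HN := HN N (leqnn N).
  have /andP[ft tf] := dfloor_itv N (ltW t0).
  apply: (@le_trans _ _ (dyad N (dfloor N t).+1)%:E).
    apply: ereal_inf_lbound; exists (N, (dfloor N t).+1) => //=.
    apply/(crossDP _ _ bb)/(hit_cross b0 XZ (dyad_ge0 _ _)); exists t => //.
    by rewrite t0 ltW.
  by rewrite -EFinD lee_fin dyadS; apply: lerD => //; exact: ltW.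
apply: le_ereal_inf_tmp => _ [[N j] /= /(crossDP _ _ bb) cr <-].
have /(hit_cross b0 XZ (dyad_ge0 _ _))[s /andP[s0 sj] Zs] := cr.
apply: (@le_trans _ _ s%:E); last by rewrite lee_fin.
by apply: ereal_inf_lbound; exists s.
Qed.

Lemma gapDE N j : (forall s, 0 <= s < dyad N j -> Z s != b) ->
  gapD k W N j = (Z (dyad N j))%:E.
Proof.
move=> Znb; have [_ _ _ _ G] := XZ.
have t0 := dyad_ge0 (R := R) N j.
have [G1 [u /andP[u0 ut] G2]] := G _ t0 Znb.
apply/eqP; rewrite eq_le; apply/andP; split.
  apply: ge_ereal_sup => _ [[M l] /= lj <-]; rewrite lee_fin !XdE.
  have := G1 (dyad (N + M) l); rewrite dyad_ge0 -(dyad_refine N M j) ler_dyad lj.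
  by move=> /(_ isT); lra.
apply/lee_addgt0Pr => e e0; have [d1 d10 H1] := cX u0 e0.
have [M HM] := half_pow_lt d10.
have {}HM : (2 ^+ (N + M))^-1 < d1 by apply: HM; exact: leq_addl.
have /andP[fu uf] := dfloor_itv (N + M) u0.
have := H1 _ (dyad_ge0 (N + M) (dfloor (N + M) u)).
have -> : `|dyad (N + M) (dfloor (N + M) u) - u| < d1.
  by rewrite distrC ger0_norm ?subr_ge0 //; move: uf; rewrite dyadS; lra.
move=> /(_ isT); rewrite ltr_distl => /andP[_ h1].
apply: (@le_trans _ _ ((Xd k W N j - Xd k W (N + M) (dfloor (N + M) u))%:E + e%:E)).
  by rewrite -EFinD lee_fin !XdE -G2; lra.
apply: leeD => //; apply: ereal_sup_ubound; exists (M, dfloor (N + M) u) => //=.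
rewrite -(ler_dyad (R := R) (N + M)) dyad_refine; exact: le_trans ut.
Qed.

(** Strict inequality with the hitting time leaves a margin, so the dyadic times just after [t]
    still precede the visit to [b]. *)
Lemma gapFE t : 0 <= t -> (t%:E < hit Z b)%E -> gapF k W t = (Z t)%:E.
Proof.
move=> t0 th; have [_ cZ _ _ _] := XZ.
have [e e0 te] : exists2 e, 0 < e & ((t + e)%:E <= hit Z b)%E.
  move: th; case: (hit Z b) => [h||//]; last by exists 1 => //; rewrite leey.
  by rewrite lte_fin => th; exists (h - t); rewrite ?subr_gt0 // addrC subrK.
have [N1 HN] := half_pow_lt e0.
have gE N : (N1 <= N)%N -> gapD k W N (dfloor N t).+1 = (Z (dyad N (dfloor N t).+1))%:E.
  move=> /HN hN; apply: gapDE => s /andP[s0 sN].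
  have /andP[ft tf] := dfloor_itv N t0.
  apply: (lt_hit b0 XZ (t := dyad N (dfloor N t).+1)); last by rewrite s0 ltW.
  by apply: lt_le_trans te; rewrite lte_fin dyadS; apply: ler_ltD.
have cv : gapD k W N (dfloor N t).+1 @[N --> \oo] --> (Z t)%:E.
  have cZt : (Z (dyad N (dfloor N t).+1))%:E @[N --> \oo] --> (Z t)%:E.
    by apply: cvg_EFin; [exact: nearW|have [_] := cont0_dyad cZ t0].
  by apply: cvg_trans cZt; apply: near_eq_cvg; exists N1 => // N /gE.
by rewrite /gapF; have [_ ->] := cvg_limn_einf_sup cv.
Qed.

End PathFunctionals.

(** * Measurability of the path functionals *)

Section CountableSets.
Context d (T : measurableType d).

Lemma measurable_ex (F : nat -> set T) :
  (forall n, measurable (F n)) -> measurable [set w | exists n, F n w].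
Proof.
move=> mF; have -> : [set w | exists n, F n w] = \bigcup_n F n.
  by apply/seteqP; split=> w [n]; [exists n|exists n].
exact: bigcupT_measurable.
Qed.

Lemma measurable_all (F : nat -> set T) :
  (forall n, measurable (F n)) -> measurable [set w | forall n, F n w].
Proof.
move=> mF; have -> : [set w | forall n, F n w] = \bigcap_n F n.
  by apply/seteqP; split=> w H n; [move=> _; exact: H|exact: (H n I)].
exact: bigcapT_measurable.
Qed.

Lemma measurable_Prop (Q : Prop) (F : set T) :
  measurable F -> measurable [set w | Q /\ F w].
Proof.
move=> mF; have [q|nq] := pselect Q.
  by rewrite (_ : [set w | _] = F) //; apply/seteqP; split=> w // [].
by rewrite (_ : [set w | _] = set0) //; apply/seteqP; split=> w // [].
Qed.

Lemma measurable_imp (Q : Prop) (F : set T) :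
  (Q -> measurable F) -> measurable [set w | Q -> F w].
Proof.
move=> mF; have [q|nq] := pselect Q.
  rewrite (_ : [set w | _] = F); first exact: mF.
  by apply/seteqP; split=> w //= H; exact: H.
by rewrite (_ : [set w | _] = setT) //; apply/seteqP; split=> w // _ /nq.
Qed.

End CountableSets.

Section CountableMeasurability.
Context {R : realType} d (T : measurableType d).

Lemma measurable_of_ltr (f : T -> \bar R) :
  (forall x : R, measurable [set w | (f w < x%:E)%E]) -> measurable_fun setT f.
Proof.
move=> H; apply: (measurability _ (ErealGenInftyO.measurableE R)) => //.
move=> _ [_ [x ->] <-]; rewrite setTI; move: (H x); congr (measurable _).
Qed.

Lemma measurable_of_gtr (f : T -> \bar R) :
  (forall x : R, measurable [set w | (x%:E < f w)%E]) -> measurable_fun setT f.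
Proof.
move=> H; apply: (measurability _ (ErealGenOInfty.measurableE R)) => //.
move=> _ [_ [x ->] <-]; rewrite setTI; move: (H x); congr (measurable _).
by apply/seteqP; split=> w /=; rewrite in_itv /= andbT.
Qed.

Lemma measurable_fin_comp m (g : 'I_m -> R) (f : T -> 'I_m) :
  (forall k, measurable [set w | f w = k]) -> measurable_fun setT (fun w => g (f w)).
Proof.
move=> mf _ A mA; rewrite setTI.
have -> : (fun w => g (f w)) @^-1` A = \bigcup_(k in [set k | A (g k)]) [set w | f w = k].
  by apply/seteqP; split=> [w Aw|w [k Ak /= fk]]; [exists (f w)|rewrite /= fk].
exact: fin_bigcup_measurable.
Qed.

Lemma measurable_gtr (f : T -> \bar R) x : measurable_fun setT f ->
  measurable [set w | (x%:E < f w)%E].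
Proof.
move=> mf; rewrite -[X in measurable X]setTI.
by apply: measurable_lte => //; exact: measurable_cst.
Qed.

Lemma measurable_ltr (f : T -> \bar R) x : measurable_fun setT f ->
  measurable [set w | (f w < x%:E)%E].
Proof.
move=> mf; rewrite -[X in measurable X]setTI.
by apply: measurable_lte => //; exact: measurable_cst.
Qed.

Lemma measurable_ler (f : T -> \bar R) x : measurable_fun setT f ->
  measurable [set w | (f w <= x%:E)%E].
Proof.
move=> mf; rewrite (_ : [set w | _] = ~` [set w | (x%:E < f w)%E]).
  by apply: measurableC; exact: measurable_gtr.
by apply/seteqP; split=> w /=; rewrite leNgt => /negP.
Qed.

Lemma measurable_ger (f : T -> \bar R) x : measurable_fun setT f ->
  measurable [set w | (x%:E <= f w)%E].
Proof.
move=> mf; rewrite (_ : [set w | _] = ~` [set w | (f w < x%:E)%E]).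
  by apply: measurableC; exact: measurable_ltr.
by apply/seteqP; split=> w /=; rewrite leNgt => /negP.
Qed.

End CountableMeasurability.

Section FunctionalMeasurability.
Context {R : realType} {m : nat} d (T : measurableType d).
Variables (mu sigma : 'I_m -> R) (kap : R -> T -> 'I_m) (W : R -> T -> R).
Notation kp w := (kap ^~ w).
Notation Wp w := (W ^~ w).

Section UpTo.
Variable tm : R.
Hypothesis mkap : forall t, dyadic t -> t <= tm -> forall k, measurable [set w | kap t w = k].
Hypothesis mW : forall t, dyadic t -> t <= tm -> measurable_fun setT (W t).

Lemma measurable_riemann N j : dyad N j <= tm ->
  measurable_fun setT (fun w => riemann mu sigma (kp w) (Wp w) N j).
Proof.
move=> jt; apply: measurable_sum => l.
have d1 : dyadic (@dyad R N l) by exists N, l.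
have d2 : dyadic (@dyad R N l.+1) by exists N, l.+1.
have t2 : dyad N l.+1 <= tm by apply: le_trans jt; rewrite ler_dyad.
have t1 : dyad N l <= tm by apply: le_trans t2; rewrite ler_dyad.
apply: measurable_funD; apply: measurable_funM.
- by apply: (measurable_fin_comp mu); exact: mkap.
- exact: measurable_cst.
- by apply: (measurable_fin_comp sigma); exact: mkap.
- by apply: measurable_funB; exact: mW.
Qed.

Lemma measurable_Xd N j : dyad N j <= tm ->
  measurable_fun setT (fun w => Xd mu sigma (kp w) (Wp w) N j).
Proof.
move=> jt; apply: (measurableT_comp (fine_measurable measurableT)).
apply: measurable_fun_limn_esup => M; apply/measurable_EFinP.
by apply: measurable_riemann; rewrite dyad_refine.
Qed.

(** Coordinates are supposed measurable up to [tm] only, so the lemma also applies to the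
    sigma-algebra of the past of a dyadic time. *)
Lemma measurable_crossD c N j : dyad N j <= tm ->
  measurable [set w | crossD mu sigma (kp w) (Wp w) c N j].
Proof.
move=> jt; apply: measurable_all => p; apply: measurable_ex => M.
apply: measurable_ex => l; apply: measurable_ex => l'.
have [lj|lj] := pselect (l' <= j * 2 ^ M)%N; last first.
  by rewrite [X in measurable X](_ : _ = set0) //; apply/seteqP; split=> w // -[_ /lj].
have [ll|ll] := pselect (l <= l')%N; last first.
  by rewrite [X in measurable X](_ : _ = set0) //; apply/seteqP; split=> w // -[/ll].
pose f w := Xd mu sigma (kp w) (Wp w) (N + M) l' - Xd mu sigma (kp w) (Wp w) (N + M) l.
have t' : dyad (N + M) l' <= tm.
  by apply: le_trans jt; rewrite -(dyad_refine N M j) ler_dyad.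
have mf : measurable_fun setT f.
  apply: measurable_funB; apply: measurable_Xd => //.
  by apply: le_trans t'; rewrite ler_dyad.
rewrite [X in measurable X](_ : _ = [set w | ((c - p.+1%:R^-1)%:E < (EFin \o f) w)%E]).
  by apply: measurable_gtr; exact/measurable_EFinP.
by apply/seteqP; split=> w /=; rewrite lte_fin; [case|split].
Qed.

End UpTo.

Hypothesis mkap : forall t, dyadic t -> forall k, measurable [set w | kap t w = k].
Hypothesis mW : forall t, dyadic t -> measurable_fun setT (W t).

Let mk tm t : dyadic t -> t <= tm -> forall k, measurable [set w | kap t w = k].
Proof. by move=> dt _; exact: mkap. Qed.

Let mw tm t : dyadic t -> t <= tm -> measurable_fun setT (W t).
Proof. by move=> dt _; exact: mW. Qed.

Lemma measurable_tauF c : measurable_fun setT (fun w => tauF mu sigma (kp w) (Wp w) c).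
Proof.
apply: measurable_of_ltr => x.
rewrite [X in measurable X](_ : _ = [set w | exists N, exists j, dyad N j < x /\
    crossD mu sigma (kp w) (Wp w) c N j]).
  apply: measurable_ex => N; apply: measurable_ex => j; apply: measurable_Prop.
  exact: (measurable_crossD (@mk (dyad N j)) (@mw (dyad N j))).
apply/seteqP; split=> w.
  move=> /ereal_inf_lt[_ [[N j] /= cr <-]]; rewrite lte_fin => lt.
  by exists N, j.
move=> [N [j [lt cr]]]; apply: (@le_lt_trans _ _ (dyad N j)%:E); last by rewrite lte_fin.
by apply: ereal_inf_lbound; exists (N, j).
Qed.

Lemma measurable_gapD N j : measurable_fun setT (fun w => gapD mu sigma (kp w) (Wp w) N j).
Proof.
apply: measurable_of_gtr => x.
rewrite [X in measurable X](_ : _ = [set w | exists M, exists l, (l <= j * 2 ^ M)%N /\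
    x < Xd mu sigma (kp w) (Wp w) N j - Xd mu sigma (kp w) (Wp w) (N + M)%N l]).
  apply: measurable_ex => M; apply: measurable_ex => l; apply: measurable_Prop.
  pose f w := Xd mu sigma (kp w) (Wp w) N j - Xd mu sigma (kp w) (Wp w) (N + M) l.
  have mf : measurable_fun setT f.
    apply: measurable_funB.
      exact: (measurable_Xd (@mk (dyad N j)) (@mw (dyad N j))).
    exact: (measurable_Xd (@mk (dyad (N + M) l)) (@mw (dyad (N + M) l))).
  rewrite [X in measurable X](_ : _ = [set w | (x%:E < (EFin \o f) w)%E]).
    by apply: measurable_gtr; exact/measurable_EFinP.
  by apply/seteqP; split=> w /=; rewrite lte_fin.
apply/seteqP; split=> w.
  move=> /ereal_sup_gt[_ [[M l] /= lj <-]]; rewrite lte_fin => lt.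
  by exists M, l.
move=> [M [l [lj lt]]].
apply: (@lt_le_trans _ _ (Xd mu sigma (kp w) (Wp w) N j - Xd mu sigma (kp w) (Wp w) (N + M) l)%:E).
  by rewrite lte_fin.
by apply: ereal_sup_ubound; exists (M, l).
Qed.

Lemma measurable_lastF c j : measurable [set w | lastF (kp w) (tauF mu sigma (kp w) (Wp w) c) j].
Proof.
apply: measurable_ex => N0; apply: measurable_all => N; apply: measurable_imp => _.
apply: measurable_ex => l.
rewrite [X in measurable X](_ : _ = [set w | ((dyad N l)%:E < tauF mu sigma (kp w) (Wp w) c)%E] `&`
  ([set w | (tauF mu sigma (kp w) (Wp w) c <= (dyad N l.+1)%:E)%E] `&`
   [set w | kap (dyad N l) w = j])).
  apply: measurableI; first by apply: measurable_gtr; exact: measurable_tauF.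
  apply: measurableI; first by apply: measurable_ler; exact: measurable_tauF.
  by apply: mkap; exists N, l.
by apply/seteqP; split=> w; [case|case=> ? []].
Qed.

Lemma measurable_lastP c i j :
  measurable [set w | lastP mu sigma c i (kp w) (Wp w) = j].
Proof.
pose L l := [set w | lastF (kp w) (tauF mu sigma (kp w) (Wp w) c) l].
have mL l : measurable (L l) by exact: measurable_lastF.
rewrite (_ : [set w | _] = L j `|` [set w | i = j /\ (\bigcap_(l in [set: 'I_m]) ~` L l) w]).
  apply: measurableU => //; apply: measurable_Prop.
  by apply: fin_bigcap_measurable => // l _; exact: measurableC.
apply/seteqP; split=> w /=.
  rewrite /lastP; case: xgetP => [l -> Ll <-|no <-]; first by left.
  by right; split=> // l _ Ll; exact: (no l Ll).
case=> [Lj|[<- no]]; first exact: lastPE.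
by rewrite /lastP; case: xgetP => // l _ Ll; case: (no l I).
Qed.

Lemma measurable_dfloor_eq N j : measurable [set t : R | dfloor N t = j].
Proof.
(* Truncation sends all negative times to index 0. *)
rewrite [X in measurable X](_ : _ = [set t | t < 0 /\ j = 0%N] `|`
    `[dyad N j, (dyad N j.+1)[%classic).
  apply: measurableU; last exact: measurable_itv.
  have [->|jn] := eqVneq j 0%N.
    rewrite [X in measurable X](_ : _ = `]-oo, (0 : R)[%classic); first exact: measurable_itv.
    by apply/seteqP; split=> t /=; rewrite in_itv /=; [case|split].
  rewrite [X in measurable X](_ : _ = set0) //; apply/seteqP; split=> t // -[_ j0].
  by rewrite j0 in jn.
apply/seteqP; split=> t /=.
  move=> <-; have [t0|t0] := ltP t 0.
    left; split=> //; rewrite /dfloor; apply/eqP; rewrite truncn_floor.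
    by rewrite leNgt pmulr_llt0 ?t0 // exprn_gt0.
  by right; rewrite in_itv /=; exact: dfloor_itv.
case=> [[t0 ->]|]; last first.
  rewrite in_itv /= => /andP[jt tj].
  have t0 : 0 <= t by apply: le_trans jt; exact: dyad_ge0.
  have /andP[ft tf] := dfloor_itv N t0.
  apply/eqP; rewrite eqn_leq; apply/andP; split; rewrite -ltnS -(ltr_dyad (R := R) N).
    exact: le_lt_trans tj.
  exact: le_lt_trans tf.
rewrite /dfloor; apply/eqP; rewrite truncn_floor.
by rewrite leNgt pmulr_llt0 ?t0 // exprn_gt0.
Qed.

(** Joint measurability in the path and the time: the dependence on time goes through countably many
    dyadic cells. *)
Lemma measurable_by_floor d' (U : measurableType d') (f : nat -> T -> U) N :
  (forall j, measurable_fun setT (f j)) ->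
  measurable_fun setT (fun z : T * R => f (dfloor N z.2) z.1).
Proof.
move=> mf _ A mA; rewrite setTI.
rewrite (_ : _ @^-1` A = [set z | exists j, (f j @^-1` A `*` [set t | dfloor N t = j]) z]).
  apply: measurable_ex => j; apply: measurableX.
    by rewrite -[X in measurable X]setTI; exact: mf.
  exact: measurable_dfloor_eq.
apply/seteqP; split=> [[w t] /= Az|[w t] [j [Aj /= tj]]]; last by rewrite /= tj.
by exists (dfloor N t).
Qed.

Lemma measurable_gapF : measurable_fun setT
  (fun z : T * R => gapF mu sigma (kp z.1) (Wp z.1) z.2).
Proof.
apply: measurable_fun_limn_esup => N.
apply: (measurable_by_floor (f := fun j w => gapD mu sigma (kp w) (Wp w) N j.+1)) => j.
exact: measurable_gapD.
Qed.

Lemma measurable_phaseF j : measurable [set z : T * R | phaseF (kp z.1) z.2 j].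
Proof.
apply: measurable_ex => N0; apply: measurable_all => N; apply: measurable_imp => _.
rewrite [X in measurable X](_ : _ = [set z : T * R | exists l, ([set w | kap (dyad N l.+1) w = j] `*`
    [set t : R | dfloor N t = l]) z]).
  apply: measurable_ex => l; apply: measurableX; last exact: measurable_dfloor_eq.
  by apply: mkap; exists N, l.+1.
apply/seteqP; split=> [[w t] /= Az|[w t] [l [Aj /= tj]]]; last by rewrite /= tj.
by exists (dfloor N t).
Qed.

(** A subset of the product space, so that the measure of its sections is measurable in the path.
    The lower bound [lo] serves reflected segments, where [[0, x]] becomes [[b - x, b]]. *)
Definition occ_set (lo hi c : R) (j : 'I_m) : set (T * R) :=
  [set z | [/\ 0 <= z.2, (z.2%:E < tauF mu sigma (kp z.1) (Wp z.1) c)%E,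
    (lo%:E <= gapF mu sigma (kp z.1) (Wp z.1) z.2 <= hi%:E)%E & phaseF (kp z.1) z.2 j]].

Lemma measurable_occ_set lo hi c j : measurable (occ_set lo hi c j).
Proof.
rewrite (_ : occ_set lo hi c j = (setT `*` `[(0 : R), +oo[%classic) `&`
  ([set z | (z.2%:E < tauF mu sigma (kp z.1) (Wp z.1) c)%E] `&`
  ([set z | (lo%:E <= gapF mu sigma (kp z.1) (Wp z.1) z.2)%E] `&`
  ([set z | (gapF mu sigma (kp z.1) (Wp z.1) z.2 <= hi%:E)%E] `&`
   [set z | phaseF (kp z.1) z.2 j])))).
  apply: measurableI; first by apply: measurableX => //; exact: measurable_itv.
  apply: measurableI.
    rewrite -[X in measurable X]setTI; apply: measurable_lte => //.
      by apply/measurable_EFinP; exact: measurable_snd.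
    exact: (measurableT_comp (measurable_tauF c) measurable_fst).
  apply: measurableI; first by apply: measurable_ger; exact: measurable_gapF.
  apply: measurableI; first by apply: measurable_ler; exact: measurable_gapF.
  exact: measurable_phaseF.
apply/seteqP; split=> [[w t] /= [t0 tt /andP[l1 l2] ph]|[w t] [[_ /=]]].
  by do ![split=> //]; rewrite /= in_itv /= t0.
rewrite in_itv /= andbT => t0 [tt [l1 [l2 ph]]].
by split=> //; rewrite l1.
Qed.

Definition occF (lo hi c : R) (j : 'I_m) (w : T) : \bar R :=
  lebesgue_measure (xsection (occ_set lo hi c j) w).

Lemma measurable_occF lo hi c j : measurable_fun setT (occF lo hi c j).
Proof. by apply: measurable_fun_xsection; exact: measurable_occ_set. Qed.

End FunctionalMeasurability.

Section CylinderCoordinates.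
Context {R : realType} {m : nat} d (T : measurableType d).
Variables (kap : R -> T -> 'I_m) (W : R -> T -> R) (i : 'I_m).
Hypothesis kap0 : forall w, kap 0 w = i.
Hypothesis W0 : forall w, W 0 w = 0.

(** Cylinders involve positive times only; the coordinates at time 0 are constant by
    normalisation. *)
Lemma coord_sub_cyl : coord kap W dyadic `<=` <<s cyl_class kap W >>.
Proof.
pose GT := g_sigma_algebraType (cyl_class kap W).
have gen t k A : 0 < t -> measurable A ->
    measurable ([set w | kap t w = k /\ A (W t w)] : set GT).
  move=> t0 mA; apply: sub_sigma_algebra.
  exists 1%N, (fun=> t), (fun=> k), (fun=> A); split; first by split.
  split=> //; apply/seteqP; split=> [w [kt At] [|l]//= _|w /(_ 0%N isT)] /=.
    by rewrite W0 subr0.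
  by rewrite W0 subr0.
move=> E [t [N [j ->]]] H; have [t0|t0] := eqVneq (dyad N j : R) 0.
  move: H; rewrite t0 => -[[k ->]|[A mA ->]].
    have [ik|ik] := pselect (i = k).
      rewrite (_ : [set _ | _] = setT); first exact: (@measurableT _ GT).
      by apply/seteqP; split=> // w _ /=; rewrite kap0.
    rewrite (_ : [set _ | _] = set0); first exact: (@measurable0 _ GT).
    by apply/seteqP; split=> // w /=; rewrite kap0.
  have [A0|A0] := pselect (A 0).
    rewrite (_ : _ @^-1` _ = setT); first exact: (@measurableT _ GT).
    by apply/seteqP; split=> // w _ /=; rewrite W0.
  rewrite (_ : _ @^-1` _ = set0); first exact: (@measurable0 _ GT).
  by apply/seteqP; split=> // w /=; rewrite W0.
have {}t0 : 0 < dyad N j :> R by rewrite lt_def t0 dyad_ge0.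
case: H => [[k ->]|[A mA ->]].
  rewrite (_ : [set _ | _] = [set w | kap (dyad N j) w = k /\ setT (W (dyad N j) w)]).
    exact: gen.
  by apply/seteqP; split=> w //= [].
rewrite (_ : _ @^-1` _ = \bigcup_(k in [set: 'I_m])
    [set w | kap (dyad N j) w = k /\ A (W (dyad N j) w)]).
  by apply: (@fin_bigcup_measurable _ GT) => // k _; exact: gen.
by apply/seteqP; split=> [w Aw|w [k _ []]//]; exists (kap (dyad N j) w).
Qed.

End CylinderCoordinates.

(** * Transfer of laws through the canonical path space *)

Section SameLaw.
Context {R : realType} {m : nat}.

(** The index [i] does not appear in the carrier; it provides the base point, the constant path in
    phase [i]. *)
Definition path_space (i : 'I_m) := ((R -> 'I_m) * (R -> R))%type.
HB.instance Definition _ i := Choice.on (path_space i).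
HB.instance Definition _ i :=
  isPointed.Build (path_space i) ((fun=> i), (fun=> 0)).

Variable i : 'I_m.

(* Coordinates are normalised at time 0, so that the canonical process starts in [i]
   on the whole path space. *)
Definition kapS (t : R) (s : path_space i) : 'I_m := if t == 0 then i else s.1 t.
Definition WS (t : R) (s : path_space i) : R := if t == 0 then 0 else s.2 t.

Notation ST := (g_sigma_algebraType (coord kapS WS dyadic)).

Lemma kapS0 s : kapS 0 s = i. Proof. by rewrite /kapS eqxx. Qed.
Lemma WS0 s : WS 0 s = 0. Proof. by rewrite /WS eqxx. Qed.

Lemma measurable_kapS t : dyadic t -> forall k, measurable ([set s | kapS t s = k] : set ST).
Proof. by move=> dt k; apply: sub_sigma_algebra; exists t => //; left; exists k. Qed.

Lemma measurable_WS t : dyadic t -> measurable_fun (setT : set ST) (WS t : ST -> R).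
Proof.
move=> dt _ A mA; rewrite setTI; apply: sub_sigma_algebra; exists t => //.
by right; exists A.
Qed.

Context d (T : measurableType d) (P : probability T R) (Q : 'M[R]_m).

Section Lift.
Variables (kap : R -> T -> 'I_m) (W : R -> T -> R).
Hypothesis kap0 : forall w, kap 0 w = i.
Hypothesis W0 : forall w, W 0 w = 0.
Hypothesis mkap : forall t k, measurable [set w | kap t w = k].
Hypothesis mW : forall t, measurable_fun setT (W t).

Definition lift_path (w : T) : ST := (kap ^~ w, W ^~ w).

Lemma kapS_lift t w : kapS t (lift_path w) = kap t w.
Proof. by rewrite /kapS; case: eqP => // ->; rewrite kap0. Qed.

Lemma WS_lift t w : WS t (lift_path w) = W t w.
Proof. by rewrite /WS; case: eqP => // ->; rewrite W0. Qed.

Lemma measurable_lift : measurable_fun setT lift_path.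
Proof.
apply: (@measurability _ _ T ST setT lift_path (coord kapS WS dyadic)) => //.
move=> _ [_ [t dt [[k ->]|[A mA ->]]] <-]; rewrite setTI.
  rewrite (_ : _ @^-1` _ = [set w | kap t w = k]); first exact: mkap.
  by apply/seteqP; split=> w /=; rewrite kapS_lift.
rewrite (_ : _ @^-1` _ = W t @^-1` A).
  by rewrite -[X in measurable X]setTI; exact: mW.
by apply/seteqP; split=> w /=; rewrite WS_lift.
Qed.

End Lift.

Variables (kap1 kap2 : R -> T -> 'I_m) (W1 W2 : R -> T -> R).
Hypothesis kap10 : forall w, kap1 0 w = i.
Hypothesis W10 : forall w, W1 0 w = 0.
Hypothesis mkap1 : forall t k, measurable [set w | kap1 t w = k].
Hypothesis mW1 : forall t, measurable_fun setT (W1 t).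
Hypothesis fdd1 : MC_BM_fdd P Q i kap1 W1.
Hypothesis kap20 : forall w, kap2 0 w = i.
Hypothesis W20 : forall w, W2 0 w = 0.
Hypothesis mkap2 : forall t k, measurable [set w | kap2 t w = k].
Hypothesis mW2 : forall t, measurable_fun setT (W2 t).
Hypothesis fdd2 : MC_BM_fdd P Q i kap2 W2.

Let phi1 : {mfun T >-> ST} := mfun_Sub (mem_set (measurable_lift kap10 W10 mkap1 mW1)).
Let phi2 : {mfun T >-> ST} := mfun_Sub (mem_set (measurable_lift kap20 W20 mkap2 mW2)).

Let phi1E w : phi1 w = lift_path kap1 W1 w. Proof. by []. Qed.
Let phi2E w : phi2 w = lift_path kap2 W2 w. Proof. by []. Qed.

Let k1E w : kapS ^~ (phi1 w) = kap1 ^~ w.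
Proof. by apply/funext => t; rewrite phi1E kapS_lift. Qed.
Let k2E w : kapS ^~ (phi2 w) = kap2 ^~ w.
Proof. by apply/funext => t; rewrite phi2E kapS_lift. Qed.
Let w1E w : WS ^~ (phi1 w) = W1 ^~ w.
Proof. by apply/funext => t; rewrite phi1E WS_lift. Qed.
Let w2E w : WS ^~ (phi2 w) = W2 ^~ w.
Proof. by apply/funext => t; rewrite phi2E WS_lift. Qed.

(** Equal finite-dimensional laws give equal images on path space. Matrices computed on segments 0
    and 1 thereby hold for every segment of the same parity. *)
Lemma same_law (E : set ST) : measurable E ->
  distribution P phi1 E = distribution P phi2 E.
Proof.
move=> mE.
apply: (@two_stage _ _ _ ST kapS WS i kapS0 WS0 measurable_kapS measurable_WS
  (distribution P phi1) (distribution P phi2) (fun n => n) (fun n => n * 2 ^ n)%N).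
- have := ltry (1 : R); rewrite -(@probability_setT _ ST R (distribution P phi1)); exact.
- exact: all_grid.
- move=> n _ [K [A [mA ->]]].
  have e1 : phi1 @^-1` @cyl_event _ _ _ ST kapS WS (n * 2 ^ n) (gtime n) K A =
            cyl_event kap1 W1 (n * 2 ^ n) (gtime n) K A.
    by apply/seteqP; split=> w /= h l /h; rewrite kapS_lift // !WS_lift.
  have e2 : phi2 @^-1` @cyl_event _ _ _ ST kapS WS (n * 2 ^ n) (gtime n) K A =
            cyl_event kap2 W2 (n * 2 ^ n) (gtime n) K A.
    by apply/seteqP; split=> w /= h l /h; rewrite kapS_lift // !WS_lift.
  have tg := @gtime_grid R n (n * 2 ^ n).
  refine (etrans (congr1 P e1) (etrans _ (esym (congr1 P e2)))).
  by rewrite (fdd1 K tg mA) (fdd2 K tg mA).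
- by apply: sub_sigma_algebra2 mE => A [t /all_dyadic nt h]; exists t.
Qed.

Lemma same_prob (E : (R -> 'I_m) -> (R -> R) -> Prop) :
  measurable ([set s | E (kapS ^~ s) (WS ^~ s)] : set ST) ->
  P [set w | E (kap1 ^~ w) (W1 ^~ w)] = P [set w | E (kap2 ^~ w) (W2 ^~ w)].
Proof.
move=> /same_law; rewrite /distribution /pushforward /=.
by congr (P _ = P _); apply/seteqP; split=> w /=; rewrite ?k1E ?k2E ?w1E ?w2E.
Qed.

Lemma same_integral (F : (R -> 'I_m) -> (R -> R) -> \bar R) :
  (forall k W, 0 <= F k W)%E ->
  measurable_fun (setT : set ST) (fun s => F (kapS ^~ s) (WS ^~ s)) ->
  (\int[P]_w F (kap1 ^~ w) (W1 ^~ w) = \int[P]_w F (kap2 ^~ w) (W2 ^~ w))%E.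
Proof.
move=> F0 mF; pose G (s : ST) := F (kapS ^~ s) (WS ^~ s).
have G0 s : (0 <= G s)%E by exact: F0.
have -> : (fun w => F (kap1 ^~ w) (W1 ^~ w)) = G \o phi1.
  by apply/funext => w /=; rewrite /G k1E w1E.
have -> : (fun w => F (kap2 ^~ w) (W2 ^~ w)) = G \o phi2.
  by apply/funext => w /=; rewrite /G k2E w2E.
rewrite -(@ge0_integral_distribution _ _ T ST R P phi1 G mF G0).
rewrite -(@ge0_integral_distribution _ _ T ST R P phi2 G mF G0).
by apply: eq_measure_integral => A mA _; exact: same_law.
Qed.

End SameLaw.

(** * A single segment *)

Section MeasureLiminf.
Context {R : realType} d (T : measurableType d) (P : probability T R).

Definition eventually_in (F : nat -> set T) : set T :=
  [set w | exists n, forall k, (n <= k)%N -> F k w].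

Lemma measurable_eventually_in F : (forall n, measurable (F n)) -> measurable (eventually_in F).
Proof.
move=> mF; apply: measurable_ex => n; apply: measurable_all => k.
by apply: measurable_imp => _; exact: mF.
Qed.

(** The lower limit is an increasing union of events, each contained in some [F n]. *)
Lemma eventually_in_le F c : (forall n, measurable (F n)) -> (forall n, (P (F n) <= c)%E) ->
  (P (eventually_in F) <= c)%E.
Proof.
move=> mF Fc; pose G n := [set w | forall k, (n <= k)%N -> F k w].
have mG n : measurable (G n).
  by apply: measurable_all => k; apply: measurable_imp => _; exact: mF.
have GE : eventually_in F = \bigcup_n G n.
  by apply/seteqP; split=> [w [n Hn]|w [n _ Hn]]; exists n.
have ndG : nondecreasing_seq G.
  apply/nondecreasing_seqP => n; apply/subsetPset => w Gw k nk.
  by apply: Gw; exact: ltnW.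
rewrite GE; have cv : P (G n) @[n --> \oo] --> P (\bigcup_n G n).
  by apply: nondecreasing_cvg_mu => //; exact: bigcupT_measurable.
rewrite -(cvg_lim _ cv) //; apply: lime_le; first by apply/cvg_ex; eexists; exact: cv.
apply: nearW => n /=; apply: le_trans (Fc n); apply: le_measure; rewrite ?inE //.
by move=> w; apply.
Qed.

Lemma prob_setD_le (A B : set T) (x y : R) : measurable A -> measurable B -> x + y = 1 ->
  (x%:E * P A <= P (A `&` B))%E -> (P (A `\` B) <= y%:E * P A)%E.
Proof.
move=> mA mB xy; have mI : measurable (A `&` B) by exact: measurableI.
have fin E : measurable E -> P E \is a fin_num by move=> mE; exact: fin_num_measure.
have -> : P (A `\` B) = (P A - P (A `&` B))%E by rewrite measureD // ltey_eq fin.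
rewrite -(fineK (fin _ mA)) -(fineK (fin _ mI)) -!EFinM -EFinB !lee_fin.
by move: (fine (P A)) (fine _) => a c; have -> : x = 1 - y by [lra]; lra.
Qed.

Lemma ae_prob_le (A B : set T) : measurable A -> measurable B ->
  {ae P, forall w, A w -> B w} -> (P A <= P B)%E.
Proof.
move=> mA mB [N [mN N0 sub]].
apply: (@le_trans _ _ (P (B `|` N))).
  apply: le_measure; rewrite ?inE //; first exact: measurableU.
  move=> w Aw; have [Bw|nB] := pselect (B w); first by left.
  by right; apply: sub => /(_ Aw).
apply: (@le_trans _ _ (P B + P N)%E); first exact: measureU2.
by rewrite N0 adde0.
Qed.

Lemma ae_prob_eq (A B : set T) : measurable A -> measurable B ->
  {ae P, forall w, A w <-> B w} -> P A = P B.
Proof.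
move=> mA mB AB; apply/eqP; rewrite eq_le !ae_prob_le //.
  by apply: filterS AB => w [].
by apply: filterS AB => w [].
Qed.

End MeasureLiminf.

(** * A segment from 0 to the first visit to [b] *)

Section Segment.
Context {R : realType} {m : nat} d (T : measurableType d) (P : probability T R).
Variables (Q : 'M[R]_m) (mu sigma : 'I_m -> R) (b : R) (i : 'I_m).
Variables (kap : R -> T -> 'I_m) (W Z : R -> T -> R).
Hypothesis b0 : 0 < b.
Hypothesis kap0 : forall w, kap 0 w = i.
Hypothesis W0 : forall w, W 0 w = 0.
Hypothesis mkap : forall t k, measurable [set w | kap t w = k].
Hypothesis mW : forall t, measurable_fun setT (W t).
Hypothesis fdd : MC_BM_fdd P Q i kap W.
Hypothesis step_kap : forall w, step_path (kap ^~ w).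
Hypothesis cW : forall w, cont0 (W ^~ w).
Hypothesis path : forall w, exists X, drawup_path b X (Z ^~ w) /\
  (forall s t, 0 <= s <= t -> (forall u, s <= u < t -> kap u w = kap s w) ->
    X t - X s = mu (kap s w) * (t - s) + sigma (kap s w) * (W t w - W s w)).
(** With the phase frozen during [eta], an increment of [W] in a suitable unit interval lifts [X] by
    [b] whatever the phase. This covers both signs of [sigma], hence both kinds of segments. *)
Hypothesis push : forall eta, 0 < eta -> exists a, forall k x, a < x <= a + 1 ->
  b <= mu k * eta + sigma k * x.

Notation tau w := (tauF mu sigma (kap ^~ w) (W ^~ w) b).
Notation cross c N j w := (crossD mu sigma (kap ^~ w) (W ^~ w) c N j).

Let mtau : measurable_fun setT (fun w => tau w).
Proof.
by apply: measurable_tauF => [t _ k|t _]; [exact: mkap|exact: mW].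
Qed.

Lemma tau_hit w : tau w = hit (Z ^~ w) b.
Proof. by have [X [XZ incX]] := path w; apply: (tauFE b0 (step_kap w) (cW w) XZ incX). Qed.

Lemma tau_pos w dl : tau w = dl%:E -> 0 < dl.
Proof.
rewrite tau_hit => h; have [X [XZ _]] := path w.
by have [] := hit_fin b0 XZ h.
Qed.

Lemma tau_ge0 w : (0 <= tau w)%E.
Proof. by rewrite tau_hit; exact: hit_ge0. Qed.

Lemma cross_tau w N j : cross b N j w <-> (tau w <= (dyad N j)%:E)%E.
Proof.
have [X [XZ incX]] := path w.
have bb : 0 < b <= b by rewrite b0 lexx.
have tN := dyad_ge0 (R := R) N j.
have cD := crossDP b0 (step_kap w) (cW w) XZ incX N j bb.
have hc := hit_cross b0 XZ tN.
split.
  move=> /cD /hc[s /andP[s0 sj] Zs]; rewrite tau_hit.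
  apply: (@le_trans _ _ s%:E); last by rewrite lee_fin.
  by apply: ereal_inf_lbound; exists s.
move=> h; apply/cD/hc; move: h (tau_ge0 w); case E: (tau w) => [dl||] //.
rewrite lee_fin => dN _; have dl0 := tau_pos E.
move: E; rewrite tau_hit => /(hit_fin b0 XZ)[_ Zdl _].
by exists dl => //; rewrite dl0.
Qed.

Lemma cross_past c N j : <<s past kap W N j >> [set w | cross c N j w].
Proof.
pose GT := g_sigma_algebraType (past kap W N j).
apply: (@measurable_crossD _ _ _ GT mu sigma kap W (dyad N j)) => //.
- move=> t dt tN k; apply: sub_sigma_algebra; exists t => //.
  by left; exists k.
- move=> t dt tN _ A mA; rewrite setTI; apply: sub_sigma_algebra; exists t => //.
  by right; exists A.
Qed.

Let pastC N j A : <<s past kap W N j >> A -> <<s past kap W N j >> (~` A).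
Proof. exact: (@measurableC _ (g_sigma_algebraType (past kap W N j))). Qed.

Local Notation c := (expR (mx_total Q)).

Let c1 : 1 <= c.
Proof.
rewrite -[X in X <= _]expR0 ler_expR sumr_ge0 // => k _.
by rewrite sumr_ge0.
Qed.

Let Ev p n : set T := [set w | ((dyad p n)%:E < tau w)%E].

Let mEv p n : measurable (Ev p n).
Proof. exact: measurable_gtr. Qed.

(** In each interval of length [eta], with probability at least [(1 - c * eta) * g] given survival
    so far, the phase is quiet and the increment lifts [X] by [b], which ends the segment. The ratio
    [r] is the complementary probability. *)
Lemma tail : exists p (r : R), 0 <= r < 1 /\ forall n, (P (Ev p n) <= (r ^+ n)%:E)%E.
Proof.
(* A mesh below [(2 * c)^-1] makes an interval quiet with probability more than one half. *)
have c20 : 0 < (2 * c)^-1 by rewrite invr_gt0; move: c1; lra.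
have [p /(_ p (leqnn p))] := half_pow_lt c20.
set eta := (_ ^+ p)^-1 => etac.
have eta0 : 0 < eta by rewrite invr_gt0 exprn_gt0.
have ceta : c * eta < 2^-1.
  move: etac; rewrite invfM; move: c1; move: (c) (eta) => x y x1 yx.
  have x0 : 0 < x by lra.
  by rewrite mulrC -ltr_pdivlMr.
have eta1 : eta <= 1.
  have : eta <= c * eta by rewrite ler_peMl // ltW.
  by move: ceta; lra.
have [a Ha] := push eta0.
pose B : set R := `]a, (a + 1)%R]%classic.
have mB : measurable B by exact: measurable_itv.
have gB := gauss_fin_num eta mB.
pose g := fine (gauss eta B).
have gE : gauss eta B = g%:E by rewrite fineK.
have g0 : 0 < g by rewrite -lte_fin -gE; exact: gauss_gt0.
have g1 : g <= 1 by rewrite -lee_fin -gE; exact: gauss_le1.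
have h0 : 0 < (1 - c * eta) * g by rewrite mulr_gt0 // subr_gt0; move: ceta; lra.
have h1 : (1 - c * eta) * g <= 1.
  have x0 : 0 <= 1 - c * eta by move: ceta; lra.
  apply: mulr_ile1 => //; first exact: ltW.
  by rewrite gerBl mulr_ge0 ?expR_ge0 // ltW.
exists p, (1 - (1 - c * eta) * g); split.
  by move: h0 h1; move: (_ * g) => z; lra.
elim=> [|n IH]; first by rewrite expr0 probability_le1.
pose G := quiet kap p n eta `&` [set w | B (W (dyad p n + eta) w - W (dyad p n) w)].
have mG : measurable G.
  apply: measurableI; first exact: quiet_measurable.
  by rewrite -[X in measurable X]setTI; apply: measurable_funB.
have pE : <<s past kap W p n >> (Ev p n).
  rewrite (_ : Ev p n = ~` [set w | cross b p n w]); first exact: (pastC (@cross_past b p n)).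
  apply/seteqP; split=> w /=; first by move=> lt /cross_tau; rewrite leNgt lt.
  by move=> nc; rewrite /Ev /= ltNge; apply/negP => /cross_tau.
(* On [G] the two times [dyad p n] and [dyad p n + eta] already witness a rise of [X] by [b], so the
   segment is over by [dyad p n.+1]. *)
have sub : Ev p n.+1 `<=` Ev p n `\` G.
  move=> w En; split.
    by apply: lt_trans En; rewrite lte_fin ltr_dyad.
  move=> [qw Bw]; move: En; rewrite /Ev /=; apply/negP; rewrite -leNgt.
  have [X [XZ incX]] := path w.
  have bb : 0 < b <= b by rewrite b0 lexx.
  apply/cross_tau/(crossDP b0 (step_kap w) (cW w) XZ incX p n.+1 bb).
  have t0 := dyad_ge0 (R := R) p n.
  have kc := quiet_const (step_kap w) t0 eta0 qw.
  have te : dyad p n <= dyad p n + eta by rewrite lerDl ltW.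
  exists (dyad p n), (dyad p n + eta); split=> //; first by rewrite dyadS.
  rewrite (incX _ _ _ kc); last by rewrite t0.
  rewrite addrAC subrr add0r; apply: Ha.
  by move: Bw; rewrite /B /= in_itv.
have q : ((1 - c * eta)%:E * gauss eta B * P (Ev p n) <= P (Ev p n `&` G))%E.
  by apply: (quiet_prob kap0 W0 mkap mW fdd) => //; [rewrite eta0|move: ceta; lra].
apply: (@le_trans _ _ (P (Ev p n `\` G))).
  by apply: le_measure; rewrite ?inE //; exact: measurableD.
apply: (@le_trans _ _ ((1 - (1 - c * eta) * g)%:E * P (Ev p n))%E).
  apply: (@prob_setD_le _ _ _ P _ _ ((1 - c * eta) * g)) => //; first by ring.
  by rewrite EFinM -gE.
rewrite exprS EFinM; apply: lee_wpmul2l => //.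
by rewrite lee_fin subr_ge0.
Qed.

Lemma tau_finite : {ae P, forall w, (tau w < +oo)%E}.
Proof.
have [p [r [/andP[r0 r1] H]]] := tail.
have mI : measurable [set w | tau w = +oo%E].
  rewrite (_ : [set w | _] = (fun w => tau w) @^-1` [set +oo%E]) //.
  by rewrite -[X in measurable X]setTI; apply: mtau => //; exact: emeasurable_set1.
exists [set w | tau w = +oo%E]; split=> //; last first.
  by move=> w /= /negP; rewrite -leNgt leye_eq => /eqP.
apply/eqP; rewrite eq_le measure_ge0 andbT.
have cv : (r ^+ n)%:E @[n --> \oo] --> 0%E.
  by apply: cvg_EFin; [exact: nearW|apply: cvg_expr; rewrite ger0_norm].
rewrite -(cvg_lim _ cv) //; apply: lime_ge; first by apply/cvg_ex; eexists; exact: cv.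
apply: nearW => n; apply: le_trans (H n); apply: le_measure; rewrite ?inE //.
by move=> w /= tw; rewrite /Ev /= tw ltry.
Qed.

(** Discrete layer-cake formula: the square of [tau] is at most the sum of eta^2 (2n + 1) over those
    n with n eta < [tau], and the geometric tails bound the integral of this sum. *)
Lemma tau_sq : exists C : R, (\int[P]_w ((fine (tau w)) ^+ 2)%:E <= C%:E)%E.
Proof.
have [p [r [/andP[r0 r1] H]]] := tail.
pose eta : R := (2 ^+ p)^-1; have eta0 : 0 < eta by rewrite invr_gt0 exprn_gt0.
pose f n w : \bar R := ((eta ^+ 2 * (2 * n%:R + 1))%:E * (\1_(Ev p n) w)%:E)%E.
have a0 n : 0 <= eta ^+ 2 * (2 * n%:R + 1) by rewrite mulr_ge0 ?sqr_ge0 // addr_ge0 // mulr_ge0.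
have f0 n w : (0 <= f n w)%E by rewrite mule_ge0 // lee_fin.
have mf n : measurable_fun setT (f n).
  apply: emeasurable_funM; first exact: measurable_cst.
  by apply/measurable_EFinP; exact: measurable_indic.
(* With [a_n := (al * n + be) * r ^+ n] one has [(2 * n + 1) * r ^+ n = a_n - a_(n+1)],
   and the weights [2 * n + 1] add up to squares. *)
pose al := 2 / (1 - r); pose be := (1 + r * al) / (1 - r).
have r10 : 1 - r != 0 by rewrite subr_eq0 eq_sym lt_eqF.
exists (eta ^+ 2 * be).
apply: (@le_trans _ _ (\int[P]_w (\sum_(0 <= n <oo) f n w))%E).
  apply: ge0_le_integral => //.
  - by move=> w _; rewrite lee_fin sqr_ge0.
  - apply/measurable_EFinP; apply: measurable_funX.
    by apply: measurableT_comp mtau; exact: fine_measurable.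
  - by apply: ge0_emeasurable_sum => // n _ _; exact: mf.
  move=> w _; have s0 : (0 <= \sum_(0 <= n <oo) f n w)%E by exact: nneseries_ge0.
  (* At an infinite [tau], [fine] returns 0 and the bound is trivial. *)
  case E: (tau w) => [dl||] /=; rewrite ?expr0n //=.
  have dl0 := tau_pos E.
  have ex : exists n, dl <= dyad p n.
    by exists (dfloor p dl).+1; have /andP[_ /ltW] := dfloor_itv p (ltW dl0).
  case: (ex_minnP ex) => N dN Nmin.
  apply: (@le_trans _ _ (\sum_(0 <= n < N) f n w)%E); last first.
    by apply: nneseries_lim_ge => n _ _; exact: f0.
  have -> : (\sum_(0 <= n < N) f n w = \sum_(0 <= n < N) (eta ^+ 2 * (2 * n%:R + 1))%:E)%E.
    rewrite !big_nat; apply: eq_bigr => n /andP[_ nN].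
    rewrite /f indicE mem_set ?mule1 // /Ev /= E lte_fin ltNge.
    by apply/negP => /Nmin; rewrite leqNgt nN.
  rewrite sumEFin lee_fin.
  have -> : \sum_(0 <= n < N) (eta ^+ 2 * (2 * n%:R + 1)) = (dyad p N) ^+ 2.
    rewrite -mulr_sumr /dyad mulrC exprMn; congr (_ * _).
    elim: (N) => [|n IH]; first by rewrite big_nil expr0n.
    by rewrite big_nat_recr //= IH -natr1; ring.
  by rewrite ler_pXn2r // nnegrE ?dyad_ge0 // ltW.
rewrite integral_nneseries //.
apply: lime_le; first by apply: is_cvg_nneseries => n _ _; exact: integral_ge0.
apply: nearW => N.
apply: (@le_trans _ _ (\sum_(0 <= n < N) (eta ^+ 2 * ((2 * n%:R + 1) * r ^+ n))%:E)%E).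
  apply: lee_sum => n _.
  rewrite /f ge0_integralZl_EFin //; last first.
    by apply/measurable_EFinP; exact: measurable_indic.
  rewrite integral_indic // setIT mulrA [X in (_ <= X)%E]EFinM.
  by apply: lee_wpmul2l; [rewrite lee_fin|exact: H].
rewrite sumEFin lee_fin -mulr_sumr ler_wpM2l ?sqr_ge0 //.
suff -> : \sum_(0 <= n < N) (2 * n%:R + 1) * r ^+ n = be - (al * N%:R + be) * r ^+ N.
  rewrite gerBl mulr_ge0 ?exprn_ge0 // /be /al.
  have i0 : 0 <= (1 - r)^-1 by rewrite invr_ge0 subr_ge0 ltW.
  by rewrite !(addr_ge0, mulr_ge0).
elim: N => [|n IH]; first by rewrite big_nil expr0; ring.
rewrite big_nat_recr //= IH -natr1 exprS /be /al.
by field.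
Qed.

(** A path with a jump at its hitting time belongs to [L q] for every [q]. In [L q] the mesh index
    [N] grows before the level index [p], because the mesh needed to announce the hitting time
    depends on the level. *)
Lemma no_jump : {ae P, forall w, forall dl, tau w = dl%:E ->
  left_lim (kap ^~ w) dl (kap dl w)}.
Proof.
pose lv p := b - b / p.+2%:R.
have lvb p : 0 < lv p <= b.
  have p1 : (1 : R) < p.+2%:R by rewrite ltr1n.
  rewrite /lv subr_gt0 ltr_pdivrMr ?(lt_trans ltr01) // ltr_pMr // p1 /=.
  by rewrite gerBl divr_ge0 // ltW.
(* [dyad N j] is the first grid time that sees the level [lv p] crossed: these events are disjoint
   in [j] and each belongs to the past of its grid time. *)
pose A p N j := [set w | cross (lv p) N j w] `&`
  \bigcap_(l in [set l | (l < j)%N]) ~` [set w | cross (lv p) N l w].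
pose eta q : R := (2 ^+ q)^-1.
have eta0 q : 0 < eta q by rewrite invr_gt0 exprn_gt0.
have pA p N j : <<s past kap W N j >> (A p N j).
  pose GT := g_sigma_algebraType (past kap W N j).
  apply: (@measurableI _ GT); first exact: cross_past.
  apply: (@bigcap_measurableType _ GT) => l lj; apply: (@measurableC _ GT).
  suff sub : past kap W N l `<=` past kap W N j.
    exact: (sub_sigma_algebra2 sub (@cross_past (lv p) N l)).
  apply: coord_mono => t [dt tl]; split=> //; apply: le_trans tl _.
  by rewrite ler_dyad ltnW.
have mA p N j : measurable (A p N j) by exact: (past_measurable mkap mW (pA p N j)).
(* If the phase jumps at the hitting time, the interval of length [eta q] that follows the
   announcing grid time is not quiet, an event of probability at most [c * eta q]. *)
pose B q p N := \bigcup_j (A p N j `\` quiet kap N j (eta q)).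
have mq N j q : measurable (quiet kap N j (eta q)) by exact: quiet_measurable.
have mB q p N : measurable (B q p N).
  by apply: bigcupT_measurable => j; exact: measurableD.
have tA p N : trivIset setT (A p N).
  apply/trivIsetP => j l _ _ jl; apply/seteqP; split=> // w [[c1' n1] [c2 n2]].
  by case: (ltngtP j l) jl => // [lt|lt] _; [exact: (n2 j lt)|exact: (n1 l lt)].
have cq q : c * eta q <= 1 -> eta q <= 1 -> forall p N, (P (B q p N) <= (c * eta q)%:E)%E.
  move=> ceta eta1 p N.
  have mD j : measurable (A p N j `\` quiet kap N j (eta q)) by exact: measurableD.
  have tD : trivIset setT (fun j => A p N j `\` quiet kap N j (eta q)).
    apply/trivIsetP => j l _ _ jl; apply/seteqP; split=> // w [[Aj _] [Al _]].
    have /trivIsetP /(_ j l I I jl) := tA p N.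
    by move=> /seteqP[+ _]; apply.
  rewrite measure_semi_bigcup //; last exact: mB.
  apply: lime_le; first by apply: is_cvg_nneseries.
  apply: nearW => M.
  apply: (@le_trans _ _ (\sum_(0 <= j < M) ((c * eta q)%:E * P (A p N j)))%E).
    apply: lee_sum => j _.
    have e01 : 0 < eta q <= 1 by rewrite eta0.
    apply: (@prob_setD_le _ _ _ P _ _ (1 - c * eta q)) => //; first by ring.
    have := quiet_prob kap0 W0 mkap mW fdd e01 ceta measurableT (pA p N j).
    by rewrite gauss_setT mule1 (_ : [set w | _] = setT) ?setIT.
  rewrite -ge0_sume_distrr //.
  rewrite -[leRHS]mule1; apply: lee_wpmul2l.
    by rewrite lee_fin mulr_ge0 ?expR_ge0 // ltW.
  rewrite big_mkord -measure_bigsetU_ord //.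
    apply: probability_le1; apply: bigsetU_measurable => j _; exact: mA.
  by move=> j l _ _ ne; apply/ord_inj; exact: (tA p N j l I I ne).
pose L q := eventually_in (fun p => eventually_in (fun N => B q p N)).
have mL q : measurable (L q).
  by apply: measurable_eventually_in => p; exact: measurable_eventually_in.
exists (\bigcap_q L q); split; first exact: bigcapT_measurable.
- have mI : measurable (\bigcap_q L q) by exact: bigcapT_measurable.
  apply/eqP; rewrite eq_le measure_ge0 andbT.
  apply/lee_addgt0Pr => e e0; rewrite add0e.
  have d0 : 0 < Num.min e 1 / c.
    by rewrite divr_gt0 ?lt_min ?e0 ?ltr01 // (lt_le_trans ltr01).
  have [q /(_ q (leqnn q))] := half_pow_lt d0.
  rewrite -/(eta q) ltr_pdivlMr ?(lt_le_trans ltr01) // lt_min mulrC => /andP[ce ce1].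
  have e1 : eta q <= 1.
    by apply: le_trans (ltW ce1); rewrite ler_peMl ?c1 // ltW.
  apply: (@le_trans _ _ (P (L q))).
    by apply: le_measure; rewrite ?inE // => w; apply.
  apply: (@le_trans _ _ (c * eta q)%:E); last by rewrite lee_fin ltW.
  apply: eventually_in_le => p; first exact: measurable_eventually_in.
  by apply: eventually_in_le => N //; apply: cq => //; exact: ltW.
- move=> w /= /existsNP[dl /not_implyP[tdl nl]] q _.
  have [X [XZ incX]] := path w.
  have dl0 := tau_pos tdl.
  have /(hit_fin b0 XZ)[_ Zdl Zs] : hit (Z ^~ w) b = dl%:E by rewrite -tau_hit.
  have [p0 Hp] := announce b0 XZ dl0 Zdl Zs (eta0 q).
  exists p0 => p /Hp[N1 HN]; exists N1 => N /HN[j [cj ncj jdl dlj]].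
  have cD l := crossDP b0 (step_kap w) (cW w) XZ incX N l (lvb p).
  exists j => //; split.
    split; first exact/cD.
    by move=> l lj /= /cD; exact: ncj.
  move=> qw; apply: nl; have t0 := dyad_ge0 (R := R) N j.
  apply: (quiet_left_lim t0 (eta := eta q)); first by rewrite jdl.
  exact: (quiet_const (step_kap w) t0 (eta0 q) qw).
Qed.

Notation last w := (lastP mu sigma b i (kap ^~ w) (W ^~ w)).

Lemma measurable_last j : measurable [set w | last w = j].
Proof. by apply: measurable_lastP => [t _ k|t _]; [exact: mkap|exact: mW]. Qed.

Lemma last_left_lim w dl j : tau w = dl%:E -> left_lim (kap ^~ w) dl j <-> last w = j.
Proof.
move=> tE; have dl0 := tau_pos tE; have [l ll] := step_left (step_kap w) dl0.
have lE : last w = l by apply: lastPE; rewrite tE; apply/(lastFP (step_kap w) _ dl0).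
by rewrite lE; split=> [lj|<-//]; exact: left_lim_unique ll lj.
Qed.

Lemma sum_last_prob : \sum_j fine (P [set w | last w = j]) = 1.
Proof.
have H : (\sum_(k < m) P [set w | last w = k])%E = 1%E.
  rewrite -(probability_setT P).
  rewrite (@phase_partition R m d T P (fun _ w => last w) (fun _ => measurable_last) 0 _ measurableT).
  by apply: eq_bigr => k _; rewrite setTI.
apply/EFin_inj; rewrite -H -sumEFin; apply: eq_bigr => k _.
by rewrite fineK // fin_num_measure //; exact: measurable_last.
Qed.

(** The left-hand event reads the phase at the hitting time, the right-hand one its left limit; they
    agree almost surely because the phase does not jump there. *)
Lemma hit_phase_prob j :
  P [set w | exists dl, hit (Z ^~ w) b = dl%:E /\ kap dl w = j] = P [set w | last w = j].
Proof.
apply: ae_prob_eq; [|exact: measurable_last|].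
  rewrite (_ : [set w | _] = [set w | (tau w < +oo)%E] `&`
     (fun w => (w, fine (tau w))) @^-1` [set z | phaseF (kap ^~ z.1) z.2 j]).
    apply: measurableI.
      by rewrite -[X in measurable X]setTI; apply: measurable_lte.
    have mp : measurable_fun setT (fun w => (w, fine (tau w))).
      by apply: measurable_fun_pair => //; apply: measurableT_comp mtau; exact: fine_measurable.
    rewrite -[X in measurable X]setTI; apply: mp => //.
    by apply: (@measurable_phaseF _ _ _ _ kap) => t _ k; exact: mkap.
  apply/seteqP; split=> w /=; rewrite -tau_hit.
    move=> [dl [tE kj]]; rewrite tE ltry /=; split=> //.
    by apply/(phaseFP (step_kap w)) => //; apply: ltW; exact: tau_pos tE.
  move=> [tf]; have := tau_ge0 w; case E: (tau w) tf => [dl||] //= _ dl0 ph.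
  by exists dl; split=> //; apply/(phaseFP (step_kap w)).
near=> w; rewrite /= -tau_hit.
have tf : (tau w < +oo)%E by near: w; exact: tau_finite.
have nj : forall dl, tau w = dl%:E -> left_lim (kap ^~ w) dl (kap dl w).
  by near: w; exact: no_jump.
have := tau_ge0 w; case E: (tau w) tf => [dl||] // _ _.
have /(last_left_lim _ E) lE := nj _ E.
by split=> [[_ [[<-] <-]]//|<-]; exists dl.
Unshelve. all: by end_near.
Qed.

Notation occ lo hi j w := (occF mu sigma kap W lo hi b j w).

Lemma occ_section lo hi j w : xsection (occ_set mu sigma kap W lo hi b j) w =
  [set s | [/\ 0 <= s, (s%:E < hit (Z ^~ w) b)%E, lo <= Z s w <= hi & kap s w = j]].
Proof.
have [X [XZ incX]] := path w.
apply/seteqP; split=> s; rewrite xsectionE /= /occ_set /= tau_hit.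
  move=> [s0 sh]; rewrite (gapFE b0 (step_kap w) (cW w) XZ incX s0 sh) !lee_fin.
  by move=> ? /(phaseFP (step_kap w) _ s0).
move=> [s0 sh zz kj]; split=> //; last exact/(phaseFP (step_kap w) _ s0).
by rewrite (gapFE b0 (step_kap w) (cW w) XZ incX s0 sh) !lee_fin.
Qed.

Let mocc lo hi j w : measurable
  [set s | [/\ 0 <= s, (s%:E < hit (Z ^~ w) b)%E, lo <= Z s w <= hi & kap s w = j]].
Proof.
rewrite -occ_section; apply: measurable_xsection; apply: measurable_occ_set => [t _ k|t _].
  exact: mkap.
exact: mW.
Qed.

Lemma lebesgue_before (t : \bar R) : (0 <= t)%E ->
  measurable [set s : R | 0 <= s /\ (s%:E < t)%E] /\
  lebesgue_measure [set s : R | 0 <= s /\ (s%:E < t)%E] = t.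
Proof.
case: t => [t|_|] //.
  rewrite lee_fin => t0.
  have -> : [set s : R | 0 <= s /\ (s%:E < t%:E)%E] = `[0, t[%classic.
    by apply/seteqP; split=> s /=; rewrite in_itv /= lte_fin; [case=> -> ->|move=> /andP].
  split; first exact: measurable_itv.
  rewrite lebesgue_measure_itv /= lte_fin; case: ltgtP t0 => // [_ _|<- _] //.
  by rewrite sube0.
have -> : [set s : R | 0 <= s /\ (s%:E < +oo)%E] = `[0, +oo[%classic.
  by apply/seteqP; split=> s /=; rewrite in_itv /= andbT; [case|split=> //; rewrite ltry].
split; first exact: measurable_itv.
by rewrite lebesgue_measure_itv /= ltry.
Qed.

Lemma occ_le_tau lo hi j w : (occ lo hi j w <= tau w)%E.
Proof.
have [mS <-] := lebesgue_before (tau_ge0 w); rewrite /occF occ_section tau_hit.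
apply: le_measure; rewrite ?inE //; first exact: mocc.
  by move: mS; rewrite tau_hit.
by move=> s [].
Qed.

(** Source of the identity between row sums of [Mmat] at level [b] and mean durations. *)
Lemma occ_total w : (\sum_j occ 0 b j w = tau w)%E.
Proof.
have [mS e] := lebesgue_before (tau_ge0 w); rewrite -[RHS]e tau_hit.
have -> : [set s | 0 <= s /\ (s%:E < hit (Z ^~ w) b)%E] =
    \big[setU/set0]_(j < m) [set s | [/\ 0 <= s, (s%:E < hit (Z ^~ w) b)%E,
       0 <= Z s w <= b & kap s w = j]].
  apply/seteqP; split=> s.
    move=> [s0 sh]; rewrite (bigD1 (kap s w)) //=; left; split=> //.
    by have [X [[_ _ _ Zb _] _]] := path w; exact: Zb.
  by apply: (big_ind (fun X : set R => X s -> _)) => [//|X Y hX hY [/hX|/hY]//|k _ []].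
rewrite measure_bigsetU_ord //; last 2 first.
- by move=> j; exact: mocc.
- by move=> j k _ _ [s [[_ _ _ <-] [_ _ _ <-]]].
by apply: eq_bigr => j _; rewrite /occF occ_section.
Qed.

(** The condition on the level is an arbitrary boolean [g], since on a reflected segment it is
    stated for the original process and not for [Z]. *)
Lemma occ_integral lo hi (g : R -> bool) j w :
  (forall s, 0 <= s -> g s = (lo <= Z s w <= hi)) ->
  (\int[@lebesgue_measure R]_(s in [set s : R | (0 <= s)%R /\ (s%:E < hit (Z ^~ w) b)%E])
     (if g s && (kap s w == j) then 1%R else 0%R)%:E)%E = occ lo hi j w.
Proof.
move=> gE; rewrite integral_mkcond.
transitivity (\int[@lebesgue_measure R]_s (\1_[set s | [/\ 0 <= s,
    (s%:E < hit (Z ^~ w) b)%E, lo <= Z s w <= hi & kap s w = j]] s)%:E)%E.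
  apply: eq_integral => s _; rewrite patchE indicE; case: ifPn => [|sn].
    rewrite inE => -[s0 sh]; rewrite gE //.
    case: ifPn => [/andP[zz /eqP kj]|no]; first by rewrite mem_set.
    rewrite memNset // => -[_ _ zz kj]; move: no.
    by rewrite zz kj eqxx.
  by rewrite memNset // => -[s0 sh _ _]; move: sn; rewrite mem_set.
by rewrite integral_indic // ?setIT; [rewrite /occF occ_section|exact: mocc].
Qed.

End Segment.

(** * The chain of segments *)

Section ModulatedSums.
Context {R : realType} {m : nat} d (T : measurableType d) (P : probability T R).

Lemma measurable_modulated d' (U : measurableType d') d2 (U2 : measurableType d2)
    (ph : U -> 'I_m) (X : 'I_m -> U -> U2) :
  (forall i, measurable [set w | ph w = i]) -> (forall i, measurable_fun setT (X i)) ->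
  measurable_fun setT (fun w => X (ph w) w).
Proof.
move=> mph mX _ A mA; rewrite setTI.
rewrite (_ : _ @^-1` A = \bigcup_(i in [set: 'I_m]) ([set w | ph w = i] `&` X i @^-1` A)).
  apply: fin_bigcup_measurable => // i _; apply: measurableI => //.
  by rewrite -[X in measurable X]setTI; exact: mX.
by apply/seteqP; split=> [w Aw|w [i _ [/= <-]]//]; exists (ph w).
Qed.

Lemma integrable_big_sum (I : Type) (s : seq I) (X : I -> T -> R) :
  (forall i, P.-integrable setT (EFin \o X i)) ->
  P.-integrable setT (EFin \o (fun w => \sum_(i <- s) X i w)).
Proof.
move=> iX; have := @integrable_sum _ T R P setT measurableT I s xpredT _ (fun i _ => iX i).
by apply: eq_integrable => // w _ /=; rewrite sumEFin.
Qed.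

Lemma Rintegral_big_sum (I : Type) (s : seq I) (X : I -> T -> R) :
  (forall i, P.-integrable setT (EFin \o X i)) ->
  \int[P]_w (\sum_(i <- s) X i w) = \sum_(i <- s) \int[P]_w X i w.
Proof.
move=> iX; elim: s => [|i s IH].
  rewrite big_nil; under eq_Rintegral do rewrite big_nil.
  by rewrite Rintegral_cst // mul0r.
rewrite big_cons -IH; under eq_Rintegral do rewrite big_cons.
by rewrite RintegralD //; exact: integrable_big_sum.
Qed.

Notation Idx := ((nat * 'I_m) + (nat * 'I_m))%type.
Variable F : Idx -> set (set T).
Hypothesis Fm : forall s, F s `<=` measurable.
Hypothesis FT : forall s, F s setT.
Hypothesis FI : forall s, setI_closed (F s).
Hypothesis indF : mutually_independent P F.

Variables (L J : nat -> 'I_m -> T -> 'I_m) (V : nat -> 'I_m -> T -> R) (i0 : 'I_m).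
Hypothesis FL : forall n i k, F (inl (n, i)) [set w | L n i w = k].
Hypothesis FJ : forall n i k, F (inr (n, i)) [set w | J n i w = k].
Hypothesis FV : forall n i A, measurable A -> F (inl (n, i)) (V n i @^-1` A).

Variables (H Pj : bool -> 'M[R]_m) (f g : bool -> 'I_m -> R) (c C : R).
Hypothesis PL : forall n i k, P [set w | L n i w = k] = (H (odd n) i k)%:E.
Hypothesis PJ : forall n i k, P [set w | J n i w = k] = (Pj (odd n) i k)%:E.
Hypothesis V0 : forall n i w, 0 <= V n i w.
Hypothesis iV : forall n i, P.-integrable setT (EFin \o (fun w => V n i w ^+ 2)).
Hypothesis EV : forall n i, \int[P]_w V n i w = f (odd n) i.
Hypothesis EV2 : forall n i, \int[P]_w (V n i w ^+ 2) <= C.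
(** Poisson equation of the alternating chain: from a segment of parity [e] the starting phase moves
    by [H e] and then by the switching matrix of the other parity. *)
Hypothesis poisson : forall e i,
  f e i - c = g e i - \sum_k \sum_l H e i k * Pj (~~ e) k l * g (~~ e) l.

Fixpoint chain (n : nat) (w : T) : 'I_m :=
  if n is n'.+1 then J n'.+1 (L n' (chain n' w) w) w else i0.

(** Segment [n] starts right after the draw [J n]: the past contains the segments with index below
    [n] but the draws up to [n] included. The draw [n.+1] that closes segment [n] belongs to
    [during n]. *)
Let before n : pred Idx := fun s => match s with
  | inl (k, _) => (k < n)%N | inr (k, _) => (k <= n)%N end.
Let during n : pred Idx := fun s => match s with
  | inl (k, _) => k == n | inr (k, _) => k == n.+1 end.

Notation BT p := (g_sigma_algebraType (block F p)).

Let sub_BT (p : pred Idx) s A : p s -> F s A -> measurable (A : set (BT p)).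
Proof. by move=> ps FA; apply: sub_sigma_algebra; exact: (sub_block FT ps FA). Qed.

Let BT_measurable (p : pred Idx) (A : set T) : measurable (A : set (BT p)) -> measurable A.
Proof.
apply: smallest_sub; first exact: sigma_algebra_measurable.
exact: block_measurable.
Qed.

Let BT_fun (p : pred Idx) (X : T -> R) :
  measurable_fun (setT : set (BT p)) (X : BT p -> R) -> measurable_fun setT X.
Proof. by move=> mX _ A mA; apply: (@BT_measurable p); exact: mX. Qed.

Let BT_mono (p q : pred Idx) (A : set T) : (forall s, p s -> q s) ->
  measurable (A : set (BT p)) -> measurable (A : set (BT q)).
Proof. by move=> pq; apply: sub_sigma_algebra2; exact: block_mono. Qed.

Let before_mono n n' : (n <= n')%N -> forall s, before n s -> before n' s.
Proof. by move=> nn [[k i]|[k i]] /= kn; [exact: leq_trans nn|exact: leq_trans nn]. Qed.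

Let chain_before n i : measurable ([set w | chain n w = i] : set (BT (before n))).
Proof.
elim: n i => [|n IH] i /=.
  have [e|ne] := pselect (i0 = i).
    rewrite (_ : [set _ | _] = setT); first exact: (@measurableT _ (BT (before 0))).
    by apply/seteqP; split.
  rewrite (_ : [set _ | _] = set0); first exact: (@measurable0 _ (BT (before 0))).
  by apply/seteqP; split.
have nn := before_mono (leqnSn n).
rewrite (_ : [set _ | _] = \bigcup_(j in [set: 'I_m]) \bigcup_(k in [set: 'I_m])
   ([set w | chain n w = j] `&` ([set w | L n j w = k] `&` [set w | J n.+1 k w = i]))).
  apply: (@fin_bigcup_measurable _ (BT (before n.+1))) => // j _.
  apply: (@fin_bigcup_measurable _ (BT (before n.+1))) => // k _.
  apply: (@measurableI _ (BT (before n.+1))); first exact: (BT_mono nn).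
  apply: (@measurableI _ (BT (before n.+1))).
    by apply: (@sub_BT _ (inl (n, j))) => //=.
  by apply: (@sub_BT _ (inr (n.+1, k))) => //=.
apply/seteqP; split=> [w Jw|w [j _ [k _ [/= -> [-> //]]]]].
by exists (chain n w) => //; exists (L n (chain n w) w).
Qed.

(** Martingale difference of the Poisson equation: the centred value plus the change of [g] over the
    segment. With the starting phase [i] fixed, it depends on indices in [during n] only. *)
Let incr n i w : R := V n i w - c + g (~~ odd n) (J n.+1 (L n i w) w) - g (odd n) i.

Let incr_meas (p : pred Idx) n i : (forall s, during n s -> p s) ->
  measurable_fun (setT : set (BT p)) (incr n i : BT p -> R).
Proof.
move=> dp; apply: measurable_funB; last exact: measurable_cst.
apply: measurable_funD.
  apply: measurable_funB; last exact: measurable_cst.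
  move=> _ A mA; rewrite setTI; apply: (@sub_BT _ (inl (n, i))); last exact: FV.
  by apply: dp => /=.
apply: (@measurable_modulated _ (BT p) _ _ (fun w => L n i w)
   (fun k w => g (~~ odd n) (J n.+1 k w))) => k.
  by apply: (@sub_BT _ (inl (n, i))) => //; apply: dp => /=.
apply: (@measurable_modulated _ (BT p) _ _ (fun w => J n.+1 k w)
   (fun l _ => g (~~ odd n) l)) => l; last exact: measurable_cst.
by apply: (@sub_BT _ (inr (n.+1, k))) => //; apply: dp => /=.
Qed.

Let mincr n i : measurable_fun setT (incr n i).
Proof. by apply: (@BT_fun (during n)); exact: incr_meas. Qed.

Let mL n i k : measurable [set w | L n i w = k]. Proof. exact: Fm (FL n i k). Qed.
Let mJ n i k : measurable [set w | J n i w = k]. Proof. exact: Fm (FJ n i k). Qed.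
Let mV n i : measurable_fun setT (V n i).
Proof. by move=> _ A mA; rewrite setTI; exact: Fm (FV n i mA). Qed.

Let K := `|c| + \sum_i (`|g true i| + `|g false i|).

Let g_le e i : `|g e i| <= \sum_i (`|g true i| + `|g false i|).
Proof.
rewrite (bigD1 i) //=.
have : 0 <= \sum_(j < m | j != i) (`|g true j| + `|g false j|).
  by apply: sumr_ge0 => j _; rewrite addr_ge0.
have := normr_ge0 (g true i); have := normr_ge0 (g false i).
by case: e; lra.
Qed.

Let incr_sq n i w : incr n i w ^+ 2 <= 2 * V n i w ^+ 2 + 2 * (2 * K) ^+ 2.
Proof.
rewrite /incr; set a := V n i w; set x := g _ _; set y := g _ _.
set z := x - y - c; have -> : a - c + x - y = a + z by rewrite /z; ring.
have zK : `|z| <= 2 * K.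
  have := g_le (~~ odd n) (J n.+1 (L n i w) w); have := g_le (odd n) i.
  rewrite -/x -/y /K => yK xK; apply: (le_trans (ler_normB _ _)).
  have := ler_normB x y; have := normr_ge0 c; lra.
have : z ^+ 2 <= (2 * K) ^+ 2.
  by rewrite -[z ^+ 2]real_normK ?num_real // ler_pXn2r // nnegrE ?(le_trans (normr_ge0 z)).
have : 0 <= (a - z) ^+ 2 by exact: sqr_ge0.
clearbody z a; move: ((2 * K) ^+ 2) => K2; rewrite sqrrB sqrrD.
move: (a ^+ 2) (z ^+ 2) (a * z) => a2 z2 az; rewrite !mulr2n; lra.
Qed.

Local Notation sqint X := (P.-integrable setT (EFin \o (fun w => X w ^+ 2))).

Let sqint_le (X Y : T -> R) : measurable_fun setT X ->
  P.-integrable setT (EFin \o Y) -> (forall w, X w ^+ 2 <= Y w) -> sqint X.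
Proof.
move=> mX iY XY; apply: (le_integrable measurableT _ _ iY).
  by apply/measurable_EFinP; exact: measurable_funX.
move=> w _ /=; rewrite lee_fin ger0_norm ?sqr_ge0 //.
by apply: le_trans (XY w) _; exact: ler_norm.
Qed.

Let icst (x : R) : P.-integrable setT (EFin \o (fun=> x)).
Proof. exact: finite_measure_integrable_cst. Qed.

Let Ecst (x : R) : \int[P]_w x = x.
Proof.
rewrite Rintegral_cst // (_ : fine _ = 1) ?mulr1 //.
by rewrite -[RHS]/(fine 1%E) -(probability_setT P).
Qed.

Let iDom n i : P.-integrable setT
  (EFin \o (fun w => 2 * V n i w ^+ 2 + 2 * (2 * K) ^+ 2)).
Proof.
apply: eq_integrable (integrableD measurableT
  (integrableZl measurableT 2 (iV n i)) (icst (2 * (2 * K) ^+ 2))) => //.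
Qed.

Let iincr2 n i : sqint (incr n i).
Proof. by apply: (sqint_le (mincr n i) (iDom n i)); exact: incr_sq. Qed.

Let sqint_integrable (X : T -> R) : measurable_fun setT X -> sqint X ->
  P.-integrable setT (EFin \o X).
Proof.
move=> mX iX.
have i1 : sqint (fun _ : T => 1 : R) by under [X in EFin \o X]eq_fun do rewrite expr1n; exact: icst.
have m1 : measurable_fun setT (fun _ : T => 1 : R) by exact: measurable_cst.
have := integrable_mul_sq mX m1 iX i1.
by apply: eq_integrable => // w _ /=; rewrite mulr1.
Qed.

(** Splitting over the final phase and the next drawn phase, which are independent, gives the mean
    of the [g] term; the Poisson equation cancels the rest. *)
Let Eincr n i : \int[P]_w incr n i w = 0.
Proof.
have iVn : P.-integrable setT (EFin \o V n i) by exact: sqint_integrable.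
pose X w := g (~~ odd n) (J n.+1 (L n i w) w).
have XE w : X w = \sum_k \sum_l g (~~ odd n) l *
   \1_([set w | L n i w = k] `&` [set w | J n.+1 k w = l]) w.
  rewrite (bigD1 (L n i w)) //= (bigD1 (J n.+1 (L n i w) w)) //=.
  rewrite indicE mem_set // mulr1 !big1 ?addr0 // => [k kL|l lJ].
    rewrite big1 // => l _; rewrite indicE memNset ?mulr0 // => -[/= e _].
    by rewrite e eqxx in kL.
  rewrite indicE memNset ?mulr0 // => -[_ /= e].
  by rewrite e eqxx in lJ.
have mI k l : measurable ([set w | L n i w = k] `&` [set w | J n.+1 k w = l]).
  exact: measurableI.
have iI k l : P.-integrable setT (EFin \o (fun w => g (~~ odd n) l *
    \1_([set w | L n i w = k] `&` [set w | J n.+1 k w = l]) w)).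
  exact: (integrableZl measurableT (g (~~ odd n) l) (integrable_indic P (mI k l))).
have iIs k : P.-integrable setT (EFin \o (fun w => \sum_l g (~~ odd n) l *
    \1_([set w | L n i w = k] `&` [set w | J n.+1 k w = l]) w)).
  by apply: integrable_big_sum => l; exact: iI.
have iX : P.-integrable setT (EFin \o X).
  have := integrable_big_sum (index_enum 'I_m) iIs.
  by apply: eq_integrable => // w _ /=; rewrite XE.
have EX : \int[P]_w X w = \sum_k \sum_l H (odd n) i k * Pj (~~ odd n) k l * g (~~ odd n) l.
  under eq_Rintegral do rewrite XE.
  rewrite Rintegral_big_sum //; apply: eq_bigr => k _.
  rewrite Rintegral_big_sum //; apply: eq_bigr => l _.
  rewrite RintegralZl //; last exact: integrable_indic.
  have E1 : P ([set w | L n i w = k] `&` [set w | J n.+1 k w = l]) =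
      (P [set w | L n i w = k] * P [set w | J n.+1 k w = l])%E.
    have := indF (S := [:: inl (n, i); inr (n.+1, k)])
      (E := fun s => if s is inl _ then [set w | L n i w = k] else [set w | J n.+1 k w = l]).
    rewrite !big_cons !big_nil setIT mule1; apply=> //.
    by move=> s; rewrite !inE => /orP[] /eqP ->; [exact: FL|exact: FJ].
  rewrite mulrC; congr (_ * _); rewrite /Rintegral integral_indic // setIT.
  by transitivity (fine (P ([set w | L n i w = k] `&` [set w | J n.+1 k w = l])));
    rewrite // E1 PL PJ.
rewrite /incr RintegralB //; last first.
  exact: (integrableD measurableT (integrableB measurableT iVn (icst c)) iX).
rewrite RintegralD //; last exact: (integrableB measurableT iVn (icst c)).
rewrite (RintegralB measurableT iVn (icst c)).
rewrite !Ecst EV EX.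
by have := poisson (odd n) i; lra.
Qed.

Let D n w : R := incr n (chain n w) w.

Let D_before n n' : (n < n')%N ->
  measurable_fun (setT : set (BT (before n'))) (D n : BT (before n') -> R).
Proof.
move=> nn; apply: (@measurable_modulated _ (BT (before n')) _ _ (chain n) (incr n)) => i.
  by apply: (BT_mono (before_mono (ltnW nn))); exact: chain_before.
by apply: incr_meas => -[[k j]|[k j]] /= /eqP ->.
Qed.

Let mD n : measurable_fun setT (D n).
Proof. by apply: (@BT_fun (before n.+1)); exact: D_before. Qed.

Let iD n : sqint (D n).
Proof.
apply: (@sqint_le _ (fun w => \sum_i incr n i w ^+ 2)) => //.
  by apply: integrable_big_sum => i; exact: iincr2.
move=> w; rewrite /D (bigD1 (chain n w)) //= lerDl sumr_ge0 // => i _.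
exact: sqr_ge0.
Qed.

(** The random starting phase is dominated by the sum over all phases, hence the sum over [i < m] in
    the bound. *)
Let D2_le n : \int[P]_w (D n w ^+ 2) <= \sum_(i < m) (2 * C + 2 * (2 * K) ^+ 2).
Proof.
apply: (@le_trans _ _ (\int[P]_w \sum_i incr n i w ^+ 2)).
  apply: le_Rintegral => //.
    by apply: integrable_big_sum => i; exact: iincr2.
  move=> w _; rewrite /D (bigD1 (chain n w)) //= lerDl sumr_ge0 // => i _.
  exact: sqr_ge0.
rewrite Rintegral_big_sum //; apply: ler_sum => i _.
apply: (@le_trans _ _ (\int[P]_w (2 * V n i w ^+ 2 + 2 * (2 * K) ^+ 2))).
  by apply: le_Rintegral => // w _; exact: incr_sq.
rewrite RintegralD //; last exact: (integrableZl measurableT 2 (iV n i)).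
rewrite RintegralZl // Ecst.
by rewrite lerD2r ler_wpM2l.
Qed.

Let S n w := \sum_(k < n) D k w.

Let S_before n : measurable_fun (setT : set (BT (before n))) (S n : BT (before n) -> R).
Proof. by apply: measurable_sum => k; exact: D_before. Qed.

Let mS n : measurable_fun setT (S n).
Proof. by apply: measurable_sum => k; exact: mD. Qed.

Let iS n : sqint (S n).
Proof.
elim: n => [|n IH].
  by rewrite /S; under [X in EFin \o X]eq_fun do rewrite big_ord0 expr0n; exact: icst.
have -> : S n.+1 = fun w => S n w + D n w.
  by apply/funext => w; rewrite /S big_ord_recr.
by apply: sqintD => //; exact: mS.
Qed.

(** Split over the value [i] of [chain n]: the partial sum restricted to this event depends on
    [before n], the centred variable [incr n i] on [during n], and the two blocks are
    independent. *)
Let orthD n : \int[P]_w (S n w * D n w) = 0.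
Proof.
pose X i w : R := S n w * (chain n w == i)%:R.
have X_before i : measurable_fun (setT : set (BT (before n))) (X i : BT (before n) -> R).
  apply: measurable_funM; first exact: S_before.
  refine (@measurable_modulated _ (BT (before n)) _ _ (chain n) (fun j _ => (j == i)%:R : R) _ _) => j.
    exact: chain_before.
  exact: measurable_cst.
have mX i : measurable_fun setT (X i) by exact: (@BT_fun (before n) (X i) (X_before i)).
have iX i : sqint (X i).
  apply: (sqint_le (mX i) (iS n)) => w; rewrite /X exprMn.
  by rewrite ler_piMr ?sqr_ge0 //; case: (_ == _); rewrite ?expr1n ?expr0n.
have iXd i : P.-integrable setT (EFin \o (fun w => X i w * incr n i w)).
  exact: integrable_mul_sq.
have -> : (fun w => S n w * D n w) = (fun w => \sum_i X i w * incr n i w).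
  apply/funext => w; rewrite /D (bigD1 (chain n w)) //= /X eqxx mulr1.
  rewrite big1 ?addr0 // => i ic.
  by rewrite eq_sym (negbTE ic) mulr0 mul0r.
rewrite Rintegral_big_sum // big1 // => i _.
rewrite Rintegral_mul_indep //; first by rewrite Eincr mulr0.
- exact: sqint_integrable.
- exact: sqint_integrable.
move=> A B mA mB; apply: (block_indep Fm FT FI indF (p := before n) (q := during n)).
- by move=> [[k j]|[k j]] /=; [move=> kn; rewrite ltn_eqF|rewrite -ltnS => kn; rewrite ltn_eqF].
- by have := X_before i measurableT A mA; rewrite setTI.
- have /(_ (during n) n i (fun _ => id)) := incr_meas.
  by move=> /(_ measurableT B mB); rewrite setTI.
Qed.

Lemma modulated_lln : {ae P, forall w,
  (\sum_(k < n) V k (chain k w) w) / n%:R @[n --> \oo] --> c}.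
Proof.
have := lln_squares mD iD D2_le orthD; apply: filterS => w cS.
apply: (@cvg_div_of_squares R (fun k => V k (chain k w) w)) => [k|]; first exact: V0.
(* The changes of [g] telescope, so the orthogonal sum differs from the centred sum by a bounded
   boundary term. *)
have SE n : S n w = \sum_(k < n) V k (chain k w) w - n%:R * c +
    (g (odd n) (chain n w) - g false i0).
  elim: n => [|n IH]; first by rewrite /S !big_ord0 /=; ring.
  rewrite /S big_ord_recr -/(S n w) /= IH big_ord_recr -natr1 /D /incr /=; ring.
have b0 : (g (odd (n.+1 ^ 2)) (chain (n.+1 ^ 2) w) - g false i0) / (n.+1 ^ 2)%:R
    @[n --> \oo] --> 0.
  have K0 : 0 <= 2 * K by rewrite mulr_ge0 // addr_ge0 // sumr_ge0 // => j _; rewrite addr_ge0.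
  have h : 2 * K * n.+1%:R^-1 @[n --> \oo] --> 0.
    rewrite -[X in _ --> X](mulr0 (2 * K)); apply: cvgM; first exact: cvg_cst.
    exact: cvg_harmonic.
  have hN : - (2 * K * n.+1%:R^-1) @[n --> \oo] --> 0.
    by rewrite -[X in _ --> X]oppr0; exact: cvgN.
  apply: squeeze_cvgr hN h; apply: nearW => n; rewrite -ler_norml normrM.
  rewrite [X in _ * X]ger0_norm ?invr_ge0 //; apply: ler_pM => //.
    apply: le_trans (ler_normB _ _) _; rewrite mulr_natl mulr2n lerD //.
      by rewrite (le_trans (g_le _ _)) // lerDr.
    by rewrite (le_trans (g_le _ _)) // lerDr.
  by rewrite lef_pV2 ?posrE ?ltr0n ?expn_gt0 // ler_nat leq_pmulr.
have cc : c + (S (n.+1 ^ 2) w / (n.+1 ^ 2)%:R -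
    (g (odd (n.+1 ^ 2)) (chain (n.+1 ^ 2) w) - g false i0) / (n.+1 ^ 2)%:R)
    @[n --> \oo] --> c.
  rewrite -[X in _ --> X]addr0; apply: cvgD; first exact: cvg_cst.
  by rewrite -[X in _ --> X]subr0; exact: cvgB.
apply: cvg_trans cc; apply: near_eq_cvg; apply: nearW => n /=.
rewrite SE; move: (g (odd _) _ - _) => y; have : (n.+1 ^ 2)%:R != 0 :> R.
  by rewrite pnatr_eq0 expn_eq0.
by move: (_ ^ 2)%N => q q0; field.
Qed.

End ModulatedSums.

(** * Occupation times of concatenated segments *)

Section Concatenation.
Context {R : realType}.
Local Notation leb := (@lebesgue_measure R).

Lemma measurable_shift (a : R) (B : set R) : measurable B ->
  measurable ((fun t => t - a) @^-1` B).
Proof.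
move=> mB; rewrite -[X in measurable X]setTI.
by apply: measurable_funB => //; exact: measurable_cst.
Qed.

Lemma lebesgue_shift (a : R) (B : set R) : measurable B ->
  leb ((fun t => t - a) @^-1` B) = leb B.
Proof.
move=> mB.
have mf : measurable_fun (setT : set (measurableTypeR R))
    ((fun t => t - a) : measurableTypeR R -> measurableTypeR R).
  by apply: measurable_funB => //; exact: measurable_cst.
pose mx := isMeasurableFun.Build _ _ _ _ _ mf.
pose f : {mfun measurableTypeR R >-> measurableTypeR R} :=
  HB.pack ((fun t => t - a) : measurableTypeR R -> measurableTypeR R) mx.
apply/esym; apply: (@lebesgue_measure_unique R (pushforward leb f)) => //.
move=> _ [[c e]] _ <-; rewrite /= /pushforward.
have -> : +%R^~ (- a) @^-1` `]c, e]%classic = `]c + a, e + a]%classic.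
  by apply/seteqP; split=> t /=; rewrite !in_itv /= ltrBrDr lerBlDr.
rewrite !lebesgue_measure_itv /= !lte_fin ltrD2r; case: ifP => // _.
by rewrite -!EFinB; congr EFin; ring.
Qed.

Definition occupation (g : R -> bool) (x : R) : R :=
  fine (\int[leb]_(t in [set t : R | (0 <= t <= x)%R]) (if g t then 1%R else 0%R)%:E)%E.

Lemma occupation_ge0 g x : 0 <= occupation g x.
Proof. by rewrite fine_ge0 // integral_ge0 // => t _; rewrite lee_fin; case: ifP. Qed.

Section Cells.
Variables (th ta : nat -> R) (S : nat -> set R) (g : R -> bool).
Hypothesis th0 : th 0%N = 0.
Hypothesis thS : forall n, th n.+1 = th n + ta n.
Hypothesis ta0 : forall n, 0 < ta n.
Hypothesis mS : forall n, measurable (S n).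
Hypothesis S_sub : forall n s, S n s -> 0 <= s < ta n.
Hypothesis gS : forall n t, th n <= t < th n.+1 -> g t <-> S n (t - th n).
Hypothesis th_unbounded : forall x, exists n, x < th n.

Let A : set R := [set t | 0 <= t /\ g t].

Let th_lt n : th n < th n.+1. Proof. by rewrite thS ltrDl. Qed.

Lemma th_ge0 n : 0 <= th n.
Proof. by elim: n => [|n IH]; rewrite ?th0 // (le_trans IH) // ltW. Qed.

Let cell t : 0 <= t -> exists n, th n <= t < th n.+1.
Proof.
move=> t0; have [n tn] := th_unbounded t.
have ex : exists n, t < th n by exists n.
case: (ex_minnP ex) => -[|l] tl lmin; first by rewrite th0 ltNge t0 in tl.
by exists l; rewrite tl andbT leNgt; apply/negP => /lmin; rewrite ltnn.
Qed.

(** The measurability of the occupied set is inherited from the segments through this decomposition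
    into translated cells. *)
Let AE : A = \bigcup_n (fun t => t - th n) @^-1` S n.
Proof.
apply/seteqP; split=> [t [t0 gt]|t [n _ Sn]].
  by have [n nt] := cell t0; exists n => //; apply/(gS nt).
have /andP[a1 a2] := S_sub Sn.
split; first by rewrite (le_trans (th_ge0 n)) // -subr_ge0.
by apply/(gS (n := n)) => //; rewrite -subr_ge0 a1 thS -ltrBlDl.
Qed.

Let mA : measurable A.
Proof. by rewrite AE; apply: bigcupT_measurable => n; exact: measurable_shift. Qed.

Let upto x : set R := A `&` [set t | t <= x].

Let mupto x : measurable (upto x).
Proof.
apply: measurableI => //; rewrite (_ : [set t | _] = `]-oo, x]%classic).
  exact: measurable_itv.
by apply/seteqP; split=> t /=; rewrite in_itv.
Qed.

Let leb_upto x : (leb (upto x) < +oo)%E.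
Proof.
apply: (@le_lt_trans _ _ (leb `[0, x]%classic)).
  apply: le_measure; rewrite ?inE //; first exact: mupto.
  by move=> t [[t0 _] tx] /=; rewrite in_itv /= t0.
by rewrite lebesgue_measure_itv /=; case: ifP => // _; rewrite ltry.
Qed.

Let occupationE x : occupation g x = fine (leb (upto x)).
Proof.
rewrite /occupation integral_mkcond; congr fine.
transitivity (\int[leb]_s (\1_(upto x) s)%:E)%E.
  apply: eq_integral => s _; rewrite patchE indicE; case: ifPn => [|sn].
    rewrite inE => /andP[s0 sx]; case: ifPn => [gs|ngs]; first by rewrite mem_set.
    by rewrite memNset // => -[[_ gs] _]; rewrite gs in ngs.
  rewrite memNset // => -[[s0 _] sx]; move: sn; rewrite mem_set //=.
  by rewrite s0.
by rewrite integral_indic ?setIT //; exact: mupto.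
Qed.

Lemma occupation_le x y : x <= y -> occupation g x <= occupation g y.
Proof.
move=> xy; rewrite !occupationE fine_le ?ge0_fin_numE //.
apply: le_measure; rewrite ?inE; [exact: mupto|exact: mupto|].
by move=> t [At tx]; split=> //; exact: le_trans xy.
Qed.

(** Cells are half-open and disjoint, and Lebesgue measure is translation invariant; the closed end
    [th n] adds a null set. *)
Lemma occupation_th n : occupation g (th n) = \sum_(k < n) fine (leb (S k)).
Proof.
pose B n := A `&` [set t | t < th n].
have mB k : measurable (B k).
  apply: measurableI => //; rewrite (_ : [set t | _] = `]-oo, th k[%classic).
    exact: measurable_itv.
  by apply/seteqP; split=> t /=; rewrite in_itv.
have BS k : B k.+1 = B k `|` (fun t => t - th k) @^-1` S k.
  apply/seteqP; split=> t.
    move=> [At tk]; have [tk'|tk'] := ltP t (th k); first by left.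
    by right; case: At => _ gt; apply/gS => //; rewrite tk'.
  case=> [[At tk]|Sk]; first by split=> //=; exact: lt_trans tk (th_lt k).
  have /andP[a1 a2] := S_sub Sk.
  split; first by rewrite AE; exists k.
  by rewrite /= thS -ltrBlDl.
have Sfin k : leb (S k) \is a fin_num.
  rewrite ge0_fin_numE //; apply: (@le_lt_trans _ _ (leb `[0, ta k]%classic)).
    apply: le_measure; rewrite ?inE //; first exact: mS.
    by move=> t /S_sub /andP[t0 /ltW tk] /=; rewrite in_itv /= t0.
  by rewrite lebesgue_measure_itv /=; case: ifP => // _; rewrite ltry.
have BE k : leb (B k) = (\sum_(l < k) fine (leb (S l)))%:E.
  elim: k => [|k IH].
    rewrite big_ord0 (_ : B 0%N = set0) ?measure0 //.
    by apply/seteqP; split=> // t [[t0 _]] /=; rewrite th0 ltNge t0.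
  rewrite BS; transitivity (leb (B k) + leb ((fun t => (t - th k)%R) @^-1` S k))%E.
    apply: measureU; [exact: mB|exact: measurable_shift|].
    apply/seteqP; split=> // t [[_ /= tk] /S_sub /andP[a1 _]].
    by move: tk; rewrite ltNge -subr_ge0 a1.
  by rewrite lebesgue_shift // IH big_ord_recr EFinD fineK.
rewrite occupationE -[RHS]/(fine (\sum_(k < n) fine (leb (S k)))%:E) -BE.
congr fine; apply/eqP; rewrite eq_le; apply/andP; split; last first.
  apply: le_measure; rewrite ?inE; [exact: mB|exact: mupto|].
  by move=> t [At /= /ltW tn].
apply: (@le_trans _ _ (leb (B n `|` [set th n]))).
  apply: le_measure; rewrite ?inE; [exact: mupto|by apply: measurableU => //; exact: mB|].
  move=> t [At /=]; rewrite le_eqVlt => /predU1P[->|tn]; [by right|by left].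
apply: (@le_trans _ _ (leb (B n) + leb [set th n])%E); first (apply: measureU2; [exact: mB|exact: measurable_set1]).
by rewrite lebesgue_measure_set1 adde0.
Qed.

End Cells.

Lemma ratio_unbounded (th : nat -> R) (cT : R) : 0 < cT ->
  th n / n%:R @[n --> \oo] --> cT -> forall y, exists n, y < th n.
Proof.
move=> cT0 thc y; have e0 : 0 < cT / 2 by rewrite divr_gt0.
have /cvgrPdist_lt /(_ _ e0)[n0 _ Hn] := thc.
have [n1 Hn1] : exists n1 : nat, `|y| < n1%:R * (cT / 2).
  exists (Num.trunc (`|y| / (cT / 2))).+1; rewrite -ltr_pdivrMr //.
  by have /andP[] := truncn_itv (divr_ge0 (normr_ge0 y) (ltW e0)).
pose n := (maxn n0 n1).+1; exists n.
have n0n : (n0 <= n)%N by rewrite leqW // leq_maxl.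
have np : 0 < n%:R :> R by rewrite ltr0n.
have := Hn n n0n; rewrite /= ltr_distlC => /andP[+ _].
have -> : cT - cT / 2 = cT / 2 by field.
rewrite ltr_pdivlMr // mulrC => lt.
apply: (le_lt_trans (ler_norm y)); apply: (lt_trans Hn1); apply: le_lt_trans lt.
by rewrite ler_pM2r // ler_nat leqW // leq_maxr.
Qed.

Lemma occupation_cvg (th ta : nat -> R) (S : nat -> set R) (g : R -> bool) (cV cT : R) :
  th 0%N = 0 -> (forall n, th n.+1 = th n + ta n) -> (forall n, 0 < ta n) ->
  (forall n, measurable (S n)) -> (forall n s, S n s -> 0 <= s < ta n) ->
  (forall n t, th n <= t < th n.+1 -> g t <-> S n (t - th n)) ->
  0 < cT -> th n / n%:R @[n --> \oo] --> cT ->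
  (\sum_(k < n) fine (leb (S k))) / n%:R @[n --> \oo] --> cV ->
  occupation g t / t @[t --> +oo] --> cV / cT.
Proof.
move=> th0 thS ta0 mS S_sub gS cT0 thc Sc; have unb := ratio_unbounded cT0 thc.
apply: (@cvg_renewal R _ th) => //.
- by move=> t _; exact: occupation_ge0.
- by move=> s t /andP[_]; exact: (occupation_le th0 thS ta0 mS S_sub gS unb).
- by move=> n; exact: (th_ge0 th0 thS ta0).
- apply: cvg_trans Sc; apply: near_eq_cvg; apply: nearW => n.
  by rewrite (occupation_th th0 thS ta0 mS S_sub gS unb).
Qed.

End Concatenation.

(** * The flexible process *)

Section PathFunctionalLaws.
Context {R : realType} {m : nat}.

Lemma tauF_ge0 (mu sigma : 'I_m -> R) k W c : (0 <= tauF mu sigma k W c)%E.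
Proof. by apply: le_ereal_inf_tmp => _ [[N j] /= _ <-]; rewrite lee_fin dyad_ge0. Qed.

(** The occupation time as a function of the two paths alone, detached from a sample space, so that
    it can be compared across segments and on path space. *)
Definition occG (mu sigma : 'I_m -> R) (lo hi c : R) j (k : R -> 'I_m) (W : R -> R) : \bar R :=
  lebesgue_measure [set t : R | [/\ 0 <= t, (t%:E < tauF mu sigma k W c)%E,
    (lo%:E <= gapF mu sigma k W t <= hi%:E)%E & phaseF k t j]].

Lemma occFE d (T : measurableType d) (mu sigma : 'I_m -> R) (kap : R -> T -> 'I_m) W
    lo hi c j w :
  occF mu sigma kap W lo hi c j w = occG mu sigma lo hi c j (kap ^~ w) (W ^~ w).
Proof. by rewrite /occF /occG; congr lebesgue_measure; apply/seteqP; split=> t; rewrite xsectionE. Qed.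

(** The quantification over all spaces covers three uses: the sample space, the canonical path
    space, and the sample space with the sigma-algebra of a single segment, needed for
    independence. *)
Definition measurable_on_paths (F : (R -> 'I_m) -> (R -> R) -> \bar R) : Prop :=
  forall d (T : measurableType d) (kap : R -> T -> 'I_m) (W : R -> T -> R),
  (forall t, dyadic t -> forall k, measurable [set w | kap t w = k]) ->
  (forall t, dyadic t -> measurable_fun setT (W t)) ->
  measurable_fun setT (fun w => F (kap ^~ w) (W ^~ w)).

Lemma measurable_tau_paths (mu sigma : 'I_m -> R) c :
  measurable_on_paths (fun k W => tauF mu sigma k W c).
Proof. by move=> d T kap W mk mw; exact: measurable_tauF. Qed.

Lemma measurable_occ_paths (mu sigma : 'I_m -> R) lo hi c j :
  measurable_on_paths (occG mu sigma lo hi c j).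
Proof.
move=> d T kap W mk mw; have := measurable_occF mu sigma mk mw lo hi c j.
by congr (measurable_fun _ _); apply/funext => w; rewrite occFE.
Qed.

End PathFunctionalLaws.

Section FlexibleProcess.
Context (R : realType) (m : nat) (d : measure_display)
  (T : measurableType d) (P : probability T R) (Q : 'M[R]_m)
  (mu sigma : 'I_m -> R) (b : R) (Pc Pb : 'M[R]_m) (i0 : 'I_m)
  (kap : nat -> 'I_m -> R -> T -> 'I_m) (W : nat -> 'I_m -> R -> T -> R)
  (Z : nat -> 'I_m -> R -> T -> R) (J : nat -> 'I_m -> T -> 'I_m)
  (theta : nat -> T -> \bar R) (phi : nat -> T -> 'I_m)
  (Y : R -> T -> R) (rho : R -> T -> 'I_m).
Hypothesis sg0 : forall i, 0 < sigma i.
Hypothesis b0 : 0 < b.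
Hypothesis HF : flexible_MMBM P Q mu sigma b Pc Pb i0 kap W Z J theta phi Y rho.

(* Odd segments, started at [b], are reflected to start at [0]. *)
Let dr (e : bool) (k : 'I_m) : R := if e then - mu k else mu k.
Let vo (e : bool) (k : 'I_m) : R := if e then - sigma k else sigma k.
Let Zf n i t w : R := if odd n then b - Z n i t w else Z n i t w.

Let kap0 n i w : kap n i 0 w = i. Proof. by have [/(_ n i w)[]] := HF. Qed.
Let W0 n i w : W n i 0 w = 0. Proof. by have [/(_ n i w)[_ []]] := HF. Qed.
Let step n i w : step_path (kap n i ^~ w).
Proof. by have [/(_ n i w)[_ [_ []]]] := HF. Qed.
Let cW n i w : cont0 (W n i ^~ w).
Proof. by have [/(_ n i w)[_ [_ [_ []]]] /within_cont0] := HF. Qed.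
Let mkap n i t k : measurable [set w | kap n i t w = k].
Proof. by have [_ [H _]] := HF; exact: H. Qed.
Let mW n i t : measurable_fun setT (W n i t).
Proof. by have [_ [_ [H _]]] := HF; exact: H. Qed.
Let mJ n i k : measurable [set w | J n i w = k].
Proof. by have [_ [_ [_ [H _]]]] := HF; exact: H. Qed.
Let fdd n i : MC_BM_fdd P Q i (kap n i) (W n i).
Proof. by have [_ [_ [_ [_ [H _]]]]] := HF; exact: H. Qed.
Let PJ n i k : P [set w | J n i w = k] = ((if odd n then Pb else Pc) i k)%:E.
Proof. by have [_ [_ [_ [_ [_ [H _]]]]]] := HF; rewrite H; case: odd. Qed.

Let path n i w : exists X, drawup_path b X (Zf n i ^~ w) /\
  (forall s t, 0 <= s <= t -> (forall u, s <= u < t -> kap n i u w = kap n i s w) ->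
    X t - X s = dr (odd n) (kap n i s w) * (t - s) +
      vo (odd n) (kap n i s w) * (W n i t w - W n i s w)).
Proof.
have [/(_ n i w)[_ [_ [_ [_ H]]]] _] := HF; move: H; rewrite /seg_start /Zf /dr /vo.
case: (odd n) => [/regulated_flip|] /(regulated_drawup b0)[X [XZ inc]];
  by exists X; split.
Qed.

(** [s] exceeds in modulus the increment required in each phase. Even segments take the unit
    interval above [s]; reflected ones, with negative [vo], take the one below [- s]. *)
Let push e eta : 0 < eta -> exists a, forall k x, a < x <= a + 1 ->
  b <= dr e k * eta + vo e k * x.
Proof.
move=> eta0; pose r k := `|(b - dr e k * eta) / sigma k|.
pose s := \sum_k r k.
have rs k : (b - dr e k * eta) <= sigma k * s.
  have rk : r k <= s.
    by rewrite /s (bigD1 k) //= lerDl sumr_ge0 // => j _; exact: normr_ge0.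
  rewrite [leRHS]mulrC -ler_pdivrMr //; exact: (le_trans (ler_norm _) rk).
case: e @r @s rs => r s rs.
  exists (- s - 1) => k x /andP[_ xs]; have := rs k; rewrite /vo.
  have : sigma k * s <= - sigma k * x.
    by rewrite mulNr -mulrN ler_pM2l //; move: xs; lra.
  by lra.
exists s => k x /andP[sx _]; have := rs k; rewrite /vo.
have : sigma k * s <= sigma k * x by rewrite ler_pM2l // ltW.
by lra.
Qed.

(** The representative, 0 or 1, of the segments with the parity of [n]; the theorem defines its
    matrices on these two. *)
Let par (n : nat) : nat := odd n.
Let par_odd n : odd (par n) = odd n. Proof. exact: oddb. Qed.

Notation tau n i w := (tauF (dr (odd n)) (vo (odd n)) (kap n i ^~ w) (W n i ^~ w) b).
Notation last n i w := (lastP (dr (odd n)) (vo (odd n)) b i (kap n i ^~ w) (W n i ^~ w)).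

Lemma hit_target n i w : hit (Z n i ^~ w) (seg_target b n) = tau n i w.
Proof.
rewrite (tau_hit b0 (step n i) (cW n i) (path n i)) /hit /seg_target /Zf.
case: (odd n) => //; congr ereal_inf; apply/seteqP; split=> _ [t [t0 Zt] <-];
  exists t => //; split=> //.
  by rewrite Zt subr0.
by move: Zt; lra.
Qed.

Let Fam (x : (nat * 'I_m) + (nat * 'I_m)) : set (set T) := match x with
  | inl (n, i) => <<s cyl_class (kap n i) (W n i) >>
  | inr (n, i) => [set J n i @^-1` A | A in [set: set 'I_m]]
  end.

Let indF : mutually_independent P Fam.
Proof. by have [_ [_ [_ [_ [_ [_ [H _]]]]]]] := HF. Qed.

Let cyl_mkap n i t : dyadic t -> forall k,
  measurable ([set w | kap n i t w = k] : set (g_sigma_algebraType (cyl_class (kap n i) (W n i)))).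
Proof.
move=> dt k; apply: (coord_sub_cyl (kap0 n i) (W0 n i)); exists t => //.
by left; exists k.
Qed.

Let cyl_mW n i t : dyadic t ->
  measurable_fun (setT : set (g_sigma_algebraType (cyl_class (kap n i) (W n i))))
    (W n i t : g_sigma_algebraType (cyl_class (kap n i) (W n i)) -> R).
Proof.
move=> dt _ A mA; rewrite setTI; apply: (coord_sub_cyl (kap0 n i) (W0 n i)).
by exists t => //; right; exists A.
Qed.

Let Fm s : Fam s `<=` measurable.
Proof.
case: s => [[n i]|[n i]] /=.
  apply: smallest_sub; first exact: sigma_algebra_measurable.
  move=> _ [L [t [k [A [tg [mA ->]]]]]].
  apply: (@cyl_measurable R m _ T (kap n i) (W n i)) => //.
move=> _ [A _ <-].
rewrite (_ : _ @^-1` A = \bigcup_(k in A) [set w | J n i w = k]).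
  by apply: fin_bigcup_measurable => // k _; exact: mJ.
by apply/seteqP; split=> [w Aw|w [k Ak /= e]]; [exists (J n i w)|rewrite /= e].
Qed.

Let FT s : Fam s setT.
Proof.
case: s => [[n i]|[n i]] /=; last by exists setT.
exact: (@measurableT _ (g_sigma_algebraType (cyl_class (kap n i) (W n i)))).
Qed.

Let FI s : setI_closed (Fam s).
Proof.
case: s => [[n i]|[n i]] /= A B.
  exact: (@measurableI _ (g_sigma_algebraType (cyl_class (kap n i) (W n i)))).
by move=> [A' _ <-] [B' _ <-]; exists (A' `&` B').
Qed.

Let FJ n i k : Fam (inr (n, i)) [set w | J n i w = k].
Proof. by exists [set k]. Qed.

Let FL n i k : Fam (inl (n, i)) [set w | last n i w = k].
Proof.
exact: (@measurable_lastP R m _ (g_sigma_algebraType (cyl_class (kap n i) (W n i)))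
  (dr (odd n)) (vo (odd n)) (kap n i) (W n i) (@cyl_mkap n i) (@cyl_mW n i) b i k).
Qed.

Let mlast n i k : measurable [set w | last n i w = k].
Proof. exact: (@Fm (inl (n, i)) _ (@FL n i k)). Qed.

Let Hm (e : bool) : 'M[R]_m := \matrix_(i, k) fine (P [set w | last (e : nat) i w = k]).

Let PL n i k : P [set w | last n i w = k] = (Hm (odd n) i k)%:E.
Proof.
rewrite mxE fineK; last exact: fin_num_measure.
rewrite oddb; apply: (same_prob (kap0 n i) (W0 n i) (mkap n i) (mW n i) (fdd n i)
  (kap0 (par n) i) (W0 (par n) i) (mkap (par n) i) (mW (par n) i) (fdd (par n) i)
  (E := fun k' W' => lastP (dr (odd n)) (vo (odd n)) b i k' W' = k)).
exact: (measurable_lastP _ _ (@measurable_kapS R m i) (@measurable_WS R m i)).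
Qed.

Lemma HmE e : Hm e = Hmat P (kap e) (Z e) (seg_target b e).
Proof.
apply/matrixP => i k; rewrite !mxE; congr fine.
rewrite -(hit_phase_prob b0 (kap0 e i) (W0 e i) (mkap e i) (mW e i) (fdd e i)
  (step e i) (cW e i) (path e i) (@push (odd e)) k).
congr (P _); apply/seteqP; split=> w /= [dl [h kk]]; exists dl; split=> //.
  by rewrite hit_target (tau_hit b0 (step e i) (cW e i) (path e i)).
by rewrite -(tau_hit b0 (step e i) (cW e i) (path e i)) -hit_target.
Qed.

(** [lastP] always has a value, its default included, so the rows sum to 1. *)
Lemma Hm_stochastic e : stochastic (Hm e).
Proof.
split=> [i k|i]; first by rewrite mxE fine_ge0.
under eq_bigr do rewrite mxE.
exact: (sum_last_prob P _ _ b i (mkap e i) (mW e i)).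
Qed.

Let tau_fin n i : {ae P, forall w, (tau n i w < +oo)%E}.
Proof.
exact: (tau_finite b0 (kap0 n i) (W0 n i) (mkap n i) (mW n i) (fdd n i)
  (step n i) (cW n i) (path n i) (@push (odd n))).
Qed.

Lemma all_tau_finite : {ae P, forall w, forall n i, (tau n i w < +oo)%E}.
Proof.
(* Phases are written as natural numbers with a bound, to use closure of almost sure statements
   under quantification over [nat]. *)
have H : {ae P, forall w, forall n k (km : (k < m)%N), (tau n (Ordinal km) w < +oo)%E}.
  apply: ae_foralln => n; apply: ae_foralln => k.
  have [km|km] := pselect (k < m)%N.
    apply: filterS (tau_fin n (Ordinal km)) => w tw km'.
    by rewrite (bool_irrelevance km' km).
  by apply: filterE => w km'.
apply: filterS H => w H n [k km]; exact: H.
Qed.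

Notation Pj := (fun e : bool => if e then Pb else Pc).
Notation start n w := (chain (fun n i w => last n i w) J i0 n w).

(** * Averages of a functional bounded by the duration *)

Section SegmentSums.
Variable U : bool -> (R -> 'I_m) -> (R -> R) -> \bar R.
Hypothesis U0 : forall e k w, (0 <= U e k w)%E.
Hypothesis mU : forall e, measurable_on_paths (U e).
Hypothesis U_tau : forall n i w, (U (odd n) (kap n i ^~ w) (W n i ^~ w) <= tau n i w)%E.

Let V n i w := fine (U (odd n) (kap n i ^~ w) (W n i ^~ w)).

Lemma measurable_seg n i : measurable_fun setT (V n i).
Proof.
apply: measurableT_comp; first exact: fine_measurable.
by apply: mU => [t _ k|t _]; [exact: mkap|exact: mW].
Qed.

Let V0 n i w : 0 <= V n i w. Proof. exact: fine_ge0. Qed.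

Let FV n i A : measurable A -> Fam (inl (n, i)) (V n i @^-1` A).
Proof.
move=> mA; pose GT := g_sigma_algebraType (cyl_class (kap n i) (W n i)).
have mV : measurable_fun (setT : set GT) (V n i : GT -> R).
  have mf : measurable_fun setT (fine : \bar R -> R) by exact: fine_measurable.
  exact: (measurableT_comp mf (mU (odd n) (@cyl_mkap n i) (@cyl_mW n i))).
by have := mV measurableT A mA; rewrite setTI.
Qed.

Let same_V n i (F : R -> R) : (forall x, 0 <= F x) -> measurable_fun setT F ->
  (\int[P]_w (F (V n i w))%:E = \int[P]_w (F (V (par n) i w))%:E)%E.
Proof.
move=> F0 mF; rewrite /V par_odd.
apply: (same_integral (kap0 n i) (W0 n i) (mkap n i) (mW n i) (fdd n i)
  (kap0 (par n) i) (W0 (par n) i) (mkap (par n) i) (mW (par n) i) (fdd (par n) i)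
  (F := fun k' W' => (F (fine (U (odd n) k' W')))%:E)) => [k' W'|].
  by rewrite lee_fin.
apply/measurable_EFinP; apply: measurableT_comp => //.
apply: measurableT_comp; first exact: fine_measurable.
exact: (mU (odd n) (@measurable_kapS R m i) (@measurable_WS R m i)).
Qed.

Let mtau n i : measurable_fun setT (fun w => tau n i w).
Proof. by apply: measurable_tauF => [t _ k|t _]; [exact: mkap|exact: mW]. Qed.

Let V_le n i : (\int[P]_w (V n i w ^+ 2)%:E <= \int[P]_w ((fine (tau n i w)) ^+ 2)%:E)%E.
Proof.
apply: ae_ge0_le_integral => //.
- by move=> w _; rewrite lee_fin sqr_ge0.
- by apply/measurable_EFinP; apply: measurable_funX; exact: measurable_seg.
- by move=> w _; rewrite lee_fin sqr_ge0.
- apply/measurable_EFinP; apply: measurable_funX.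
  by apply: measurableT_comp (mtau n i); exact: fine_measurable.
apply: filterS (tau_fin n i) => w tw _.
have Ufin : U (odd n) (kap n i ^~ w) (W n i ^~ w) \is a fin_num.
  by rewrite ge0_fin_numE // (le_lt_trans (U_tau n i w)).
have tfin : tau n i w \is a fin_num by rewrite ge0_fin_numE // tauF_ge0.
by rewrite lee_fin ler_pXn2r ?nnegrE ?fine_ge0 ?tauF_ge0 // fine_le.
Qed.

Let V_sq n i : exists C : R, (\int[P]_w (V n i w ^+ 2)%:E <= C%:E)%E.
Proof.
have [C HC] := tau_sq b0 (kap0 n i) (W0 n i) (mkap n i) (mW n i) (fdd n i)
  (step n i) (cW n i) (path n i) (@push (odd n)).
by exists C; exact: le_trans (V_le n i) HC.
Qed.

Let iV n i : P.-integrable setT (EFin \o (fun w => V n i w ^+ 2)).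
Proof.
have [C HC] := V_sq n i; apply/integrableP; split.
  by apply/measurable_EFinP; apply: measurable_funX; exact: measurable_seg.
apply: le_lt_trans (ltry C); apply: le_trans HC.
rewrite le_eqVlt; apply/orP; left; apply/eqP; apply: eq_integral => w _ /=.
by rewrite ger0_norm // sqr_ge0.
Qed.

Lemma integrable_seg n i : P.-integrable setT (EFin \o V n i).
Proof.
have i1 : P.-integrable setT (EFin \o (fun _ : T => (1 : R) ^+ 2)).
  exact: finite_measure_integrable_cst.
have m1 : measurable_fun setT (fun _ : T => 1 : R) by exact: measurable_cst.
have := integrable_mul_sq (measurable_seg n i) m1 (iV n i) i1.
by apply: eq_integrable => // w _ /=; rewrite mulr1.
Qed.

Lemma segment_lln (c : R) (g : bool -> 'I_m -> R) :
  (forall (e : bool) i, \int[P]_w V e i w - c =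
     g e i - \sum_k \sum_l Hm e i k * Pj (~~ e) k l * g (~~ e) l) ->
  {ae P, forall w, (\sum_(k < n) V k (start k w) w) / n%:R @[n --> \oo] --> c}.
Proof.
move=> poisson.
have /choice[Cf HC] : forall x : nat * 'I_m, exists C : R,
    (\int[P]_w (V x.1 x.2 w ^+ 2)%:E <= C%:E)%E by move=> [n i]; exact: V_sq.
(* One constant must serve all segments: the laws depend on parity and phase only, so finitely many
   bounds are added. *)
have EV2 n i : \int[P]_w (V n i w ^+ 2) <= \sum_j (`|Cf (1%N, j)| + `|Cf (0%N, j)|).
  have -> : \int[P]_w (V n i w ^+ 2) = \int[P]_w (V (par n) i w ^+ 2).
    by congr fine; apply: (same_V n i (F := fun x => x ^+ 2)) => // x; exact: sqr_ge0.
  have le1 : \int[P]_w (V (par n) i w ^+ 2) <= Cf (par n, i).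
    rewrite -lee_fin; apply: le_trans (HC (par n, i)) => /=.
    by rewrite /Rintegral fineK // (integrable_fin_num measurableT (iV (par n) i)).
  apply: (le_trans le1); apply: (le_trans (ler_norm _)).
  rewrite (bigD1 i) //=.
  have : 0 <= \sum_(j < m | j != i) (`|Cf (1%N, j)| + `|Cf (0%N, j)|).
    by apply: sumr_ge0 => j _; rewrite addr_ge0.
  have := normr_ge0 (Cf (1%N, i)); have := normr_ge0 (Cf (0%N, i)).
  by rewrite /par; case: (odd n) => /=; lra.
have EV n i : \int[P]_w V n i w = \int[P]_w V (odd n) i w.
  (* [same_V] asks for a nonnegative function; the absolute value is one and does not change [V]. *)
  have mn : measurable_fun setT (fun x : R => `|x|) by exact: normr_measurable.
  have := same_V n i (@normr_ge0 R R) mn => E.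
  by congr fine; move: E; congr (_ = _); apply: eq_integral => w _; rewrite ger0_norm.
exact: (modulated_lln Fm FT FI indF i0 FL FJ FV (H := Hm) (Pj := Pj)
  (f := fun (e : bool) i => \int[P]_w V e i w) (g := g) PL PJ V0 iV EV EV2 poisson).
Qed.

End SegmentSums.

(** When all durations are finite, the left limit that selects the draw is [last], so the switching
    phases follow the abstract recursion [chain]. *)
Lemma start_phi w : (forall n i, (tau n i w < +oo)%E) -> forall n,
  phi n w = start n w /\
  theta n w = (\sum_(k < n) fine (tau k (start k w) w))%:E.
Proof.
move=> tw; have [_ [_ [_ [_ [_ [_ [_ /(_ w)[th0 [ph0 H]]]]]]]]] := HF.
elim=> [|n [IHp IHt]]; first by rewrite big_ord0.
have [thS [_ phS]] := H n.
have tfin : tau n (start n w) w \is a fin_num by rewrite ge0_fin_numE // tauF_ge0.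
have tE : tau n (start n w) w = (fine (tau n (start n w) w))%:E by rewrite fineK.
split.
  apply: (phS _ _ _ IHt); first by rewrite IHp hit_target tE.
  rewrite IHp.
  by apply/(last_left_lim (start n w) b0 (step n _) (cW n _) (path n _)).
by rewrite thS IHt IHp hit_target big_ord_recr EFinD fineK.
Qed.

Section Occupation.
Variables (x : R) (j : 'I_m).

(** Reflection maps the level set [[0, x]] to [[b - x, b]]. *)
Let lo (e : bool) : R := if e then b - x else 0.
Let hi (e : bool) : R := if e then b else x.

Definition seg_occ (e : bool) k' W' : \bar R := occG (dr e) (vo e) (lo e) (hi e) b j k' W'.

Lemma seg_occ_ge0 e k' W' : (0 <= seg_occ e k' W')%E.
Proof. exact: measure_ge0. Qed.

Lemma seg_occ_tau n i w : (seg_occ (odd n) (kap n i ^~ w) (W n i ^~ w) <= tau n i w)%E.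
Proof.
rewrite /seg_occ -occFE.
exact: (occ_le_tau b0 (mkap n i) (mW n i) (step n i) (cW n i) (path n i)).
Qed.

Lemma seg_occ_paths e : measurable_on_paths (seg_occ e).
Proof. exact: measurable_occ_paths. Qed.

Lemma occupation_segments w (cV cT : R) : (forall n i, (tau n i w < +oo)%E) -> 0 < cT ->
  (\sum_(k < n) fine (tau k (start k w) w)) / n%:R @[n --> \oo] --> cT ->
  (\sum_(k < n) fine (seg_occ (odd k) (kap k (start k w) ^~ w) (W k (start k w) ^~ w)))
    / n%:R @[n --> \oo] --> cV ->
  occupation (fun t => (0 <= Y t w <= x) && (rho t w == j)) t / t
    @[t --> +oo] --> cV / cT.
Proof.
move=> tw cT0 thc Vc.
pose ta n := fine (tau n (start n w) w).
have tE l : tau l (start l w) w = (ta l)%:E.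
  by rewrite fineK // ge0_fin_numE // tauF_ge0.
pose S l := xsection (occ_set (dr (odd l)) (vo (odd l)) (kap l (start l w))
  (W l (start l w)) (lo (odd l)) (hi (odd l)) b j) w.
have SE l : S l = [set s | [/\ 0 <= s, (s%:E < hit (Zf l (start l w) ^~ w) b)%E,
    lo (odd l) <= Zf l (start l w) s w <= hi (odd l) & kap l (start l w) s w = j]].
  exact: (occ_section b0 (step l _) (cW l _) (path l _)).
have hE l : hit (Zf l (start l w) ^~ w) b = (ta l)%:E.
  by rewrite -(tau_hit b0 (step l _) (cW l _) (path l _)).
apply: (@occupation_cvg R (fun n => \sum_(k < n) ta k) ta S) => //.
- by rewrite big_ord0.
- by move=> l; rewrite big_ord_recr.
- by move=> l; apply: (tau_pos b0 (step l _) (cW l _) (path l _)); exact: tE.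
- move=> l; apply: measurable_xsection; apply: measurable_occ_set => [t _ k|t _].
    exact: mkap.
  exact: mW.
- by move=> l s; rewrite SE => -[s0]; rewrite hE lte_fin s0.
- move=> l t /andP[lt tl]; rewrite SE /=.
  have [pE thE] := start_phi tw l; have [_ thE'] := start_phi tw l.+1.
  have [_ [_ [_ [_ [_ [_ [_ /(_ w)[_ [_ /(_ l)[_ [seg _]]]]]]]]]]] := HF.
  have [-> ->] := seg _ t thE lt (ltac:(by rewrite thE' lte_fin)).
  rewrite pE hE lte_fin subr_ge0 lt ltrBlDl.
  move: tl; rewrite big_ord_recr => /= ->.
  rewrite /lo /hi /Zf; split.
    move=> /andP[/andP[z0 zx] /eqP kj]; split=> //.
    by case: (odd l); rewrite ?z0 ?zx //; apply/andP; split; lra.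
  move=> [_ _ z /eqP ->]; rewrite andbT; move: z.
  by case: (odd l) => // /andP[z0 zx]; apply/andP; split; lra.
- apply: cvg_trans Vc; apply: near_eq_cvg; apply: nearW => n.
  by congr (_ / _); apply: eq_bigr => l _; rewrite /seg_occ -occFE.
Qed.

End Occupation.

Lemma hit_reflected n i w : hit (Z n i ^~ w) (seg_target b n) = hit (Zf n i ^~ w) b.
Proof. by rewrite hit_target (tau_hit b0 (step n i) (cW n i) (path n i)). Qed.

(** [fine] can be moved inside the integral because the occupation time is bounded by the duration,
    which is almost surely finite. *)
Lemma Mmat_seg_occ n x i j : Mmat P (kap n) (Z n) (seg_target b n) x i j =
  \int[P]_w fine (seg_occ x j (odd n) (kap n i ^~ w) (W n i ^~ w)).
Proof.
rewrite mxE; congr fine.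
transitivity (\int[P]_w seg_occ x j (odd n) (kap n i ^~ w) (W n i ^~ w))%E.
  apply: eq_integral => w _; rewrite hit_reflected /seg_occ -occFE.
  apply: (occ_integral b0 (mkap n i) (mW n i) (step n i) (cW n i) (path n i)) => s _.
  rewrite /Zf; case: (odd n) => //.
  by apply/idP/idP => /andP[z0 zx]; apply/andP; split; lra.
have mU : measurable_fun setT (fun w => seg_occ x j (odd n) (kap n i ^~ w) (W n i ^~ w)).
  by apply: seg_occ_paths => [t _ k|t _]; [exact: mkap|exact: mW].
apply: ge0_ae_eq_integral => //.
- by apply/measurable_EFinP; apply: measurableT_comp mU; exact: fine_measurable.
- by move=> w _; rewrite lee_fin fine_ge0 // seg_occ_ge0.
apply: filterS (tau_fin n i) => w tw _.
rewrite /= fineK // ge0_fin_numE ?seg_occ_ge0 //.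
exact: le_lt_trans (seg_occ_tau x j n i w) tw.
Qed.

Let U_tau (e : bool) k' W' : \bar R := tauF (dr e) (vo e) k' W' b.

Let U_tau0 e k' W' : (0 <= U_tau e k' W')%E. Proof. exact: tauF_ge0. Qed.

Let mU_tau e : measurable_on_paths (U_tau e). Proof. exact: measurable_tau_paths. Qed.

Let iocc x n i j : P.-integrable setT
  (EFin \o (fun w => fine (seg_occ x j (odd n) (kap n i ^~ w) (W n i ^~ w)))).
Proof.
exact: (integrable_seg (@seg_occ_ge0 x j) (@seg_occ_paths x j) (@seg_occ_tau x j)).
Qed.

Let itau n i : P.-integrable setT (EFin \o (fun w => fine (tau n i w))).
Proof. by apply: (integrable_seg U_tau0 mU_tau) => n' i' w. Qed.

Lemma mean_tau n i : \int[P]_w fine (tau n i w) =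
  \sum_j Mmat P (kap n) (Z n) (seg_target b n) b i j.
Proof.
under eq_bigr do rewrite Mmat_seg_occ.
rewrite -Rintegral_big_sum; last by move=> j; exact: iocc.
congr fine; apply: ae_eq_integral => //.
- by have /integrableP[] := itau n i.
- by have /integrableP[] := integrable_big_sum (index_enum 'I_m) (iocc b n i).
apply: filterS (tau_fin n i) => w tw _ /=; congr EFin.
have ofin j : seg_occ b j (odd n) (kap n i ^~ w) (W n i ^~ w) \is a fin_num.
  by rewrite ge0_fin_numE ?seg_occ_ge0 // (le_lt_trans (seg_occ_tau b j n i w)).
apply/EFin_inj; rewrite -sumEFin fineK; last by rewrite ge0_fin_numE // tauF_ge0.
rewrite -(occ_total b0 (mkap n i) (mW n i) (step n i) (cW n i) (path n i)).
apply: eq_bigr => j _; rewrite fineK // /seg_occ -occFE subrr.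
by case: (odd n).
Qed.

(** A zero mean would force the duration to vanish almost surely, but a finite hitting time of [b]
    from 0 is positive. *)
Lemma mean_tau_gt0 n i : 0 < \int[P]_w fine (tau n i w).
Proof.
rewrite lt_def Rintegral_ge0 ?andbT; last by move=> w _; rewrite fine_ge0 // tauF_ge0.
apply/negP => /eqP E0.
have I0 : (\int[P]_w `|(fine (tau n i w))%:E| = 0)%E.
  have -> : (\int[P]_w `|(fine (tau n i w))%:E| = \int[P]_w (fine (tau n i w))%:E)%E.
    by apply: eq_integral => w _; rewrite gee0_abs // lee_fin fine_ge0 // tauF_ge0.
  rewrite -[LHS]fineK; last exact: (integrable_fin_num measurableT (itau n i)).
  by congr EFin.
have mt : measurable_fun setT (fun w => (fine (tau n i w))%:E).
  by have /integrableP[] := itau n i.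
have /(ae_eq_integral_abs P measurableT mt) H := I0.
have : {ae P, forall w : T, False}.
  apply: filterS2 H (tau_fin n i) => w /(_ I) /= [tw0] tw.
  have tE : tau n i w = (fine (tau n i w))%:E by rewrite fineK // ge0_fin_numE // tauF_ge0.
  by have := tau_pos b0 (step n i) (cW n i) (path n i) tE; rewrite tw0 ltxx.
move=> [N [mN N0 sub]].
have : P setT = 0%E.
  by apply/eqP; rewrite eq_le measure_ge0 andbT -N0 le_measure ?inE // => w _; exact: sub.
by rewrite probability_setT => /eqP; rewrite onee_eq0.
Qed.

Section Stationary.
Variable nu0 : 'rV[R]_m.
Let nub := nu0 *m Hm false *m Pb.
Hypothesis sPb : stochastic Pb.
Hypothesis nu0_neq0 : nu0 != 0.
Hypothesis nu0_ge0 : forall i, 0 <= nu0 0 i.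
Hypothesis nu0_solve : forall f0 fb : 'cV[R]_m, nu0 *m f0 + nub *m fb = 0 ->
  exists g0 gb : 'cV[R]_m,
    f0 = g0 - Hm false *m Pb *m gb /\ fb = gb - Hm true *m Pc *m g0.

Let nub_ge0 i : 0 <= nub 0 i.
Proof.
rewrite mxE sumr_ge0 // => l _; rewrite mulr_ge0 //; last by case: sPb.
by rewrite mxE sumr_ge0 // => k _; rewrite mulr_ge0 //; case: (Hm_stochastic false).
Qed.

Let mass := \sum_i nu0 0 i + \sum_i nub 0 i.

Let nu0_pos : exists i, 0 < nu0 0 i.
Proof.
apply/not_existsP => H; case/eqP: nu0_neq0; apply/rowP => i; rewrite mxE.
by apply/eqP; rewrite eq_le nu0_ge0 andbT leNgt; apply/negP; exact: H.
Qed.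

Let mass_gt0 : 0 < mass.
Proof.
have [i i1] := nu0_pos; apply: ltr_wpDr; first by apply: sumr_ge0 => k _; exact: nub_ge0.
by rewrite (bigD1 i) //= ltr_wpDr // sumr_ge0.
Qed.

Let mulmx3E (A B : 'M[R]_m) (u : 'cV[R]_m) i :
  (A *m B *m u) i 0 = \sum_k \sum_l A i k * B k l * u l 0.
Proof.
rewrite mxE; under eq_bigr do rewrite mxE mulr_suml.
by rewrite exchange_big.
Qed.

(** The limit is the mean of [f] under the normalised pair [(nu0, nub)]; subtracting it makes the
    right-hand side orthogonal to this pair, which is the solvability condition of the Poisson
    equation. *)
Lemma segment_lln_mean (U : bool -> (R -> 'I_m) -> (R -> R) -> \bar R) :
  (forall e k w, (0 <= U e k w)%E) -> (forall e, measurable_on_paths (U e)) ->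
  (forall n i w, (U (odd n) (kap n i ^~ w) (W n i ^~ w) <= tau n i w)%E) ->
  let V n i w := fine (U (odd n) (kap n i ^~ w) (W n i ^~ w)) in
  let f n := \col_i \int[P]_w V n i w in
  {ae P, forall w, (\sum_(k < n) V k (start k w) w) / n%:R @[n --> \oo] -->
    (nu0 *m f 0%N + nub *m f 1%N) 0 0 / mass}.
Proof.
move=> U0 mU Ut V f; set c := _ / mass.
have [g0 [gb [E0 Eb]]] : exists g0 gb : 'cV[R]_m,
    f 0%N - const_mx c = g0 - Hm false *m Pb *m gb /\
    f 1%N - const_mx c = gb - Hm true *m Pc *m g0.
  apply: nu0_solve; rewrite !mulmxBr addrACA -opprD.
  apply/rowP => i; rewrite (ord1 i) [in LHS]mxE [X in _ + X]mxE.
  have -> : (nu0 *m const_mx c + nub *m (const_mx c : 'cV[R]_m)) 0 0 = mass * c.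
    rewrite mxE [X in X + _]mxE [X in _ + X]mxE /mass mulrDl !mulr_suml.
    by congr (_ + _); apply: eq_bigr => k _; congr (_ * _); rewrite mxE.
  by rewrite /c mulrC divfK ?gt_eqF // subrr mxE.
apply: (segment_lln U0 mU Ut (g := fun e i => if e then gb i 0 else g0 i 0)) => e i.
have subE (u v : 'cV[R]_m) : (u - v) i 0 = u i 0 - v i 0 by rewrite !mxE.
have fE n : f n i 0 = \int[P]_w V n i w by rewrite mxE.
have cE : (const_mx c : 'cV[R]_m) i 0 = c by rewrite mxE.
case: e.
  have := congr1 (fun u : 'cV[R]_m => u i 0) Eb.
  by rewrite !subE fE cE mulmx3E.
have := congr1 (fun u : 'cV[R]_m => u i 0) E0.
by rewrite !subE fE cE mulmx3E.
Qed.

Let M x := col_mx (Mmat P (kap 0%N) (Z 0%N) b x) (Mmat P (kap 1%N) (Z 1%N) 0 x).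
Let nu := row_mx nu0 nub.

(** All mean durations are positive, all weights are nonnegative, and some entry of [nu0] is
    positive. *)
Lemma mean_cycle_gt0 : 0 < (nu *m (M b *m (const_mx 1 : 'cV[R]_m))) 0 0.
Proof.
rewrite mul_col_mx mul_row_col mxE.
have E n i : (Mmat P (kap n) (Z n) (seg_target b n) b *m const_mx 1 : 'cV[R]_m) i 0 =
    \int[P]_w fine (tau n i w).
  by rewrite mxE mean_tau; apply: eq_bigr => j _; rewrite [X in _ * X]mxE mulr1.
have [i i1] := nu0_pos; apply: ltr_wpDr; rewrite mxE.
  apply: sumr_ge0 => k _; rewrite mulr_ge0 ?nub_ge0 //.
  by rewrite (E 1%N k) ltW // mean_tau_gt0.
rewrite (bigD1 i) //= ltr_wpDr //; last by rewrite mulr_gt0 // (E 0%N i) mean_tau_gt0.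
by apply: sumr_ge0 => k _; rewrite mulr_ge0 // (E 0%N k) ltW // mean_tau_gt0.
Qed.

Lemma occ_frac_cvg x : {ae P, forall w, forall j,
  occ_frac Y rho x j Tm w @[Tm --> +oo] -->
    ((nu *m (M b *m (const_mx 1 : 'cV[R]_m))) 0 0)^-1 * (nu *m M x) 0 j}.
Proof.
have occ_lln j := segment_lln_mean (@seg_occ_ge0 x j) (@seg_occ_paths x j) (@seg_occ_tau x j).
have tau_lln := segment_lln_mean U_tau0 mU_tau (fun n i w => lexx (tau n i w)).
have all_lln : {ae P, forall w, forall k (km : (k < m)%N), 
  (\sum_(l < n) fine (seg_occ x (Ordinal km) (odd l) (kap l (start l w) ^~ w)
      (W l (start l w) ^~ w))) / n%:R @[n --> \oo] --> (nu *m M x) 0 (Ordinal km) / mass}.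
  apply: ae_foralln => k; have [km|km] := pselect (k < m)%N; last by apply: filterE.
  apply: filterS (occ_lln (Ordinal km)) => w cw km'; rewrite (bool_irrelevance km' km).
  move: cw; congr (_ --> _); congr (_ / _).
  rewrite mul_row_col [LHS]mxE [RHS]mxE; congr (_ + _); rewrite [LHS]mxE [RHS]mxE;
    apply: eq_bigr => i _; congr (_ * _); rewrite [LHS]mxE.
    exact: (esym (Mmat_seg_occ 0%N x i (Ordinal km))).
  exact: (esym (Mmat_seg_occ 1%N x i (Ordinal km))).
have := all_tau_finite.
apply: filterS3 all_lln tau_lln => w occ_w tau_w tw j.
pose th n := \sum_(l < n) fine (tau l (start l w) w).
pose cT := (nu *m (M b *m (const_mx 1 : 'cV[R]_m))) 0 0 / mass.
have {}tau_w : th n / n%:R @[n --> \oo] --> cT.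
  move: tau_w; congr (_ --> _); congr (_ / _).
  rewrite mul_col_mx mul_row_col [LHS]mxE [RHS]mxE; congr (_ + _); rewrite [LHS]mxE [RHS]mxE;
    apply: eq_bigr => i _; congr (_ * _); rewrite [LHS]mxE [RHS]mxE.
    rewrite (mean_tau 0%N i); apply: eq_bigr => k _.
    by rewrite [X in _ = _ * X]mxE mulr1.
  rewrite (mean_tau 1%N i); apply: eq_bigr => k _.
  by rewrite [X in _ = _ * X]mxE mulr1.
have cT0 : 0 < cT by rewrite divr_gt0 // mean_cycle_gt0.
have {}occ_w : (\sum_(l < n) fine (seg_occ x j (odd l) (kap l (start l w) ^~ w)
      (W l (start l w) ^~ w))) / n%:R @[n --> \oo] --> (nu *m M x) 0 j / mass.
  by case: j occ_w => k km; exact.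
have lim := occupation_segments tw cT0 tau_w occ_w.
suff -> : ((nu *m (M b *m (const_mx 1 : 'cV[R]_m))) 0 0)^-1 * (nu *m M x) 0 j =
    (nu *m M x) 0 j / mass / cT.
  apply: cvg_trans lim; apply: near_eq_cvg; apply: nearW => t.
  by rewrite /occ_frac mulrC.
(* The normalising [mass] occurs in both limits and cancels in their ratio. *)
by rewrite /cT; field; rewrite !gt_eqF // mean_cycle_gt0.
Qed.

End Stationary.

Lemma stationary_occupation : (0 < m)%N -> stochastic Pc -> stochastic Pb ->
  let H0 := Hmat P (kap 0%N) (Z 0%N) b in
  let Hb := Hmat P (kap 1%N) (Z 1%N) 0 in
  let M0 := Mmat P (kap 0%N) (Z 0%N) b in
  let Mb := Mmat P (kap 1%N) (Z 1%N) 0 in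
  irreducible_mx (Dinf Pc Pb H0 Hb) ->
  exists nu0 : 'rV[R]_m,
    [/\ nu0 != 0,
        nu0 = nu0 *m H0 *m Pb *m Hb *m Pc,
        (forall nu' : 'rV[R]_m, nu' = nu' *m H0 *m Pb *m Hb *m Pc ->
           exists c : R, nu' = c *: nu0) &
        let nu := row_mx nu0 (nu0 *m H0 *m Pb) in
        let mvec : 'cV[R]_(m + m) := col_mx (M0 b) (Mb b) *m const_mx 1 in
        (nu *m mvec) ord0 ord0 != 0 /\
        forall x, {ae P, forall w, forall j : 'I_m,
          occ_frac Y rho x j Tm w @[Tm --> +oo] -->
          ((nu *m mvec) ord0 ord0)^-1 * (nu *m col_mx (M0 x) (Mb x)) ord0 j}].
Proof.
move=> m0 sPc sPb H0 Hb M0 Mb.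
have E0 : H0 = Hm false := esym (HmE false).
have Eb : Hb = Hm true := esym (HmE true).
rewrite E0 Eb => irr.
have [nu0 [[nz ge0] inv uni solve]] := alternating_invariant m0 sPc sPb
  (Hm_stochastic false) (Hm_stochastic true) irr.
exists nu0; split=> // nu mvec; split.
  by rewrite gt_eqF // mean_cycle_gt0.
by move=> x; exact: occ_frac_cvg.
Qed.

End FlexibleProcess.

Theorem theorem2p2 (R : realType) (m : nat) (d : measure_display)
  (T : measurableType d) (P : probability T R) (Q : 'M[R]_m)
  (mu sigma : 'I_m -> R) (b : R) (Pc Pb : 'M[R]_m) (i0 : 'I_m)
  (kap : nat -> 'I_m -> R -> T -> 'I_m) (W : nat -> 'I_m -> R -> T -> R)
  (Z : nat -> 'I_m -> R -> T -> R) (J : nat -> 'I_m -> T -> 'I_m)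
  (theta : nat -> T -> \bar R) (phi : nat -> T -> 'I_m)
  (Y : R -> T -> R) (rho : R -> T -> 'I_m) :
  (0 < m)%N -> generator Q -> (forall i, 0 < sigma i) -> 0 < b ->
  stochastic Pc -> stochastic Pb ->
  flexible_MMBM P Q mu sigma b Pc Pb i0 kap W Z J theta phi Y rho ->
  let H0 := Hmat P (kap 0%N) (Z 0%N) b in
  let Hb := Hmat P (kap 1%N) (Z 1%N) 0 in
  let M0 := Mmat P (kap 0%N) (Z 0%N) b in
  let Mb := Mmat P (kap 1%N) (Z 1%N) 0 in
  irreducible_mx (Dinf Pc Pb H0 Hb) ->
  exists nu0 : 'rV[R]_m,
    [/\ nu0 != 0,
        nu0 = nu0 *m H0 *m Pb *m Hb *m Pc,
        (forall nu' : 'rV[R]_m, nu' = nu' *m H0 *m Pb *m Hb *m Pc ->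
           exists c : R, nu' = c *: nu0) &
        let nu := row_mx nu0 (nu0 *m H0 *m Pb) in
        let mvec : 'cV[R]_(m + m) := col_mx (M0 b) (Mb b) *m const_mx 1 in
        (nu *m mvec) ord0 ord0 != 0 /\
        forall x, 0 <= x <= b ->
          {ae P, forall w, forall j : 'I_m,
             occ_frac Y rho x j Tm w @[Tm --> +oo] -->
             ((nu *m mvec) ord0 ord0)^-1 * (nu *m col_mx (M0 x) (Mb x)) ord0 j}].
Proof.
move=> m0 _ sg0 b0 sPc sPb HF H0 Hb M0 Mb irr.
have [nu0 [nz inv uni [mz lim]]] := stationary_occupation sg0 b0 HF m0 sPc sPb irr.
by exists nu0; split=> //; split=> // x _; exact: lim.
Qed.
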